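(* Let $\mathrm{Aut}\,\mathcal{D}_q(\mathfrak{b}_{m,n})$ be the group of $\mathbb{K}$-algebra automorphisms of $\mathcal{D}_q(\mathfrak{b}_{m,n})$. 1. For any $z_1,z_2\in\mathbb{K}^*$, let $\zeta_{z_1,z_2}\in\mathrm{Aut}\,\mathcal{D}_q(\mathfrak{b}_{m,n})$ be defined by $K\mapsto z_1K$, $a\mapsto z_2a$, $\zeta_{z_1,z_2}|_S=\mathrm{id}_S$. Then $\{\zeta_{z_1,z_2}\mid z_1,z_2\in\mathbb{K}^*\}\cong(\mathbb{K}^* )^2$. 2. For any $A=(A_{i,j})\in SL_2(\mathbb{Z})$, let $\rho_A\in\mathrm{Aut}\,\mathcal{D}_q(\mathfrak{b}_{m,n})$ be defined by $K\mapsto K^{A_{1,1}}a^{A_{2,1}}$, $a\mapsto K^{A_{1,2}}a^{A_{2,2}}$, $\rho_A|_S=\mathrm{id}_S$. The subgroup generated by all $\zeta_{z_1,z_2}$ ($z_1,z_2\in\mathbb{K}^*$) and all $\rho_A$ ($A\in SL_2(\mathbb{Z})$) is isomorphic to $(\mathbb{K}^* )^2\rtimes SL_2(\mathbb{Z})$. 3. For any $z_3,z_4\in\mathbb{K}^*$, let $\xi_{z_3,z_4}\in\mathrm{Aut}\,\mathcal{D}_q(\mathfrak{b}_{m,n})$ be defined by $K\mapsto K$, $a\mapsto a$, $E'\mapsto z_3E'$, $F'\mapsto z_4F'$, $c'\mapsto z_3^{-1}c'$, $b'\mapsto z_4^{-1}b'$. Then $\{\xi_{z_3,z_4}\mid z_3,z_4\in\mathbb{K}^*\}\cong(\mathbb{K}^*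 )^2$. 4. $\mathrm{Aut}\,\mathcal{D}_q(\mathfrak{b}_{m,n})\cong\big((\mathbb{K}^* )^2\rtimes SL_2(\mathbb{Z})\big)\times(\mathbb{K}^* )^2$.
   Context: $\mathbb{K}$ is an algebraically closed field of characteristic zero, $\mathbb{K}^*=\mathbb{K}\setminus\{0\}$, $q\in\mathbb{K}^*$ is not a root of unity, and $m,n$ are nonzero integers. The Heisenberg double $\mathcal{D}_q(\mathfrak{b}_{m,n})$ is the unital associative $\mathbb{K}$-algebra generated by $a,a^{-1},b,c,K,K^{-1},E,F$ subject to the relations $ab=q^nba$, $ac=q^mca$, $bc=cb$, $aa^{-1}=a^{-1}a=1$; $KE=q^{2m}EK$, $KF=q^{-2n}FK$, $EF=FE$, $KK^{-1}=K^{-1}K=1$; $Ka=q^{-1}aK$, $Kb=q^nbK$, $Kc=q^{-m}cK$; $Ea=aE$, $Eb=bE$, $Ec=cE+a^{-m}K^m$; $Fa=q^naF$, $Fb=q^{-n^2}bF+a^n$, $Fc=q^{mn}cF$. Put $b'=a^nbK^{-n}$, $c'=a^{-m}cK^{-m}$, $E'=a^{2m}E$, $F'=q^{-n^2}a^{-2n}FK^n$, and let $S$ be the subalgebra generated by $b',c',E',F'$. The algebra $\mathcal{D}_q(\mathfrak{b}_{m,n})$ is generated by $a^{\pm1},K^{\pm1},b',c',E',F'$; elements of $S$ commute with $K$ and $a$; and $\mathcal{D}_q(\mathfrak{b}_{m,n})\cong\mathbb{K}[K^{\pm1},a^{\pm1}]\otimes S$, where $\mathbb{K}[K^{\pm1},a^{\pm1}]$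 is the subalgebra generated by $K^{\pm1},a^{\pm1}$ (a quantum torus). In $(\mathbb{K}^* )^2\rtimes SL_2(\mathbb{Z})$ the group $SL_2(\mathbb{Z})$ acts on $(\mathbb{K}^* )^2$ by the action induced by conjugation of the $\zeta_{z_1,z_2}$ by the $\rho_A$: with $B=A^{-1}$, $A\cdot(z_1,z_2)=(z_1^{B_{1,1}}z_2^{B_{2,1}},\,z_1^{B_{1,2}}z_2^{B_{2,2}})$. *)

(* Defs.v *)
From HB Require Import structures.
From mathcomp Require Import all_boot all_order all_algebra.
From mathcomp Require Import ring boolp classical_sets.
Set Implicit Arguments.
Unset Strict Implicit.
Unset Printing Implicit Defensive.
Import GRing.Theory.
Local Open Scope quotient_scope.
Local Open Scope ring_scope.

(* Presented algebras: the unital associative K-algebra generated by G        *)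
(* subject to the relations R is the quotient of the noncommutative           *)
(* polynomial expressions over K in G by the smallest congruence that         *)
(* contains R and the axioms of K-algebras. A scalar c : K is identified      *)
(* with c.1, so that the opposite is the multiplication by -1.                *)

Inductive pexpr (K G : Type) :=
  | PXcst of K
  | PXgen of G
  | PXadd of pexpr K G & pexpr K G
  | PXmul of pexpr K G & pexpr K G.

Arguments PXcst {K G}.
Arguments PXgen {K G}.

HB.instance Definition _ (K G : Type) := gen_eqMixin (pexpr K G).
HB.instance Definition _ (K G : Type) := gen_choiceMixin (pexpr K G).

Declare Scope pexpr_scope.
Delimit Scope pexpr_scope with PX.
Bind Scope pexpr_scope with pexpr.
Notation "x + y" := (PXadd x y) : pexpr_scope.
Notation "x * y" := (PXmul x y) : pexpr_scope.
Notation "c %:PX" := (PXcst c) (at level 1, left associativity, format "c %:PX").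

(* x ^ z for z : int, where y stands for the inverse of x *)
Definition pxexpz (K : fieldType) G (x y : pexpr K G) (z : int) : pexpr K G :=
  match z with
  | Posz k => iter k (PXmul x) 1%:PX
  | Negz k => iter k.+1 (PXmul y) 1%:PX
  end.

Section Presented.
Variables (K : fieldType) (G : Type).
Local Notation T := (pexpr K G).
Variable R : T -> T -> Prop.

Inductive pres_cong : T -> T -> Prop :=
  | pc_rel x y : R x y -> pres_cong x y
  | pc_refl x : pres_cong x x
  | pc_sym x y : pres_cong x y -> pres_cong y x
  | pc_trans x y z : pres_cong x y -> pres_cong y z -> pres_cong x z
  | pc_add x x' y y' : pres_cong x x' -> pres_cong y y' ->
      pres_cong (x + y)%PX (x' + y')%PX
  | pc_mul x x' y y' : pres_cong x x' -> pres_cong y y' ->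
      pres_cong (x * y)%PX (x' * y')%PX
  | pc_addA x y z : pres_cong (x + (y + z))%PX (x + y + z)%PX
  | pc_addC x y : pres_cong (x + y)%PX (y + x)%PX
  | pc_add0 x : pres_cong (0%:PX + x)%PX x
  | pc_mulA x y z : pres_cong (x * (y * z))%PX (x * y * z)%PX
  | pc_mul1l x : pres_cong (1%:PX * x)%PX x
  | pc_mul1r x : pres_cong (x * 1%:PX)%PX x
  | pc_mulDl x y z : pres_cong ((x + y) * z)%PX (x * z + y * z)%PX
  | pc_mulDr x y z : pres_cong (x * (y + z))%PX (x * y + x * z)%PX
  | pc_mul0 x : pres_cong (0%:PX * x)%PX 0%:PX
  | pc_cstD c d : pres_cong (c + d)%:PX (c%:PX + d%:PX)%PX
  | pc_cstM c d : pres_cong (c * d)%:PX (c%:PX * d%:PX)%PX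
  | pc_cstC c x : pres_cong (c%:PX * x)%PX (x * c%:PX)%PX.

Definition pres_eqv : rel T := fun x y => `[< pres_cong x y >].

Lemma pres_eqv_equiv : equiv_class_of pres_eqv.
Proof.
split=> [x|x y|y x z].
- by apply/asboolP; apply: pc_refl.
- by apply/asboolP/asboolP => ?; apply: pc_sym.
- by move=> /asboolP xy /asboolP yz; apply/asboolP; apply: pc_trans xy yz.
Qed.

Canonical pres_equiv := EquivRelPack pres_eqv_equiv.

Definition presented : Type := {eq_quot pres_eqv}.
HB.instance Definition _ := Choice.on presented.
HB.instance Definition _ : EqQuotient T pres_eqv presented :=
  EqQuotient.on presented.

Lemma pres_eqP (x y : T) : pres_cong x y -> \pi_presented x = \pi_presented y.
Proof. by move=> xy; apply/eqP; rewrite eqmodE /=; apply/asboolP. Qed.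

Lemma pres_eqK (x y : T) : \pi_presented x = \pi_presented y -> pres_cong x y.
Proof. by move/eqP; rewrite eqmodE /= => /asboolP. Qed.

Lemma pres_repr (x : T) : pres_cong (repr (\pi_presented x)) x.
Proof. by apply: pres_eqK; rewrite reprK. Qed.

Definition pcst (c : K) : presented := \pi_presented c%:PX.
Definition pgen (g : G) : presented := \pi_presented (PXgen g).
Definition padd (x y : presented) : presented := \pi_presented (repr x + repr y)%PX.
Definition pmul (x y : presented) : presented := \pi_presented (repr x * repr y)%PX.
Definition popp (x : presented) : presented := pmul (pcst (-1)) x.
Definition pscale (c : K) (x : presented) : presented := pmul (pcst c) x.

Lemma piD (x y : T) : \pi_presented (x + y)%PX = padd (\pi_presented x) (\pi_presented y).
Proof. by apply: pres_eqP; apply: pc_add; apply: pc_sym; apply: pres_repr. Qed.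

Lemma piM (x y : T) : \pi_presented (x * y)%PX = pmul (\pi_presented x) (\pi_presented y).
Proof. by apply: pres_eqP; apply: pc_mul; apply: pc_sym; apply: pres_repr. Qed.

Lemma paddA : associative padd.
Proof.
by elim/quotW=> x; elim/quotW=> y; elim/quotW=> z;
   rewrite -(piD y z) -(piD x y) -!piD; apply: pres_eqP; apply: pc_addA.
Qed.

Lemma paddC : commutative padd.
Proof.
by elim/quotW=> x; elim/quotW=> y; rewrite -!piD; apply: pres_eqP; apply: pc_addC.
Qed.

Lemma padd0 : left_id (pcst 0) padd.
Proof. by elim/quotW=> x; rewrite -piD; apply: pres_eqP; apply: pc_add0. Qed.

Lemma pmulA : associative pmul.
Proof.
by elim/quotW=> x; elim/quotW=> y; elim/quotW=> z;
   rewrite -(piM y z) -(piM x y) -!piM; apply: pres_eqP; apply: pc_mulA.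
Qed.

Lemma pmul1l : left_id (pcst 1) pmul.
Proof. by elim/quotW=> x; rewrite -piM; apply: pres_eqP; apply: pc_mul1l. Qed.

Lemma pmul1r : right_id (pcst 1) pmul.
Proof. by elim/quotW=> x; rewrite -piM; apply: pres_eqP; apply: pc_mul1r. Qed.

Lemma pmulDl : left_distributive pmul padd.
Proof.
by elim/quotW=> x; elim/quotW=> y; elim/quotW=> z;
   rewrite -(piD x y) -!piM -piD; apply: pres_eqP; apply: pc_mulDl.
Qed.

Lemma pmulDr : right_distributive pmul padd.
Proof.
by elim/quotW=> x; elim/quotW=> y; elim/quotW=> z;
   rewrite -(piD y z) -!piM -piD; apply: pres_eqP; apply: pc_mulDr.
Qed.

Lemma pmul0 x : pmul (pcst 0) x = pcst 0.
Proof. by elim/quotW: x => x; rewrite -piM; apply: pres_eqP; apply: pc_mul0. Qed.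

Lemma pcstD c d : pcst (c + d) = padd (pcst c) (pcst d).
Proof. by rewrite -piD; apply: pres_eqP; apply: pc_cstD. Qed.

Lemma pcstM c d : pcst (c * d) = pmul (pcst c) (pcst d).
Proof. by rewrite -piM; apply: pres_eqP; apply: pc_cstM. Qed.

Lemma pcstC c x : pmul (pcst c) x = pmul x (pcst c).
Proof. by elim/quotW: x => x; rewrite -!piM; apply: pres_eqP; apply: pc_cstC. Qed.

Lemma paddN : left_inverse (pcst 0) popp padd.
Proof.
move=> x; rewrite -[X in padd _ X]pmul1l /popp -pmulDl -pcstD addNr.
exact: pmul0.
Qed.

HB.instance Definition _ :=
  GRing.isZmodule.Build presented paddA paddC padd0 paddN.

HB.instance Definition _ :=
  GRing.Zmodule_isPzRing.Build presented pmulA pmul1l pmul1r pmulDl pmulDr.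

Lemma pscaleA c d x : pscale c (pscale d x) = pscale (c * d) x.
Proof. by rewrite /pscale pmulA -pcstM. Qed.

Lemma pscale1 : left_id 1 pscale.
Proof. exact: pmul1l. Qed.

Lemma pscaleDr : right_distributive pscale +%R.
Proof. by move=> c x y; apply: pmulDr. Qed.

Lemma pscaleDl x : {morph pscale^~ x : c d / c + d}.
Proof. by move=> c d; rewrite /pscale pcstD pmulDl. Qed.

HB.instance Definition _ :=
  GRing.Zmodule_isLmodule.Build K presented pscaleA pscale1 pscaleDr pscaleDl.

Lemma pscaleAl c (x y : presented) : c *: (x * y) = (c *: x) * y.
Proof. exact: pmulA. Qed.

Lemma pscaleAr c (x y : presented) : c *: (x * y) = x * (c *: y).
Proof.
rewrite -[LHS]/(pmul (pcst c) (pmul x y)) -[RHS]/(pmul x (pmul (pcst c) y)).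
by rewrite !pmulA (pcstC c x).
Qed.

End Presented.

Definition kstar (K : fieldType) : Type := {x : K | x != 0}.

Section Kstar.
Variable K : fieldType.
HB.instance Definition _ := SubChoice.on (kstar K).
Implicit Types x y z : kstar K.

Definition kstar_one : kstar K := Sub 1 (oner_neq0 K).
Lemma kstar_mul_subproof x y : val x * val y != 0.
Proof. by rewrite mulf_neq0 ?(valP x) ?(valP y). Qed.
Definition kstar_mul x y : kstar K := Sub (val x * val y) (kstar_mul_subproof x y).
Lemma kstar_inv_subproof x : (val x)^-1 != 0.
Proof. by rewrite invr_neq0 ?(valP x). Qed.
Definition kstar_inv x : kstar K := Sub (val x)^-1 (kstar_inv_subproof x).
Lemma kstar_expz_subproof x (e : int) : val x ^ e != 0.
Proof. by rewrite expfz_neq0 ?(valP x). Qed.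
Definition kstar_expz x e : kstar K := Sub (val x ^ e) (kstar_expz_subproof x e).

Lemma kstar_mulA : associative kstar_mul.
Proof. by move=> x y z; apply: val_inj => /=; rewrite mulrA. Qed.
Lemma kstar_mul1 : left_id kstar_one kstar_mul.
Proof. by move=> x; apply: val_inj => /=; rewrite mul1r. Qed.
Lemma kstar_mulr1 : right_id kstar_one kstar_mul.
Proof. by move=> x; apply: val_inj => /=; rewrite mulr1. Qed.
Lemma kstar_mulV : left_inverse kstar_one kstar_inv kstar_mul.
Proof. by move=> x; apply: val_inj => /=; rewrite mulVf ?(valP x). Qed.
Lemma kstar_mulrV : right_inverse kstar_one kstar_inv kstar_mul.
Proof. by move=> x; apply: val_inj => /=; rewrite divff ?(valP x). Qed.

HB.instance Definition _ := isGroup.Build (kstar K)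
  kstar_mulA kstar_mul1 kstar_mulr1 kstar_mulV kstar_mulrV.
End Kstar.

Definition SL2Z : Type := {A : 'M[int]_2 | \det A == 1}.

HB.instance Definition _ := SubChoice.on SL2Z.

Section SL2Z.
Implicit Types A B C : SL2Z.

Lemma SL2Z_det A : \det (val A) = 1. Proof. exact/eqP/(valP A). Qed.

Lemma SL2Z_one_subproof : \det (1%:M : 'M[int]_2) == 1.
Proof. by rewrite det1. Qed.
Definition SL2Z_one : SL2Z := Sub 1%:M SL2Z_one_subproof.
Lemma SL2Z_mul_subproof A B : \det (val A *m val B) == 1.
Proof. by rewrite det_mulmx !SL2Z_det mulr1. Qed.
Definition SL2Z_mul A B : SL2Z := Sub (val A *m val B) (SL2Z_mul_subproof A B).
Lemma SL2Z_inv_subproof A : \det (invmx (val A)) == 1.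
Proof. by rewrite det_inv SL2Z_det invr1. Qed.
Definition SL2Z_inv A : SL2Z := Sub (invmx (val A)) (SL2Z_inv_subproof A).

Lemma SL2Z_unit A : val A \in unitmx.
Proof. by rewrite unitmxE SL2Z_det unitr1. Qed.

Lemma SL2Z_mulA : associative SL2Z_mul.
Proof. by move=> A B C; apply: val_inj => /=; rewrite mulmxA. Qed.
Lemma SL2Z_mul1 : left_id SL2Z_one SL2Z_mul.
Proof. by move=> A; apply: val_inj => /=; rewrite mul1mx. Qed.
Lemma SL2Z_mulr1 : right_id SL2Z_one SL2Z_mul.
Proof. by move=> A; apply: val_inj => /=; rewrite mulmx1. Qed.
Lemma SL2Z_mulV : left_inverse SL2Z_one SL2Z_inv SL2Z_mul.
Proof. by move=> A; apply: val_inj => /=; rewrite mulVmx ?SL2Z_unit. Qed.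
Lemma SL2Z_mulrV : right_inverse SL2Z_one SL2Z_inv SL2Z_mul.
Proof. by move=> A; apply: val_inj => /=; rewrite mulmxV ?SL2Z_unit. Qed.

HB.instance Definition _ := isGroup.Build SL2Z
  SL2Z_mulA SL2Z_mul1 SL2Z_mulr1 SL2Z_mulV SL2Z_mulrV.
End SL2Z.

Record group_action (H N : groupType) := GroupAction {
  gact :> H -> N -> N;
  gact1 : forall x, gact 1%g x = x;
  gactM : forall g h x, gact (g * h)%g x = gact g (gact h x);
  gact_morph : forall g, {morph gact g : x y / (x * y)%g}
}.

Section Semidirect.
Variables (H N : groupType) (to : group_action H N).

(* N ><| H: the action is a phantom parameter, which determines the group law *)
Definition semidirect of group_action H N : Type := (N * H)%type.
Local Notation SD := (semidirect to).
HB.instance Definition _ := Choice.copy SD (N * H)%type.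

Definition sd_one : SD := (1%g, 1%g).
Definition sd_mul (x y : SD) : SD := ((x.1 * to x.2 y.1)%g, (x.2 * y.2)%g).
Definition sd_inv (x : SD) : SD := (to x.2^-1%g x.1^-1%g, x.2^-1%g).

Lemma gact_1 h : to h 1%g = 1%g.
Proof. by apply: (@mulgI _ (to h 1%g)); rewrite -gact_morph !mulg1. Qed.

Lemma sd_mulA : associative sd_mul.
Proof.
by move=> x y z; congr pair; rewrite /= ?gact_morph ?gactM mulgA.
Qed.
Lemma sd_mul1 : left_id sd_one sd_mul.
Proof. by case=> x h; congr pair; rewrite /= ?gact1 mul1g. Qed.
Lemma sd_mulr1 : right_id sd_one sd_mul.
Proof. by case=> x h; congr pair; rewrite /= ?gact_1 mulg1. Qed.
Lemma sd_mulV : left_inverse sd_one sd_inv sd_mul.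
Proof.
by case=> x h; congr pair; rewrite /= ?mulVg // -gact_morph mulVg gact_1.
Qed.
Lemma sd_mulrV : right_inverse sd_one sd_inv sd_mul.
Proof.
by case=> x h; congr pair; rewrite /= ?mulgV // -gactM mulgV gact1 mulgV.
Qed.

HB.instance Definition _ := isGroup.Build SD
  sd_mulA sd_mul1 sd_mulr1 sd_mulV sd_mulrV.
End Semidirect.

Section SL2Zaction.
Variable K : fieldType.
Local Notation T := (kstar K * kstar K)%type.

(* the action induced by the conjugation of the zeta_z by the rho_A (below) *)
Definition SL2Z_act (A : SL2Z) (z : T) : T :=
  let B := val (A^-1)%g in
  ((kstar_expz z.1 (B 0 0)%R * kstar_expz z.2 (B 1 0)%R)%g,
   (kstar_expz z.1 (B 0 1)%R * kstar_expz z.2 (B 1 1)%R)%g).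

Lemma SL2Z_act1 z : SL2Z_act 1%g z = z.
Proof.
case: z => x y; rewrite /SL2Z_act invg1; congr pair; apply: val_inj => /=.
all: by rewrite !mxE /= ?expr1z ?expr0z ?mulr1 ?mul1r.
Qed.

Lemma SL2Z_actM A B z : SL2Z_act (A * B)%g z = SL2Z_act A (SL2Z_act B z).
Proof.
have i0 : ord0 = 0 :> 'I_2 by apply: val_inj.
have i1 : lift ord0 ord0 = 1 :> 'I_2 by apply: val_inj.
case: z => x y; have [x0 y0] := (valP x, valP y); rewrite /= in x0 y0.
rewrite /SL2Z_act invgM; congr pair; apply: val_inj.
all: rewrite /= !mxE !big_ord_recl !big_ord0 !addr0 i0 i1 /=.
all: rewrite !expfzMl !expfzDr // -!exprz_exp.
all: rewrite mulrACA; congr (_ * _).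
Qed.

Lemma SL2Z_act_morph A : {morph SL2Z_act A : x y / (x * y)%g}.
Proof.
move=> [x1 x2] [y1 y2]; rewrite /SL2Z_act; congr pair; apply: val_inj => /=.
all: rewrite !exprMz_comm ?unitfE ?(valP x1) ?(valP x2) ?(valP y1) ?(valP y2) //;
     try exact: mulrC.
all: exact: mulrACA.
Qed.

Definition SL2Z_action : group_action SL2Z T :=
  GroupAction SL2Z_act1 SL2Z_actM SL2Z_act_morph.
End SL2Zaction.

Section AlgAut.
Variables (K : fieldType) (A : algType K).

Definition is_alg_aut (f : A -> A) : Prop :=
  [/\ bijective f, linear f & GRing.monoid_morphism f].

Definition algAut : Type := {f : A -> A | `[< is_alg_aut f >]}.
HB.instance Definition _ := SubChoice.on algAut.
Definition aut_fun (f : algAut) : A -> A := val f.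
Local Coercion aut_fun : algAut >-> Funclass.

Lemma algAutP (f : algAut) : is_alg_aut f. Proof. exact/asboolP/(valP f). Qed.

Lemma algAut_eqP (f g : algAut) : f =1 g -> f = g.
Proof. by move=> fg; apply: val_inj; apply/funext. Qed.

Lemma algAut_one_subproof : `[< is_alg_aut id >].
Proof. by apply/asboolP; split=> //; exists id. Qed.
Definition algAut_one : algAut := Sub id algAut_one_subproof.

Lemma algAut_mul_subproof (f g : algAut) : `[< is_alg_aut (f \o g) >].
Proof.
apply/asboolP; have [bf lf [f1 fM]] := algAutP f.
have [bg lg [g1 gM]] := algAutP g; split; first exact: bij_comp.
- by move=> c x y /=; rewrite lg lf.
- by split=> [|x y] /=; rewrite ?g1 // gM fM.
Qed.
Definition algAut_mul (f g : algAut) : algAut :=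
  Sub (f \o g) (algAut_mul_subproof f g).

Lemma algAut_inv_ex (f : algAut) : {g : algAut | cancel f g /\ cancel g f}.
Proof.
apply: cid; have [[g fK gK] lf [f1 fM]] := algAutP f.
suff gP : `[< is_alg_aut g >] by exists (Sub g gP).
apply/asboolP; split; first by exists f.
- by move=> c x y; apply: (can_inj fK); rewrite lf !gK.
- by split=> [|x y]; apply: (can_inj fK); rewrite ?fM !gK.
Qed.
Definition algAut_inv (f : algAut) : algAut := sval (algAut_inv_ex f).

Lemma algAut_mulA : associative algAut_mul.
Proof. by move=> f g h; apply: algAut_eqP. Qed.
Lemma algAut_mul1 : left_id algAut_one algAut_mul.
Proof. by move=> f; apply: algAut_eqP. Qed.
Lemma algAut_mulr1 : right_id algAut_one algAut_mul.
Proof. by move=> f; apply: algAut_eqP. Qed.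
Lemma algAut_mulV : left_inverse algAut_one algAut_inv algAut_mul.
Proof.
by move=> f; apply: algAut_eqP; case: (svalP (algAut_inv_ex f)).
Qed.
Lemma algAut_mulrV : right_inverse algAut_one algAut_inv algAut_mul.
Proof.
by move=> f; apply: algAut_eqP; case: (svalP (algAut_inv_ex f)).
Qed.

HB.instance Definition _ := isGroup.Build algAut
  algAut_mulA algAut_mul1 algAut_mulr1 algAut_mulV algAut_mulrV.
End AlgAut.

Coercion aut_fun : algAut >-> Funclass.

Definition is_subalgebra (K : fieldType) (A : algType K) (S : set A) : Prop :=
  [/\ S 1, forall c x y, S x -> S y -> S (c *: x + y)
    & forall x y, S x -> S y -> S (x * y)].

Definition gen_subalgebra (K : fieldType) (A : algType K) (X : set A) : set A :=
  smallest (@is_subalgebra K A) X.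

Definition is_subgroup (G : groupType) (S : set G) : Prop :=
  [/\ S 1%g, forall x y, S x -> S y -> S (x * y)%g
    & forall x, S x -> S x^-1%g].

Definition gen_subgroup (G : groupType) (X : set G) : set G :=
  smallest (@is_subgroup G) X.

(* S is a subgroup of G isomorphic to H: as a homomorphic image of H in G,   *)
(* S is in particular a subgroup                                              *)
Definition subgroup_isom (G : groupType) (S : set G) (H : groupType) : Prop :=
  exists f : H -> G,
    [/\ {morph f : x y / (x * y)%g}, injective f & range f = S].

Definition group_isom (G H : groupType) : Prop :=
  exists f : G -> H, {morph f : x y / (x * y)%g} /\ bijective f.

Inductive heis_gen := Ga | GaV | Gb | Gc | GK | GKV | GE | GF.

Section Heisenberg.
Variables (K : fieldType) (qs : kstar K) (m n : int).
Local Notation q := (val qs).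
Local Notation T := (pexpr K heis_gen).
Local Notation a := (PXgen Ga : T).
Local Notation aV := (PXgen GaV : T).
Local Notation b := (PXgen Gb : T).
Local Notation c := (PXgen Gc : T).
Local Notation k := (PXgen GK : T).
Local Notation kV := (PXgen GKV : T).
Local Notation E := (PXgen GE : T).
Local Notation F := (PXgen GF : T).
Local Notation "c *: x" := (PXmul (PXcst c%R) x) : pexpr_scope.

Inductive heis_rel : T -> T -> Prop :=
  | hr_ab : heis_rel (a * b) (q ^ n *: (b * a))
  | hr_ac : heis_rel (a * c) (q ^ m *: (c * a))
  | hr_bc : heis_rel (b * c) (c * b)
  | hr_aaV : heis_rel (a * aV) 1%:PX
  | hr_aVa : heis_rel (aV * a) 1%:PX
  | hr_KE : heis_rel (k * E) (q ^ (2 * m) *: (E * k))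
  | hr_KF : heis_rel (k * F) (q ^ (- (2 * n)) *: (F * k))
  | hr_EF : heis_rel (E * F) (F * E)
  | hr_KKV : heis_rel (k * kV) 1%:PX
  | hr_KVK : heis_rel (kV * k) 1%:PX
  | hr_Ka : heis_rel (k * a) (q^-1 *: (a * k))
  | hr_Kb : heis_rel (k * b) (q ^ n *: (b * k))
  | hr_Kc : heis_rel (k * c) (q ^ (- m) *: (c * k))
  | hr_Ea : heis_rel (E * a) (a * E)
  | hr_Eb : heis_rel (E * b) (b * E)
  | hr_Ec : heis_rel (E * c) (c * E + pxexpz a aV (- m) * pxexpz k kV m)
  | hr_Fa : heis_rel (F * a) (q ^ n *: (a * F))
  | hr_Fb : heis_rel (F * b) (q ^ (- n ^+ 2) *: (b * F) + pxexpz a aV n)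
  | hr_Fc : heis_rel (F * c) (q ^ (m * n) *: (c * F)).

Definition heis : Type := presented heis_rel.
HB.instance Definition _ := GRing.PzRing.on heis.
HB.instance Definition _ := GRing.Lmodule.on heis.

(* A representation of heis on the functions int -> nat -> nat -> K, which    *)
(* shows that heis is not the zero ring: K and a act through z : int, the     *)
(* pairs (c, E) and (b, F) as q-Weyl algebras through i and j                 *)

Local Notation V := (int -> nat -> nat -> K).

Definition hrep_int (p : K) (i : nat) : K := \sum_(l < i) p ^+ l.

Definition hrep_gen (g : heis_gen) (f : V) : V := fun z i j =>
  match g with
  | Ga => f (z + 1) i j
  | GaV => f (z - 1) i j
  | Gb => q ^ (2 * m * n * i%:Z + n * (z - n))
            * hrep_int (q ^ (- (2 * n ^+ 2))) j * f (z - n) i j.-1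
  | Gc => q ^ (m * (z + m)) * hrep_int (q ^ (2 * m ^+ 2)) i
            * f (z + m) i.-1 j
  | GK => q ^ z * f z i j
  | GKV => q ^ (- z) * f z i j
  | GE => f (z - 2 * m) i.+1 j
  | GF => q ^ (- n ^+ 2 - 2 * m * n * i%:Z - n * z) * f (z + 2 * n) i j.+1
  end.

Fixpoint hrep (t : T) : V -> V :=
  match t with
  | PXcst x => fun f z i j => x * f z i j
  | PXgen g => hrep_gen g
  | (t + u)%PX => fun f z i j => hrep t f z i j + hrep u f z i j
  | (t * u)%PX => fun f => hrep t (hrep u f)
  end.

Lemma hrepD t f g z i j :
  hrep t (fun z i j => f z i j + g z i j) z i j = hrep t f z i j + hrep t g z i j.
Proof.
elim: t f g z i j => [x|h|t IHt u IHu|t IHt u IHu] f g z i j /=.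
- exact: mulrDr.
- by case: h => /=; rewrite ?mulrDr.
- by rewrite IHt IHu addrACA.
- rewrite -IHt; congr (hrep t _ _ _ _).
  by apply/funext => ?; apply/funext => ?; apply/funext => ?; exact: IHu.
Qed.

Lemma hrepZ t x f z i j :
  hrep t (fun z i j => x * f z i j) z i j = x * hrep t f z i j.
Proof.
elim: t f z i j => [y|h|t IHt u IHu|t IHt u IHu] f z i j /=.
- exact: mulrCA.
- by case: h => //=; rewrite mulrCA.
- by rewrite IHt IHu mulrDr.
- rewrite -IHt; congr (hrep t _ _ _ _).
  by apply/funext => ?; apply/funext => ?; apply/funext => ?; exact: IHu.
Qed.

Lemma hrep_int0 p : hrep_int p 0 = 0.
Proof. by rewrite /hrep_int big_ord0. Qed.

Lemma hrep_intS p i : hrep_int p i.+1 = p * hrep_int p i + 1.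
Proof.
rewrite /hrep_int big_ord_recl expr0 addrC mulr_sumr; congr (_ + _).
by apply: eq_bigr => l _; rewrite -exprS.
Qed.

Lemma hrep_expa e f z i j : hrep (pxexpz a aV e) f z i j = f (z + e) i j.
Proof.
have it g : hrep (iter g (PXmul a) 1%:PX) f z i j = f (z + g%:Z) i j.
  elim: g z => [|g IHg] z; first by rewrite /= mul1r addr0.
  by rewrite iterS /= IHg -addrA -intS.
have itV g : hrep (iter g (PXmul aV) 1%:PX) f z i j = f (z - g%:Z) i j.
  elim: g z {it} => [|g IHg] z; first by rewrite /= mul1r subr0.
  by rewrite iterS /= IHg -addrA -opprD -intS.
by case: e => g; [exact: it|rewrite NegzE; exact: itV].
Qed.

Let q0 : q != 0 := valP qs.

Lemma hrep_expK e f z i j :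
  hrep (pxexpz k kV e) f z i j = q ^ (z * e) * f z i j.
Proof.
have it g : hrep (iter g (PXmul k) 1%:PX) f z i j = q ^ (z * g%:Z) * f z i j.
  elim: g => [|g IHg]; first by rewrite /= mulr0.
  by rewrite iterS /= IHg mulrA -expfzDr // intS mulrDr mulr1.
have itV g : hrep (iter g (PXmul kV) 1%:PX) f z i j
           = q ^ (- (z * g%:Z)) * f z i j.
  elim: g {it} => [|g IHg]; first by rewrite /= mulr0.
  by rewrite iterS /= IHg mulrA -expfzDr // intS mulrDr mulr1 opprD.
by case: e => g; [exact: it|rewrite NegzE mulrN; exact: itV].
Qed.

Lemma hrep_rel t u f z i j : heis_rel t u -> hrep t f z i j = hrep u f z i j.
Proof.
have qD x y : q ^ x * q ^ y = q ^ (x + y) by rewrite expfzDr.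
have qV : q^-1 = q ^ (- 1) by [].
have qhD x h y : q ^ x * h * q ^ y = q ^ (x + y) * h by rewrite mulrAC qD.
have fE e e' x x' h i' j' : e = e' -> x = x' ->
  q ^ e * h * f x i' j' = q ^ e' * h * f x' i' j' by move=> -> ->.
have fE1 e e' x x' i' j' : e = e' -> x = x' ->
  q ^ e * f x i' j' = q ^ e' * f x' i' j' by move=> -> ->.
case; rewrite /= ?hrep_expa ?hrep_expK ?qV.
all: rewrite ?mul1r ?addrK ?subrK ?mulrA ?qD ?qhD //.
- by apply: fE; ring.
- by apply: fE; ring.
- case: i => [|i]; first by rewrite !hrep_int0 !(mulr0, mul0r).
  rewrite intS [in LHS](mulrAC _ (hrep_int _ j)) /= -[LHS]mulrA -[RHS]mulrA.
  by congr (_ ^ _ * _ * (_ * f _ _ _)); ring.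
- by apply: fE1; ring.
- by apply: fE1; ring.
- by apply: fE1; rewrite ?intS; ring.
- by rewrite subrr expr0z mul1r.
- by rewrite addNr expr0z mul1r.
- by apply: fE1; ring.
- by apply: fE; ring.
- by apply: fE; ring.
- by congr (f _ _ _); ring.
- by apply: fE; rewrite ?intS; ring.
- have -> : z - 2 * m + m = z - m by ring.
  have -> : z + m - 2 * m = z - m by ring.
  have -> : q ^ (m * (z + m)) * hrep_int (q ^ (2 * m * m)) i
      * f (z - m) i.-1.+1 j
    = q ^ (m * (z + m)) * hrep_int (q ^ (2 * m * m)) i * f (z - m) i j.
    by case: (i) => // ; rewrite hrep_int0 mulr0 !mul0r.
  rewrite hrep_intS mulrDr mulr1 mulrDl mulrA qD.
  by congr (_ ^ _ * _ * _ + _ ^ _ * _); ring.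
- by apply: fE1; ring.
- have -> : z + 2 * n - n = z + n by ring.
  have -> : z - n + 2 * n = z + n by ring.
  set B := (X in _ = q ^ X * _ * _ + _).
  have -> : q ^ B * hrep_int (q ^ (- (2 * n * n))) j
      * f (z + n) i j.-1.+1
    = q ^ B * hrep_int (q ^ (- (2 * n * n))) j * f (z + n) i j.
    by case: (j) => // ; rewrite hrep_int0 mulr0 !mul0r.
  have -> : - n ^+ 2 - 2 * m * n * i - n * z
      + (2 * m * n * i + n * (z + n)) = 0 by ring.
  rewrite expr0z mul1r hrep_intS mulrDl mul1r; congr (_ ^ _ * _ * _ + _).
  by rewrite /B; ring.
- case: i => [|i]; first by rewrite !hrep_int0 !(mulr0, mul0r).
  by apply: fE; rewrite ?intS /=; ring.
Qed.

Lemma hrep_cong t u f z i j :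
  pres_cong heis_rel t u -> hrep t f z i j = hrep u f z i j.
Proof.
have ext v f1 f2 : (forall z i j, f1 z i j = f2 z i j) ->
    hrep v f1 =  hrep v f2.
  move=> f12; congr (hrep v _).
  by apply/funext => ?; apply/funext => ?; apply/funext => ?.
move=> tu; elim: {t u} tu f z i j => //=.
- by move=> t u tu f z i j; apply: hrep_rel.
- by move=> t u v _ tu _ uv f z i j; rewrite tu uv.
- by move=> t t' u u' _ tt' _ uu' f z i j; rewrite tt' uu'.
- by move=> t t' u u' _ tt' _ uu' f z i j; rewrite tt' (ext t' _ _ (uu' f)).
- by move=> t u v f z i j; rewrite addrA.
- by move=> t u f z i j; rewrite addrC.
- by move=> t f z i j; rewrite mul0r add0r.
- by move=> t f z i j; rewrite mul1r.
- move=> t f z i j; apply: (congr1 (fun g : V => g z i j)).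
  by apply: ext => *; rewrite mul1r.
- by move=> t u v f z i j; rewrite hrepD.
- by move=> t f z i j; rewrite !mul0r.
- by move=> x y f z i j; rewrite mulrDl.
- by move=> x y f z i j; rewrite mulrA.
- by move=> x t f z i j; rewrite hrepZ.
Qed.

Lemma heis_nonzero : (1 : heis) != 0.
Proof.
apply/eqP => /pres_eqK /(hrep_cong (fun _ _ _ => 1) 0 0 0) /= /eqP.
by rewrite mulr1 mul0r oner_eq0.
Qed.

HB.instance Definition _ := GRing.PzSemiRing_isNonZero.Build heis heis_nonzero.
HB.instance Definition _ := GRing.LSemiModule_isLSemiAlgebra.Build K heis
  (@pscaleAl K heis_gen heis_rel).
HB.instance Definition _ := GRing.LSemiAlgebra_isSemiAlgebra.Build K heis
  (@pscaleAr K heis_gen heis_rel).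
End Heisenberg.

(* x ^ z for z : int, where y stands for the inverse of x *)
Definition invexpz (A : pzRingType) (x y : A) (z : int) : A :=
  match z with
  | Posz l => x ^+ l
  | Negz l => y ^+ l.+1
  end.

Section HeisenbergAut.
Variables (K : fieldType) (q : kstar K) (m n : int).
Local Notation D := (heis q m n).

Definition heis_elt (g : heis_gen) : D := pgen (heis_rel q m n) g.
Local Notation a := (heis_elt Ga).
Local Notation k := (heis_elt GK).
Definition heis_aexp (z : int) : D := invexpz a (heis_elt GaV) z.
Definition heis_Kexp (z : int) : D := invexpz k (heis_elt GKV) z.

Definition heis_b' : D := heis_aexp n * heis_elt Gb * heis_Kexp (- n).
Definition heis_c' : D := heis_aexp (- m) * heis_elt Gc * heis_Kexp (- m).
Definition heis_E' : D := heis_aexp (2 * m) * heis_elt GE.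
Definition heis_F' : D :=
  val q ^ (- n ^+ 2) *: (heis_aexp (- (2 * n)) * heis_elt GF * heis_Kexp n).

Definition heis_S : set D :=
  gen_subalgebra [set heis_b'; heis_c'; heis_E'; heis_F'].

Definition is_zeta (z1 z2 : kstar K) (phi : algAut D) : Prop :=
  [/\ phi k = val z1 *: k, phi a = val z2 *: a
    & forall s, heis_S s -> phi s = s].

Definition is_rho (A : SL2Z) (phi : algAut D) : Prop :=
  [/\ phi k = heis_Kexp (val A 0 0) * heis_aexp (val A 1 0),
      phi a = heis_Kexp (val A 0 1) * heis_aexp (val A 1 1)
    & forall s, heis_S s -> phi s = s].

Definition is_xi (z3 z4 : kstar K) (phi : algAut D) : Prop :=
  (phi k = k /\ phi a = a) /\
  [/\ phi heis_E' = val z3 *: heis_E', phi heis_F' = val z4 *: heis_F',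
      phi heis_c' = (val z3)^-1 *: heis_c'
    & phi heis_b' = (val z4)^-1 *: heis_b'].

Definition zetas : set (algAut D) :=
  [set phi | exists z1 z2, is_zeta z1 z2 phi].
Definition rhos : set (algAut D) := [set phi | exists A, is_rho A phi].
Definition xis : set (algAut D) := [set phi | exists z3 z4, is_xi z3 z4 phi].

End HeisenbergAut.

Arguments zetas {K} q m n.
Arguments rhos {K} q m n.
Arguments xis {K} q m n.

(* Main.v *)
From HB Require Import structures.
Require Import Defs.
From mathcomp Require Import all_boot all_order all_algebra.
From mathcomp Require Import finmap zify ring monalg.
From mathcomp Require Import boolp classical_sets.
Set Implicit Arguments.
Unset Strict Implicit.
Unset Printing Implicit Defensive.
Import Order.TTheory GRing.Theory Num.Theory.
Local Open Scope quotient_scope.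
Local Open Scope ring_scope.

(** Write [x = E'], [y = c'], [z = F'], [w = b']. These elements commute with
    [K] and [a], they generate the algebra together with [K^±1] and [a^±1], and
    apart from q-commutations they satisfy
      [x y = q^(2m^2) y x + 1] and [z w = q^(-2n^2) w z + 1].
    The elements [u = 1 + (q^(2m^2) - 1) y x] and
    [v = 1 + (q^(-2n^2) - 1) w z] q-commute with all generators. As [y] can be
    expressed by [u] and the inverse of [x], and [w] by [v] and the inverse of
    [z], there is a morphism [theta] to the quantum torus on the six variables
    K, a, x, z, u, v. The ordered monomials span the algebra ([ospan_all]) and
    their images have distinct leading exponents, so [theta] is injective.

    A quantum torus is a group algebra of an ordered group twisted by a
    bicharacter: it is a domain, and the supports of its elements can be
    compared in every direction ([tsupp_max], [tsupp_conj]). This determines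
    the nonzero normal elements of the algebra, which are the scalar multiples
    of [K^i a^j u^s v^t] ([normal_nmon]); the decisive point is that neither
    [x] nor [z] has a left inverse, for otherwise they would be normal as well.
    The units are the normal elements with [s = t = 0] ([unit_nmon]).

    Hence an automorphism maps [K] and [a] to scalar multiples of monomials in
    [K] and [a], and the relation between [K] and [a] says that the matrix of
    exponents has determinant 1 ([aut_torus]). Composing with a monomial
    automorphism leaves an automorphism that fixes [K] and [a]. It permutes the
    normal elements that commute with [K] and [a], that is the monoid generated
    by [u], [v] and the scalars, so it preserves or exchanges [u] and [v] up to
    scalars ([fix_permutes]). An exchange would reverse the commutation
    [z x = q^(2mn) x z] ([fix_no_swap]), and if [u] and [v] are preserved then
    the factors [x], [y], [z], [w] can only be rescaled ([rigid_pair],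
    [fix_torus]): the automorphism is some [xi].

    It remains to identify the group of the monomial automorphisms. A square
    root [r] of [q] splits the extension: the normalized monomials
    [r^(ij) K^i a^j] multiply through the symplectic form of [Z^2] ([wmonM]),
    so that SL_2(Z) acts on them by automorphisms. This gives an action [paut]
    of the abstract group of the theorem, which is faithful ([paut_inj]) and
    by the above exhausts the automorphisms ([paut_surj]). The four parts are
    then read off from the parameters of the zetas, the rhos and the xis. *)

(** * Twisted group algebras of ordered abelian groups *)

Record bicharacter (K : fieldType) (G : zmodType) := Bicharacter {
  bichar :> G -> G -> K;
  bicharDl : forall a b c, bichar (a + b) c = bichar a c * bichar b c;
  bicharDr : forall a b c, bichar a (b + c) = bichar a b * bichar a c;
  bichar_neq0 : forall a b, bichar a b != 0
}.

Section BicharTheory.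
Variables (K : fieldType) (G : zmodType) (chi : bicharacter K G).

Lemma bichar0l a : chi 0 a = 1.
Proof. by apply: (mulfI (bichar_neq0 chi 0 a)); rewrite -bicharDl addr0 mulr1. Qed.

Lemma bichar0r a : chi a 0 = 1.
Proof. by apply: (mulfI (bichar_neq0 chi a 0)); rewrite -bicharDr addr0 mulr1. Qed.
End BicharTheory.

Section LinearExtension.
Variables (K : fieldType) (G : choiceType).

Definition linext (V : zmodType) (h : G -> K -> V) (f : {malg K[G]}) : V :=
  \sum_(a <- msupp f) h a f@_a.

(** Supports may grow or shrink under addition; padding both sums to a common
    set of exponents makes the coefficients add up termwise. *)
Lemma linextD V h : (forall a, {morph h a : c d / c + d}) ->
  {morph @linext V h : f g / f + g}.
Proof.
move=> hD f g; have h0 a : h a 0 = 0.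
  by apply: (addIr (h a 0)); rewrite -hD !add0r.
have w (f' : {malg K[G]}) (d : {fset G}) : fsubset (msupp f') d ->
    linext h f' = \sum_(a <- d) h a f'@_a.
  by move=> sd; apply: big_fset_incl => // a _ /mcoeff_outdom ->.
rewrite (w (f + g) _ (msuppD_le f g)) (w f _ (fsubsetUl _ (msupp g))).
rewrite (w g _ (fsubsetUr (msupp f) _)) -big_split.
by apply: eq_bigr => a _; rewrite mcoeffD hD.
Qed.

Lemma linextU V h c a : h a 0 = 0 -> @linext V h << c *g a >> = h a c.
Proof.
move=> h0; rewrite /linext msuppU; case: eqP => [->|_].
  by rewrite big_seq_fset0 h0.
by rewrite big_seq_fset1 mcoeffUU.
Qed.

End LinearExtension.

Section TwistedGroupAlgebra.
Variables (K : fieldType) (G : zmodType) (chi : bicharacter K G).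

Lemma malg_ind (P : {malg K[G]} -> Prop) :
  (forall f g, P f -> P g -> P (f + g)) -> (forall c k, P << c *g k >>) ->
  forall f, P f.
Proof.
move=> PD PU f; rewrite (monalgE f); apply: (big_ind P) => //.
by rewrite -(monalgU0 0); apply: PU.
Qed.

(** A synonym of the free module that remembers the bicharacter, on which the
    product depends. *)
Definition tga of bicharacter K G := {malg K[G]}.
Local Notation T := (tga chi).
HB.instance Definition _ := GRing.Lmodule.on T.

Definition tmul (f g : T) : T :=
  linext (fun a c => linext (fun b d => << c * d * chi a b *g a + b >>) g) f.

Lemma tmulUU c a d b :
  tmul << c *g a >> << d *g b >> = << c * d * chi a b *g a + b >>.
Proof.
rewrite /tmul linextU ?linextU ?mulr0 ?mul0r ?monalgU0 //.
Qed.

Lemma tmulDl : left_distributive tmul +%R.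
Proof.
move=> f g h; apply: linextD => a c d.
rewrite /linext -big_split; apply: eq_bigr => b _.
by rewrite !mulrDl monalgUD.
Qed.

Lemma tmulDr : right_distributive tmul +%R.
Proof.
move=> f g h; rewrite /tmul -big_split; apply: eq_bigr => a _.
apply: linextD => b c d.
by rewrite mulrDr mulrDl monalgUD.
Qed.

Lemma tmulA : associative tmul.
Proof.
move=> f g h.
elim/malg_ind: f => [f1 f2 IH1 IH2|c1 a1]; first by rewrite !tmulDl IH1 IH2.
elim/malg_ind: g => [f1 f2 IH1 IH2|c2 a2]; first by rewrite ?(tmulDl, tmulDr) IH1 IH2.
elim/malg_ind: h => [f1 f2 IH1 IH2|c3 a3]; first by rewrite !tmulDr IH1 IH2.
by rewrite !tmulUU bicharDl bicharDr addrA; congr << _ *g _ >>; ring.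
Qed.

Definition tone : T := << 1 *g 0 >>.

Lemma tmul1l : left_id tone tmul.
Proof.
elim/malg_ind=> [f g IHf IHg|c a]; first by rewrite tmulDr IHf IHg.
by rewrite tmulUU bichar0l add0r mul1r mulr1.
Qed.

Lemma tmul1r : right_id tone tmul.
Proof.
elim/malg_ind=> [f g IHf IHg|c a]; first by rewrite tmulDl IHf IHg.
by rewrite tmulUU bichar0r addr0 !mulr1.
Qed.

Lemma tone_neq0 : tone != 0.
Proof. by rewrite monalgU_eq0 oner_eq0. Qed.

HB.instance Definition _ := GRing.Zmodule_isNzRing.Build T
  tmulA tmul1l tmul1r tmulDl tmulDr tone_neq0.

Lemma malgZU (c d : K) (a : G) : c *: << d *g a >> = << c * d *g a >> :> {malg K[G]}.
Proof. by apply/malgP => b; rewrite mcoeffZ !mcoeffU mulrnAr. Qed.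

Lemma tscaleAl c (f g : T) : c *: (f * g) = c *: f * g.
Proof.
elim/malg_ind: f => [f1 f2 IH1 IH2|c1 a1].
  by rewrite mulrDl !scalerDr mulrDl IH1 IH2.
elim/malg_ind: g => [f1 f2 IH1 IH2|c2 a2].
  by rewrite !mulrDr !scalerDr IH1 IH2.
rewrite -[_ * _ in LHS]/(tmul _ _) -[RHS]/(tmul _ _).
by rewrite malgZU !tmulUU malgZU !mulrA.
Qed.

Lemma tscaleAr c (f g : T) : c *: (f * g) = f * (c *: g).
Proof.
elim/malg_ind: f => [f1 f2 IH1 IH2|c1 a1].
  by rewrite !mulrDl !scalerDr IH1 IH2.
elim/malg_ind: g => [f1 f2 IH1 IH2|c2 a2].
  by rewrite !mulrDr !scalerDr mulrDr IH1 IH2.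
rewrite -[_ * _ in LHS]/(tmul _ _) -[RHS]/(tmul _ _).
by rewrite malgZU !tmulUU malgZU; congr << _ *g _ >>; ring.
Qed.

HB.instance Definition _ :=
  GRing.LSemiModule_isLSemiAlgebra.Build K T tscaleAl.
HB.instance Definition _ :=
  GRing.LSemiAlgebra_isSemiAlgebra.Build K T tscaleAr.

Definition gX (a : G) : T := << 1 *g a >>.

Lemma gX0 : gX 0 = 1. Proof. by []. Qed.

Lemma gXM a b : gX a * gX b = chi a b *: gX (a + b).
Proof. by rewrite -[LHS]/(tmul _ _) tmulUU [RHS]malgZU !mulr1 mul1r. Qed.

Lemma gcoefM (f g : T) c : (f * g)@_c =
  \sum_(a <- msupp f) \sum_(b <- msupp g)
     (f@_a * g@_b * chi a b) *+ (a + b == c).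
Proof.
rewrite -[f * g]/(tmul f g) /tmul /linext raddf_sum; apply: eq_bigr => a _.
rewrite raddf_sum; apply: eq_bigr => b _.
by rewrite [LHS]mcoeffU.
Qed.

Lemma gcoefXl a (f : T) c : (gX a * f)@_c = chi a (c - a) * f@_(c - a).
Proof.
elim/malg_ind: f => [f g IHf IHg|d b].
  by rewrite mulrDr [LHS]mcoeffD IHf IHg [in RHS]mcoeffD mulrDr.
rewrite -[_ * _ in LHS]/(tmul _ _) tmulUU !mcoeffU mul1r.
rewrite [b == _]eq_sym subr_eq [b + a]addrC [c == _]eq_sym.
by case: eqP => [<-|]; rewrite ?mulr0 // addrC addKr mulrC.
Qed.

Lemma gcoefXr a (f : T) c : (f * gX a)@_c = chi (c - a) a * f@_(c - a).
Proof.
elim/malg_ind: f => [f g IHf IHg|d b].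
  by rewrite mulrDl [LHS]mcoeffD IHf IHg [in RHS]mcoeffD mulrDr.
rewrite -[_ * _ in LHS]/(tmul _ _) tmulUU !mcoeffU mulr1.
rewrite [b == _]eq_sym subr_eq [c == _]eq_sym.
by case: eqP => [<-|]; rewrite ?mulr0 // addrK mulrC.
Qed.
End TwistedGroupAlgebra.

(** An abstract interface to the twisted group algebra: its operations stay
    opaque, since unfolding them would make unification very slow. The
    coefficients [tcoef f] are indexed by the exponents, and [tX a] is the
    monomial of exponent [a]. *)
Record twisted_algebra (K : fieldType) (G : zmodType) (chi : bicharacter K G) :=
  TwistedAlgebra {
    ta_alg :> algType K;
    tX : G -> ta_alg;
    tcoef : ta_alg -> G -> K;
    tsupp : ta_alg -> {fset G};
    in_tsupp : forall f a, (a \in tsupp f) = (tcoef f a != 0);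
    tcoefP : forall f g, tcoef f =1 tcoef g -> f = g;
    tcoefD : forall f g a, tcoef (f + g) a = tcoef f a + tcoef g a;
    tcoefZ : forall c f a, tcoef (c *: f) a = c * tcoef f a;
    tcoefX : forall a b, tcoef (tX a) b = (a == b)%:R;
    tX0 : tX 0 = 1;
    tXM : forall a b, tX a * tX b = chi a b *: tX (a + b);
    tcoefM : forall f g c, tcoef (f * g) c =
      \sum_(a <- tsupp f) \sum_(b <- tsupp g)
         (tcoef f a * tcoef g b * chi a b) *+ (a + b == c);
    tcoefXl : forall a f c, tcoef (tX a * f) c = chi a (c - a) * tcoef f (c - a);
    tcoefXr : forall a f c, tcoef (f * tX a) c = chi (c - a) a * tcoef f (c - a)
  }.

Fact twisted_group_algebra (K : fieldType) (G : zmodType) (chi : bicharacter K G) :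
  twisted_algebra chi.
Proof.
apply: (@TwistedAlgebra _ _ chi (tga chi) (@gX _ _ chi) (fun f a => mcoeff a f) (@msupp G K)).
- by move=> f a; rewrite mcoeff_neq0.
- by move=> f g fg; apply/malgP.
- by move=> f g a; exact: mcoeffD.
- by move=> c f a; exact: mcoeffZ.
- by move=> a b; exact: mcoeffU.
- exact: gX0.
- exact: gXM.
- exact: gcoefM.
- exact: gcoefXl.
- exact: gcoefXr.
Qed.

(** * Leading terms *)

(** The positive elements of a total order compatible with the addition.
    Working with a predicate instead of an order structure lets the order on
    the exponents vary within a proof. *)
Definition is_cone (G : zmodType) (pos : pred G) :=
  [/\ ~~ pos 0, forall a b, pos a -> pos b -> pos (a + b)
    & forall a, a != 0 -> pos a || pos (- a)].

Section TwistedAlgebraTheory.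
Variables (K : fieldType) (G : zmodType) (chi : bicharacter K G).
Variable T : twisted_algebra chi.
Local Notation tX := (@tX K G chi T).
Local Notation tcoef := (@tcoef K G chi T).
Local Notation tsupp := (@tsupp K G chi T).

Implicit Types (pos : pred G) (f g : T).

Lemma tcoef0 a : tcoef 0 a = 0.
Proof. by rewrite -(scale0r (0 : T)) tcoefZ mul0r. Qed.
Lemma tcoefN (f : T) a : tcoef (- f) a = - tcoef f a.
Proof. by rewrite -scaleN1r tcoefZ mulN1r. Qed.

Lemma tsuppM (f g : T) c : c \in tsupp (f * g) ->
  exists a b, [/\ a \in tsupp f, b \in tsupp g & a + b = c].
Proof.
rewrite in_tsupp tcoefM; apply: contraPP => nex; apply/negP; rewrite negbK.
rewrite big_seq big1 // => a sa; rewrite big_seq big1 // => b sb.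
by case: eqP => // ab; case: nex; exists a, b.
Qed.

Lemma tsupp_neq0 (f : T) : f != 0 -> exists a, a \in tsupp f.
Proof.
apply: contraNP => nex; apply/eqP/tcoefP => a; rewrite tcoef0.
by apply/eqP; apply: contraPT (nex) => fa; case; exists a; rewrite in_tsupp.
Qed.

Lemma cone_max (pos : pred G) (s : seq G) a0 : is_cone pos -> a0 \in s ->
  exists2 a, a \in s & forall b, b \in s -> b != a -> pos (a - b).
Proof.
case=> p0 pD pT; elim: s a0 => // a1 s IHs a0 _.
case: s IHs => [_|a2 s IHs].
  by exists a1; rewrite ?mem_head // => b; rewrite inE => ->.
have [a sa amax] := IHs a2 (mem_head _ _).
have [e|a1a] := eqVneq a1 a.
  exists a1; first exact: mem_head.
  by move=> b; rewrite inE => /orP[/eqP ->|]; rewrite ?eqxx // e; apply: amax.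
have /orP[p|] : pos (a - a1) || pos (- (a - a1)).
- by apply: pT; rewrite subr_eq0 eq_sym.
- exists a; first by rewrite inE sa orbT.
  by move=> b; rewrite inE => /orP[/eqP->//|/amax].
rewrite opprB => p; exists a1; first exact: mem_head.
move=> b; rewrite inE => /orP[/eqP ->|sb bne]; first by rewrite eqxx.
have [->//|ba] := eqVneq b a.
by rewrite -(subrK a a1) -addrA; apply: pD => //; apply: amax.
Qed.

Definition is_lead (pos : pred G) (f : T) a :=
  a \in tsupp f /\ forall b, b \in tsupp f -> b != a -> pos (a - b).

Lemma lead_ex pos f : is_cone pos -> f != 0 -> exists a, is_lead pos f a.
Proof.
move=> cp /tsupp_neq0[a0 sa0].
by have [a sa amax] := cone_max cp sa0; exists a.
Qed.

(** If [a + b = a' + b'] with [a], [b] maximal, then [a - a'] and [b - b'] are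
    opposite and both nonnegative: only the leading terms contribute. *)
Lemma tcoef_leadM pos f g a b : is_cone pos ->
  is_lead pos f a -> is_lead pos g b ->
  tcoef (f * g) (a + b) = tcoef f a * tcoef g b * chi a b.
Proof.
move=> [p0 pD pT] [sa amax] [sb bmax].
rewrite tcoefM (big_fsetD1 a) //= (big_fsetD1 b) //= eqxx mulr1n.
rewrite !big1_fset ?addr0 // => [a'|b'].
  rewrite in_fsetD1 => /andP[aa' sa'] _; rewrite big_seq big1 // => b' sb'.
  case: eqP => // ab; have pa := amax _ sa' aa'.
  have e : b - b' = - (a - a').
    by apply/eqP; rewrite opprB subr_eq addrAC eq_sym subr_eq [b + _]addrC ab.
  have [bb'|bb'] := eqVneq b' b.
    by move: pa; rewrite -[a - a']opprK -e bb' subrr oppr0 (negPf p0).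
  by have := pD _ _ pa (bmax _ sb' bb'); rewrite e subrr (negPf p0).
rewrite in_fsetD1 => /andP[bb' sb'] _.
by rewrite (inj_eq (addrI a)) (negPf bb').
Qed.

Lemma lead_neq0 pos f g a b : is_cone pos ->
  is_lead pos f a -> is_lead pos g b -> a + b \in tsupp (f * g).
Proof.
move=> cp fa gb; rewrite in_tsupp (tcoef_leadM cp fa gb).
by rewrite !mulf_neq0 ?bichar_neq0 -?in_tsupp //; [case: fa|case: gb].
Qed.

Lemma lead_mul pos f g a b : is_cone pos ->
  is_lead pos f a -> is_lead pos g b -> is_lead pos (f * g) (a + b).
Proof.
move=> cp fa gb; split; first exact: lead_neq0 cp fa gb.
have [_ pD _] := cp.
move=> c /tsuppM[a' [b' [sa sb <-]]] ne.
rewrite opprD addrACA; have [e|na] := eqVneq a' a.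
  rewrite e subrr add0r; apply: gb.2 => //.
  by apply: contraNneq ne => ->; rewrite e.
have [->|nb] := eqVneq b' b; first by rewrite subrr addr0; apply: fa.2.
by apply: pD; [apply: fa.2|apply: gb.2].
Qed.

Lemma lead_X pos a : is_lead pos (tX a) a.
Proof.
split=> [|b]; first by rewrite in_tsupp tcoefX eqxx oner_eq0.
by rewrite in_tsupp tcoefX; have [->|_] := eqVneq a b; rewrite ?eqxx.
Qed.

Lemma lead_Z pos c f a : c != 0 -> is_lead pos f a -> is_lead pos (c *: f) a.
Proof.
move=> c0 [sa amax]; split; first by rewrite in_tsupp tcoefZ mulf_neq0 // -in_tsupp.
by move=> b; rewrite in_tsupp tcoefZ mulf_eq0 negb_or -in_tsupp => /andP[_]; apply: amax.
Qed.

Lemma lead_exp pos f a l : is_cone pos -> is_lead pos f a -> is_lead pos (f ^+ l) (a *+ l).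
Proof.
move=> cp fa; elim: l => [|l IHl]; first by rewrite expr0 mulr0n; rewrite -tX0; exact: lead_X.
by rewrite exprS mulrS; exact: lead_mul.
Qed.

Lemma tdomain pos (f g : T) : is_cone pos -> f != 0 -> g != 0 -> f * g != 0.
Proof.
move=> cp /(lead_ex cp)[a fa] /(lead_ex cp)[b gb].
have := lead_neq0 cp fa gb; apply: contraTneq => ->.
by rewrite in_tsupp tcoef0 eqxx.
Qed.

Section Directions.
Variable l : G -> int.
Hypothesis lD : {morph l : a b / a + b}.

Let l0 : l 0 = 0. Proof. by apply: (addIr (l 0)); rewrite -lD !add0r. Qed.
Let lN a : l (- a) = - l a.
Proof. by apply: (addIr (l a)); rewrite -lD !addNr. Qed.
Let lB a b : l (a - b) = l a - l b. Proof. by rewrite lD lN. Qed.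

(** Comparing the values of [l] first, and breaking ties by the given order. *)
Lemma cone_refine pos : is_cone pos ->
  is_cone (fun a : G => (0 < l a) || ((l a == 0) && pos a)).
Proof.
case=> p0 pD pT; split => [|a b|a a0].
- by rewrite l0 ltxx (negPf p0) andbF.
- move=> /orP[la|/andP[/eqP la pa]] /orP[lb|/andP[/eqP lb pb]]; apply/orP; rewrite lD.
  + by left; rewrite addr_gt0.
  + by left; rewrite lb addr0.
  + by left; rewrite la add0r.
  + by right; rewrite la lb addr0 eqxx pD.
- rewrite lN oppr_gt0 oppr_eq0.
  by case: ltgtP => //= la; apply: pT.
Qed.

(** The largest values of an additive function on the supports of two elements
    add up to its largest value on the support of their product: a compatible
    order can always be refined so as to compare that function first. *)
Lemma tsupp_max pos (f g : T) : is_cone pos ->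
  f != 0 -> g != 0 ->
  exists a b, [/\ a \in tsupp f, b \in tsupp g, a + b \in tsupp (f * g),
    forall a', a' \in tsupp f -> l a' <= l a
    & forall b', b' \in tsupp g -> l b' <= l b].
Proof.
move=> /cone_refine cp /(lead_ex cp)[a fa] /(lead_ex cp)[b gb].
exists a, b; have [sa amax] := fa; have [sb bmax] := gb.
split=> //; first exact: lead_neq0 cp fa gb.
- move=> a' sa'; have [->//|aa'] := eqVneq a' a.
  have /orP[|/andP[/eqP]] := amax _ sa' aa'; rewrite lB; first by rewrite subr_gt0 => /ltW.
  by move/subr0_eq=> ->.
- move=> a' sa'; have [->//|aa'] := eqVneq a' b.
  have /orP[|/andP[/eqP]] := bmax _ sa' aa'; rewrite lB; first by rewrite subr_gt0 => /ltW.
  by move/subr0_eq=> ->.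
Qed.

(** By [tsupp_max] the maxima of [l] satisfy [max f + max N = max N + max g].
    Applied to all directions [l], this bounds the support of a conjugate. *)
Lemma tsupp_conj pos (f g N : T) : is_cone pos ->
  N != 0 -> f * N = N * g -> forall b, b \in tsupp g ->
  exists2 a, a \in tsupp f & l b <= l a.
Proof.
move=> cp N0 e b sb.
have g0 : g != 0 by apply: contraTneq sb => ->; rewrite in_tsupp tcoef0 eqxx.
have [n [b1 [sn sb1]]] := tsupp_max cp N0 g0.
rewrite -e => /tsuppM[a [n' [sa sn' en]]] nmax bmax; exists a => //.
have := congr1 l en; rewrite !lD => e'.
have := nmax _ sn'; have := bmax _ sb; lia.
Qed.

End Directions.
End TwistedAlgebraTheory.

Section Lexicographic.
Variables (G H : zmodType).

Definition cone_lex (p : pred G) (r : pred H) : pred (G * H) :=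
  fun a => p a.1 || ((a.1 == 0) && r a.2).

Lemma cone_lexP p r : is_cone p -> is_cone r -> is_cone (cone_lex p r).
Proof.
move=> [p0 pD pT] [r0 rD rT]; split => [|[a a'] [b b']|[a a']]; rewrite /cone_lex /=.
- by rewrite (negPf p0) (negPf r0) andbF.
- move=> /orP[pa|/andP[/eqP -> ra]] /orP[pb|/andP[/eqP -> rb]]; apply/orP.
  + by left; apply: pD.
  + by left; rewrite addr0.
  + by left; rewrite add0r.
  + by right; rewrite addr0 eqxx rD.
- rewrite xpair_eqE negb_and oppr_eq0; have [->|a0 _] := eqVneq a 0.
    by rewrite oppr0 (negPf p0) /= => /rT.
  by rewrite !orbF pT.
Qed.
End Lexicographic.

Lemma int_cone : is_cone (fun i : int => 0 < i).
Proof. by split=> // [a b|a a0]; lia. Qed.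

(** * Integer powers of a unit of an algebra *)

Section IntegerPowers.
Variables (K : fieldType) (B : algType K).
Implicit Types (x y g : B) (s : K) (i j : int).

Lemma invexpzS x y i : x * y = 1 -> y * x = 1 ->
  invexpz x y (i + 1) = x * invexpz x y i.
Proof.
move=> xy yx; case: i => [l|l]; first by rewrite -PoszD addn1 /= exprS.
have -> : Negz l + 1 = - l%:Z by rewrite NegzE; lia.
by case: l => [|l] /=; rewrite ?expr1 ?xy // [in RHS]exprS mulrA xy mul1r.
Qed.

Lemma invexpzP x y i : x * y = 1 -> y * x = 1 ->
  invexpz x y (i - 1) = y * invexpz x y i.
Proof.
by move=> xy yx; rewrite -[in RHS](subrK 1 i) invexpzS // mulrA yx mul1r.
Qed.

Lemma invexpz1 x y : invexpz x y 1 = x. Proof. by rewrite /= expr1. Qed.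
Lemma invexpzN1 x y : invexpz x y (-1) = y. Proof. by rewrite /= expr1. Qed.
Lemma invexpz0 x y : invexpz x y 0 = 1. Proof. by rewrite /= expr0. Qed.

Lemma invexpzD x y i j : x * y = 1 -> y * x = 1 ->
  invexpz x y (i + j) = invexpz x y i * invexpz x y j.
Proof.
move=> xy yx; elim/int_rec: i => [|l IHl|l IHl].
- by rewrite add0r invexpz0 mul1r.
- by rewrite intS [1 + _]addrC addrAC !invexpzS // IHl mulrA.
- have -> : - (l.+1%:Z) = - l%:Z - 1 by rewrite intS opprD addrC.
  by rewrite addrAC !invexpzP // IHl mulrA.
Qed.

Lemma invexpzVr x y i : x * y = 1 -> y * x = 1 ->
  invexpz x y i * invexpz x y (- i) = 1.
Proof. by move=> xy yx; rewrite -invexpzD // subrr invexpz0. Qed.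

Lemma invexpzVl x y i : x * y = 1 -> y * x = 1 ->
  invexpz x y (- i) * invexpz x y i = 1.
Proof. by move=> xy yx; rewrite -invexpzD // addNr invexpz0. Qed.

Lemma qcomm_invexpz x y g s i : x * y = 1 -> y * x = 1 -> s != 0 ->
  g * x = s *: (x * g) -> g * invexpz x y i = s ^ i *: (invexpz x y i * g).
Proof.
move=> xy yx s0 gx.
have gy : g * y = s^-1 *: (y * g).
  have : y * (g * x) * y = s *: (y * (x * g) * y) by rewrite gx -scalerAr -scalerAl.
  rewrite -!mulrA xy mulr1 (mulrA y x) yx mul1r => ->.
  by rewrite scalerA mulVf // scale1r.
elim/int_rec: i => [|l IHl|l IHl].
- by rewrite invexpz0 scale1r mulr1 mul1r.
- rewrite intS [1 + _]addrC invexpzS // mulrA gx -scalerAl -mulrA IHl.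
  by rewrite -scalerAr scalerA expfzDr // expr1z mulrC -!mulrA.
- have -> : - (l.+1%:Z) = - l%:Z - 1 by rewrite intS opprD addrC.
  rewrite invexpzP // mulrA gy -scalerAl -mulrA IHl.
  by rewrite -scalerAr scalerA expfzDr // exprN1 mulrC -!mulrA.
Qed.

Lemma comm_invexpz x y g i : x * y = 1 -> y * x = 1 ->
  g * x = x * g -> g * invexpz x y i = invexpz x y i * g.
Proof.
move=> xy yx gx; rewrite (@qcomm_invexpz _ _ _ 1) ?oner_eq0 ?scale1r //.
by rewrite exp1rz scale1r.
Qed.

Lemma invexpzM x y i j : x * y = 1 -> y * x = 1 ->
  invexpz (invexpz x y i) (invexpz x y (- i)) j = invexpz x y (i * j).
Proof.
move=> xy yx; have [xi ix] := (invexpzVr i xy yx, invexpzVl i xy yx).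
elim/int_rec: j => [|l IHl|l IHl].
- by rewrite mulr0 !invexpz0.
- rewrite intS [1 + _]addrC [LHS]invexpzS // IHl -invexpzD //.
  by congr (invexpz x y _); ring.
- have -> : - (l.+1%:Z) = - l%:Z - 1 by rewrite intS opprD addrC.
  rewrite [LHS]invexpzP // IHl -invexpzD //.
  by congr (invexpz x y _); ring.
Qed.

Lemma monoid_morph_invexpz (B' : algType K) (f : B -> B') x y i :
  GRing.monoid_morphism f -> f (invexpz x y i) = invexpz (f x) (f y) i.
Proof.
case=> f1 fM; have fX g l : f (g ^+ l) = f g ^+ l.
  by elim: l => [|l IHl]; rewrite ?expr0 ?f1 // !exprS fM IHl.
by case: i => l; apply: fX.
Qed.
End IntegerPowers.

(** * Algebra morphisms out of a presented algebra *)

Section Evaluation.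
Variables (K : fieldType) (G : Type) (B : algType K).
Variable R : pexpr K G -> pexpr K G -> Prop.
Local Notation P := (presented R).

Fixpoint peval (f : G -> B) (t : pexpr K G) : B :=
  match t with
  | PXcst x => x *: 1
  | PXgen g => f g
  | PXadd t u => peval f t + peval f u
  | PXmul t u => peval f t * peval f u
  end.

Lemma peval_pxexpz f x y i :
  peval f (pxexpz x y i) = invexpz (peval f x) (peval f y) i.
Proof.
by case: i => l /=; elim: l => [|l IHl] /=; rewrite ?scale1r ?mulr1 ?expr0 // exprS ?IHl.
Qed.

Definition respects (f : G -> B) := forall t u, R t u -> peval f t = peval f u.

Variable f : G -> B.
Hypothesis fR : respects f.

Lemma peval_cong t u : pres_cong R t u -> peval f t = peval f u.
Proof.
elim=> {t u} //=.
- by move=> x y z _ -> _ ->.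
- by move=> x x' y y' _ -> _ ->.
- by move=> x x' y y' _ -> _ ->.
- by move=> *; rewrite addrA.
- by move=> *; rewrite addrC.
- by move=> *; rewrite scale0r add0r.
- by move=> *; rewrite mulrA.
- by move=> *; rewrite scale1r mul1r.
- by move=> *; rewrite scale1r mulr1.
- by move=> *; rewrite mulrDl.
- by move=> *; rewrite mulrDr.
- by move=> *; rewrite scale0r mul0r.
- by move=> *; rewrite scalerDl.
- by move=> c d; rewrite -scalerAl mul1r scalerA.
- by move=> c x; rewrite -scalerAl mul1r -scalerAr mulr1.
Qed.

Definition plift (x : P) : B := peval f (repr x).

Lemma plift_pi t : plift (\pi_P t) = peval f t.
Proof. exact/peval_cong/pres_repr. Qed.

Lemma pliftD x y : plift (x + y) = plift x + plift y.
Proof.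
elim/quotW: x => x; elim/quotW: y => y.
by rewrite -[_ + _]/(padd _ _) -piD !plift_pi.
Qed.

Lemma pliftM x y : plift (x * y) = plift x * plift y.
Proof.
elim/quotW: x => x; elim/quotW: y => y.
by rewrite -[_ * _ in LHS]/(pmul _ _) -piM !plift_pi.
Qed.

Lemma pliftZ c x : plift (c *: x) = c *: plift x.
Proof.
elim/quotW: x => x; rewrite -[_ *: _]/(pmul _ _) -piM !plift_pi /=.
by rewrite -scalerAl mul1r.
Qed.

Lemma plift1 : plift 1 = 1.
Proof. by have := plift_pi (PXcst 1); rewrite /= scale1r. Qed.

Lemma plift_gen g : plift (pgen R g) = f g.
Proof. exact: plift_pi. Qed.
End Evaluation.

(** * A second presentation *)

Definition is_alg_morph (K : fieldType) (A B : algType K) (f : A -> B) :=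
  linear f /\ GRing.monoid_morphism f.

Section SecondPresentation.
Variables (K : fieldType) (qs : kstar K) (m n : int).
Local Notation q := (val qs).
Let q0 : q != 0 := valP qs.

Let qD i j : q ^ i * q ^ j = q ^ (i + j). Proof. by rewrite expfzDr. Qed.
Let qz i : q ^ i != 0. Proof. exact: expfz_neq0. Qed.

(** Images of [K^±1], [a^±1], [x = E'], [y = c'], [z = F'], [w = b'] in an
    algebra, together with a complete list of relations between them. The
    algebra is a free object on such data, and these relations are much more
    symmetric than the original ones: [K], [a] on one side and [x, y, z, w] on
    the other commute, and each of [x y], [z w] is a quantum Weyl pair. *)
Record heis_data (B : algType K) := HeisData {
  hk : B; hkV : B; ha : B; haV : B; hx : B; hy : B; hz : B; hw : B;
  hkkV : hk * hkV = 1;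
  hkVk : hkV * hk = 1;
  haaV : ha * haV = 1;
  haVa : haV * ha = 1;
  hka : hk * ha = q^-1 *: (ha * hk);
  hxk : hx * hk = hk * hx;
  hyk : hy * hk = hk * hy;
  hzk : hz * hk = hk * hz;
  hwk : hw * hk = hk * hw;
  hxa : hx * ha = ha * hx;
  hya : hy * ha = ha * hy;
  hza : hz * ha = ha * hz;
  hwa : hw * ha = ha * hw;
  hxy : hx * hy = q ^ (2 * m ^+ 2) *: (hy * hx) + 1;
  hzw : hz * hw = q ^ (- (2 * n ^+ 2)) *: (hw * hz) + 1;
  hzx : hz * hx = q ^ (2 * m * n) *: (hx * hz);
  hzy : hz * hy = q ^ (- (2 * m * n)) *: (hy * hz);
  hwx : hw * hx = q ^ (- (2 * m * n)) *: (hx * hw);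
  hwy : hw * hy = q ^ (2 * m * n) *: (hy * hw)
}.

Section Morphism.
Variables (B : algType K) (d : heis_data B).
Local Notation k i := (invexpz (hk d) (hkV d) i).
Local Notation a i := (invexpz (ha d) (haV d) i).
Local Notation x := (hx d).
Local Notation y := (hy d).
Local Notation z := (hz d).
Local Notation w := (hw d).

Lemma hdkD i j : k i * k j = k (i + j).
Proof. by rewrite invexpzD ?hkkV ?hkVk. Qed.
Lemma hdaD i j : a i * a j = a (i + j).
Proof. by rewrite invexpzD ?haaV ?haVa. Qed.

Lemma hdka i j : k i * a j = q ^ (- (i * j)) *: (a j * k i).
Proof.
have qV : q^-1 != 0 by rewrite invr_eq0.
have kaj l : hk d * a l = q ^ (- l) *: (a l * hk d).
  by rewrite (@qcomm_invexpz _ _ _ _ _ q^-1) ?haaV ?haVa ?hka // exprz_inv.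
have ajk l : a l * hk d = q ^ l *: (hk d * a l).
  by rewrite kaj scalerA qD subrr scale1r.
rewrite (@qcomm_invexpz _ _ _ _ (a j) (q ^ j) i) ?hkkV ?hkVk // scalerA.
by rewrite exprz_exp qD [j * i]mulrC addNr scale1r.
Qed.

Lemma hdxk i : x * k i = k i * x.
Proof. by rewrite comm_invexpz ?hkkV ?hkVk ?hxk. Qed.
Lemma hdyk i : y * k i = k i * y.
Proof. by rewrite comm_invexpz ?hkkV ?hkVk ?hyk. Qed.
Lemma hdzk i : z * k i = k i * z.
Proof. by rewrite comm_invexpz ?hkkV ?hkVk ?hzk. Qed.
Lemma hdwk i : w * k i = k i * w.
Proof. by rewrite comm_invexpz ?hkkV ?hkVk ?hwk. Qed.
Lemma hdxa i : x * a i = a i * x.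
Proof. by rewrite comm_invexpz ?haaV ?haVa ?hxa. Qed.
Lemma hdya i : y * a i = a i * y.
Proof. by rewrite comm_invexpz ?haaV ?haVa ?hya. Qed.
Lemma hdza i : z * a i = a i * z.
Proof. by rewrite comm_invexpz ?haaV ?haVa ?hza. Qed.
Lemma hdwa i : w * a i = a i * w.
Proof. by rewrite comm_invexpz ?haaV ?haVa ?hwa. Qed.

Let pre (g h r : B) : g * h = h * g -> g * (h * r) = h * (g * r).
Proof. by move=> gh; rewrite mulrA gh mulrA. Qed.
Let preq s (g h r : B) : g * h = s *: (h * g) -> g * (h * r) = s *: (h * (g * r)).
Proof. by move=> gh; rewrite mulrA gh -scalerAl mulrA. Qed.
Let kD' i j r : k i * (k j * r) = k (i + j) * r.
Proof. by rewrite mulrA hdkD. Qed.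
Let aD' i j r : a i * (a j * r) = a (i + j) * r.
Proof. by rewrite mulrA hdaD. Qed.
Let xy' r : x * (y * r) = q ^ (2 * m ^+ 2) *: (y * (x * r)) + r.
Proof. by rewrite mulrA hxy mulrDl -scalerAl mul1r mulrA. Qed.
Let zw' r : z * (w * r) = q ^ (- (2 * n ^+ 2)) *: (w * (z * r)) + r.
Proof. by rewrite mulrA hzw mulrDl -scalerAl mul1r mulrA. Qed.

Let rules := (hdka, hdkD, hdaD, hdxk, hdyk, hdzk, hdwk, hdxa, hdya, hdza, hdwa,
  hxy, hzw, hzx, hzy, hwx, hwy).
Let rules' r := (fun i j => preq r (hdka i j), fun i j => kD' i j r,
  fun i j => aD' i j r,
  (fun i => pre r (hdxk i), fun i => pre r (hdyk i), fun i => pre r (hdzk i),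
  fun i => pre r (hdwk i), fun i => pre r (hdxa i), fun i => pre r (hdya i),
  fun i => pre r (hdza i), fun i => pre r (hdwa i)),
  xy' r, zw' r, preq r (hzx d), preq r (hzy d), preq r (hwx d), preq r (hwy d)).

Local Ltac normal := repeat (progress rewrite ?rules ?rules' -?mulrA ?mulrDl
  ?mulrDr ?scalerDr -?scalerAl -?scalerAr ?scalerA ?mulr1 ?mul1r ?qD).

Lemma monoE s s' i i' j j' r : s = s' -> i = i' -> j = j' ->
  q ^ s *: (a i * (k j * r)) = q ^ s' *: (a i' * (k j' * r)).
Proof. by move=> -> -> ->. Qed.

(** The original generators recovered from the new ones. *)
Definition heis_image (g : heis_gen) : B :=
  match g with
  | Ga => a 1
  | GaV => a (-1)
  | GK => k 1
  | GKV => k (-1)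
  | Gb => a (- n) * (k n * w)
  | Gc => a m * (k m * y)
  | GE => a (- 2 * m) * x
  | GF => q ^ (n ^+ 2) *: (a (2 * n) * (k (- n) * z))
  end.

Arguments invexpz : simpl never.
(** Every word is rewritten into a combination of the normal forms
    [q^s a^i K^j ...], after which only identities between integer exponents
    remain. *)
Lemma heis_image_respects : respects (heis_rel qs m n) heis_image.
Proof.
have e1 : 1 = q ^ 0 :> K by rewrite expr0z.
have eV : q^-1 = q ^ (-1) by rewrite exprN1.
move=> t u; case; rewrite /= ?peval_pxexpz /= ?eV; normal.
all: rewrite -?[sval qs]/(\val qs) //.
all: try by (apply: monoE; ring).
all: try by rewrite ?subrr ?addNr invexpz0 scale1r.
all: try by rewrite subrr expr0z scale1r [1 + _]addrC.
- by congr (a _ * _); ring.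
- by rewrite -[LHS]scale1r -(expr0z q); apply: monoE; ring.
- rewrite (invexpzM _ _ (haaV d)) ?haVa // !(invexpzM _ _ (hkkV d)) ?hkVk //.
  by congr (_ + _); [apply: monoE; ring | congr (a _ * k _); ring].
- rewrite (invexpzM _ _ (haaV d)) ?haVa //; congr (_ + _); first by apply: monoE; ring.
  have -> : n ^+ 2 - - n * - n = 0 by ring.
  by rewrite addNr invexpz0 mulr1 expr0z scale1r mul1r; congr (a _); ring.
Qed.
End Morphism.

Local Notation D := (heis qs m n).
Local Notation gen := (heis_elt qs m n).
Local Notation R := (heis_rel qs m n).

Lemma heis_pi t : \pi_(presented R) t = peval gen t.
Proof.
elim: t => [x|g|t IHt u IHu|t IHt u IHu] //=.
- rewrite -[RHS]/(pmul (pcst R x) (pcst R 1)) -pcstM mulr1 //.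
- by rewrite piD IHt IHu.
- by rewrite piM IHt IHu.
Qed.

Lemma heis_relP t u : R t u -> peval gen t = peval gen u.
Proof. by move=> h; rewrite -!heis_pi; apply: pres_eqP; apply: pc_rel. Qed.

Lemma heis_ind (S : D -> Prop) :
  (forall s x y, S x -> S y -> S (s *: x + y)) -> S 1 ->
  (forall x y, S x -> S y -> S (x * y)) -> (forall g, S (gen g)) ->
  forall x, S x.
Proof.
move=> SL S1 SM Sg; elim/quotW => t; rewrite heis_pi.
have S0 : S 0 by rewrite -(addNr (1 : D)) -scaleN1r; apply: SL.
elim: t => [c|g|t IHt u IHu|t IHt u IHu] //=.
- by rewrite -[c *: 1]addr0; apply: SL.
- by rewrite -[peval gen t]scale1r; apply: SL.
- exact: SM.
Qed.

Section Lift.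
Variables (B : algType K) (d : heis_data B).

Definition heis_lift : D -> B := plift (heis_image d).

Lemma heis_liftP : is_alg_morph heis_lift.
Proof.
have h := @heis_image_respects _ d; split=> [s x y|].
  by rewrite /heis_lift pliftD // pliftZ.
by split=> [|x y]; [apply: plift1|apply: pliftM].
Qed.

Lemma heis_lift_gen g : heis_lift (gen g) = heis_image d g.
Proof. exact: plift_gen (@heis_image_respects _ d) g. Qed.
End Lift.

(** The converse direction: whatever satisfies the original relations contains
    the data above. It is stated for an arbitrary algebra, as computing with
    variables is cheaper than computing in the presented algebra itself. *)
Section Relations.
Variables (B : algType K) (gen : heis_gen -> B).
Hypothesis genR : respects R gen.
Local Notation kG := (gen GK).
Local Notation kVG := (gen GKV).
Local Notation aG := (gen Ga).
Local Notation aVG := (gen GaV).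
Local Notation k i := (invexpz kG kVG i).
Local Notation a i := (invexpz aG aVG i).
Local Notation b := (gen Gb).
Local Notation c := (gen Gc).
Local Notation E := (gen GE).
Local Notation F := (gen GF).

Let rel t u (h : R t u) := genR h.

Lemma heis_kkV : kG * kVG = 1.
Proof. by have := rel (hr_KKV qs m n); rewrite /= scale1r. Qed.
Lemma heis_kVk : kVG * kG = 1.
Proof. by have := rel (hr_KVK qs m n); rewrite /= scale1r. Qed.
Lemma heis_aaV : aG * aVG = 1.
Proof. by have := rel (hr_aaV qs m n); rewrite /= scale1r. Qed.
Lemma heis_aVa : aVG * aG = 1.
Proof. by have := rel (hr_aVa qs m n); rewrite /= scale1r. Qed.
Lemma heis_ka : kG * aG = q^-1 *: (aG * kG).
Proof. by have := rel (hr_Ka qs m n); rewrite /= -scalerAl mul1r. Qed.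

Let qcomm_flip s (g h : B) : s != 0 -> g * h = s *: (h * g) ->
  h * g = s^-1 *: (g * h).
Proof. by move=> s0 ->; rewrite scalerA mulVf // scale1r. Qed.

Local Ltac rel H := have := rel H; rewrite /= -?scalerAl ?mul1r.

Let kD i j : k i * k j = k (i + j).
Proof. by rewrite invexpzD ?heis_kkV ?heis_kVk. Qed.
Let aD i j : a i * a j = a (i + j).
Proof. by rewrite invexpzD ?heis_aaV ?heis_aVa. Qed.
Let ak (g : B) s t i : g * aG = q ^ s *: (aG * g) -> t = s * i ->
  g * a i = q ^ t *: (a i * g).
Proof.
by move=> e ->; rewrite (qcomm_invexpz _ _ _ _ e) ?heis_aaV ?heis_aVa ?exprz_exp.
Qed.
Let kk (g : B) s t i : g * kG = q ^ s *: (kG * g) -> t = s * i ->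
  g * k i = q ^ t *: (k i * g).
Proof.
by move=> e ->; rewrite (qcomm_invexpz _ _ _ _ e) ?heis_kkV ?heis_kVk ?exprz_exp.
Qed.
Let flip s (g h : B) : g * h = q ^ s *: (h * g) -> h * g = q ^ (- s) *: (g * h).
Proof. by move=> e; rewrite -invr_expz; apply: qcomm_flip. Qed.

Let ba i : b * a i = q ^ (- (n * i)) *: (a i * b).
Proof. by apply: (@ak _ (- n)); [apply: flip; rel (hr_ab qs m n)|ring]. Qed.
Let ca i : c * a i = q ^ (- (m * i)) *: (a i * c).
Proof. by apply: (@ak _ (- m)); [apply: flip; rel (hr_ac qs m n)|ring]. Qed.
Let Ea i : E * a i = a i * E.
Proof.
rewrite -[RHS]scale1r -(expr0z q); apply: (@ak _ 0); last by rewrite mul0r.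
by rewrite expr0z scale1r; rel (hr_Ea qs m n).
Qed.
Let Fa i : F * a i = q ^ (n * i) *: (a i * F).
Proof. by apply: (@ak _ n) => //; rel (hr_Fa qs m n). Qed.
Let ka i j : k i * a j = q ^ (- (i * j)) *: (a j * k i).
Proof.
apply: (@ak _ (- i)); last by ring.
by apply: flip; apply: (@kk _ 1); [apply: (@flip (-1)); rewrite exprN1 heis_ka|ring].
Qed.
Let bk i : b * k i = q ^ (- (n * i)) *: (k i * b).
Proof. by apply: (@kk _ (- n)); [apply: flip; rel (hr_Kb qs m n)|ring]. Qed.
Let ck i : c * k i = q ^ (m * i) *: (k i * c).
Proof.
apply: (@kk _ m) => //; rewrite -[m in q ^ m]opprK; apply: flip; rel (hr_Kc qs m n) => //.
Qed.
Let Ek i : E * k i = q ^ (- (2 * m * i)) *: (k i * E).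
Proof. by apply: (@kk _ (- (2 * m))); [apply: flip; rel (hr_KE qs m n)|ring]. Qed.
Let Fk i : F * k i = q ^ (2 * n * i) *: (k i * F).
Proof.
apply: (@kk _ (2 * n)) => //; rewrite -[2 * n]opprK; apply: flip; rel (hr_KF qs m n) => //.
Qed.
Let cb : c * b = b * c. Proof. by rel (hr_bc qs m n). Qed.
Let FE : F * E = E * F. Proof. by rel (hr_EF qs m n). Qed.
Let Eb : E * b = b * E. Proof. by rel (hr_Eb qs m n). Qed.
Let Ec : E * c = c * E + a (- m) * k m.
Proof. by rel (hr_Ec qs m n); rewrite !peval_pxexpz. Qed.
Let Fb : F * b = q ^ (- n ^+ 2) *: (b * F) + a n.
Proof. by rel (hr_Fb qs m n); rewrite !peval_pxexpz. Qed.
Let Fc : F * c = q ^ (m * n) *: (c * F). Proof. by rel (hr_Fc qs m n). Qed.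

Let pre (g h r : B) : g * h = h * g -> g * (h * r) = h * (g * r).
Proof. by move=> gh; rewrite mulrA gh mulrA. Qed.
Let preq s (g h r : B) : g * h = s *: (h * g) -> g * (h * r) = s *: (h * (g * r)).
Proof. by move=> gh; rewrite mulrA gh -scalerAl mulrA. Qed.
Let kD' i j r : k i * (k j * r) = k (i + j) * r.
Proof. by rewrite mulrA kD. Qed.
Let aD' i j r : a i * (a j * r) = a (i + j) * r.
Proof. by rewrite mulrA aD. Qed.
Let Ec' r : E * (c * r) = c * (E * r) + a (- m) * (k m * r).
Proof. by rewrite mulrA Ec mulrDl !mulrA. Qed.
Let Fb' r : F * (b * r) = q ^ (- n ^+ 2) *: (b * (F * r)) + a n * r.
Proof. by rewrite mulrA Fb mulrDl -scalerAl !mulrA. Qed.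

Let rules := (ka, kD, aD, ba, ca, Ea, Fa, bk, ck, Ek, Fk, cb, FE, Eb, Ec, Fb, Fc).
Let rules' r := (fun i j => preq r (ka i j), fun i j => kD' i j r,
  fun i j => aD' i j r,
  (fun i => preq r (ba i), fun i => preq r (ca i), fun i => pre r (Ea i),
  fun i => preq r (Fa i), fun i => preq r (bk i), fun i => preq r (ck i),
  fun i => preq r (Ek i), fun i => preq r (Fk i)),
  pre r cb, pre r FE, pre r Eb, Ec' r, Fb' r, preq r Fc).

Local Ltac normal := repeat (progress rewrite ?rules ?rules' -?mulrA ?mulrDl
  ?mulrDr ?scalerDr -?scalerAl -?scalerAr ?scalerA ?mulr1 ?mul1r ?qD).

Lemma monoD s s' i i' j j' (r : B) : s = s' -> i = i' -> j = j' ->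
  q ^ s *: (a i * (k j * r)) = q ^ s' *: (a i' * (k j' * r)).
Proof. by move=> -> -> ->. Qed.

Let kcomm (g : B) : g * k 1 = k 1 * g -> g * kG = kG * g.
Proof. by rewrite invexpz1. Qed.
Let acomm (g : B) : g * a 1 = a 1 * g -> g * aG = aG * g.
Proof. by rewrite invexpz1. Qed.

Let X := a (2 * m) * E.
Let Y := a (- m) * c * k (- m).
Let Z := q ^ (- n ^+ 2) *: (a (- (2 * n)) * F * k n).
Let W := a n * b * k (- n).
Let XE : X = a (2 * m) * E. Proof. by []. Qed.
Let YE : Y = a (- m) * (c * k (- m)). Proof. by rewrite mulrA. Qed.
Let ZE : Z = q ^ (- n ^+ 2) *: (a (- (2 * n)) * (F * k n)). Proof. by rewrite mulrA. Qed.
Let WE : W = a n * (b * k (- n)). Proof. by rewrite mulrA. Qed.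
Let YE' : Y = q ^ (- (m * m)) *: (a (- m) * (k (- m) * c)).
Proof. by rewrite YE ck -scalerAr; congr (q ^ _ *: _); ring. Qed.
Let ZE' : Z = q ^ (n ^+ 2) *: (a (- (2 * n)) * (k n * F)).
Proof. by rewrite ZE Fk -scalerAr scalerA qD; congr (q ^ _ *: _); ring. Qed.
Let WE' : W = q ^ (n ^+ 2) *: (a n * (k (- n) * b)).
Proof. by rewrite WE bk -scalerAr; congr (q ^ _ *: _); ring. Qed.
Let a0 i : i = 0 -> a i = 1. Proof. by move=> ->; rewrite invexpz0. Qed.
Let unit0 s i j : s = 0 -> i = 0 -> j = 0 -> q ^ s *: (a i * k j) = 1 :> B.
Proof. by move=> -> -> ->; rewrite !invexpz0 mul1r expr0z scale1r. Qed.

Definition heis_data_of : heis_data B.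
Proof.
apply: (@HeisData _ kG kVG aG aVG X Y Z W heis_kkV heis_kVk heis_aaV heis_aVa heis_ka).
1-4: apply: kcomm. 5-8: apply: acomm.
all: rewrite ?XE ?YE' ?ZE' ?WE'; normal.
all: try by (apply: monoD; ring).
- by congr (a _ * _); ring.
- congr (_ + _); first by apply: monoD; ring.
  by apply: unit0; ring.
- congr (_ + _); first by apply: monoD; ring.
  by apply: unit0; ring.
Defined.

Lemma heis_image_of : heis_image heis_data_of =1 gen.
Proof.
have unit s i j r : s = 0 -> i = 0 -> j = 0 -> q ^ s *: (a i * (k j * r)) = r.
  by move=> -> -> ->; rewrite !invexpz0 !mul1r expr0z scale1r.
case; rewrite /= ?invexpz1 ?invexpzN1 //.
- by rewrite -/W WE'; normal; apply: unit; ring.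
- by rewrite -/Y YE'; normal; apply: unit; ring.
- by rewrite -/X XE; normal; rewrite a0 ?mul1r //; ring.
- by rewrite -/Z ZE'; normal; apply: unit; ring.
Qed.

End Relations.

Definition heis_data_self : heis_data D := heis_data_of heis_relP.

Lemma heis_image_self : heis_image heis_data_self =1 gen.
Proof. exact: heis_image_of. Qed.

(** Morphisms that agree on a unit agree on its inverse, so the inverses of K
    and a need not be checked in the extensionality lemmas below. *)
Lemma alg_morph_inv (B : algType K) (f g : D -> B) u v : u * v = 1 -> v * u = 1 ->
  is_alg_morph f -> is_alg_morph g -> f u = g u -> f v = g v.
Proof.
move=> uv vu [_ [f1 fM]] [_ [g1 gM]] fgu.
by rewrite -[f v]mulr1 -g1 -uv gM -fgu mulrA -fM vu f1 mul1r.
Qed.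

Lemma alg_morphP (B : algType K) (f : D -> B) : is_alg_morph f ->
  [/\ f 1 = 1, forall x y, f (x * y) = f x * f y, forall x y, f (x + y) = f x + f y,
     forall s x, f (s *: x) = s *: f x & f 0 = 0].
Proof.
case=> fL [f1 fM].
have f0 : f 0 = 0.
  by have := fL (-1) 0 0; rewrite scaler0 addr0 scaleN1r addNr.
split=> // [x y|s x].
- by have := fL 1 x y; rewrite !scale1r.
- by have := fL s x 0; rewrite f0 !addr0.
Qed.

Section LiftValues.
Variables (B : algType K) (d : heis_data B).
Local Notation f := (heis_lift d).

Let fg := heis_lift_gen d.
Let fm := (heis_liftP d).2.
Let fM := fm.2.
Let fZ s x : f (s *: x) = s *: f x. Proof. by have [_ _ _ ->] := alg_morphP (heis_liftP d). Qed.
Local Notation k i := (invexpz (hk d) (hkV d) i).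
Local Notation a i := (invexpz (ha d) (haV d) i).

Lemma heis_lift_k : f (hk heis_data_self) = hk d.
Proof. by rewrite -[hk d](invexpz1 _ (hkV d)); exact: fg. Qed.
Lemma heis_lift_a : f (ha heis_data_self) = ha d.
Proof. by rewrite -[ha d](invexpz1 _ (haV d)); exact: fg. Qed.
Lemma heis_lift_kV : f (hkV heis_data_self) = hkV d.
Proof. by rewrite -[hkV d](invexpzN1 (hk d)); exact: fg. Qed.
Lemma heis_lift_aV : f (haV heis_data_self) = haV d.
Proof. by rewrite -[haV d](invexpzN1 (ha d)); exact: fg. Qed.

Lemma heis_lift_kz i : f (heis_Kexp qs m n i) = k i.
Proof.
by rewrite [LHS](monoid_morph_invexpz _ _ _ fm) -heis_lift_k -heis_lift_kV.
Qed.
Lemma heis_lift_az i : f (heis_aexp qs m n i) = a i.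
Proof.
by rewrite [LHS](monoid_morph_invexpz _ _ _ fm) -heis_lift_a -heis_lift_aV.
Qed.

Lemma heis_lift_x : f (hx heis_data_self) = hx d.
Proof.
rewrite [LHS]fM heis_lift_az [f _]fg /= mulrA hdaD (_ : 2 * m + _ = 0); last by ring.
by rewrite invexpz0 mul1r.
Qed.

Lemma heis_lift_y : f (hy heis_data_self) = hy d.
Proof.
rewrite [LHS]fM [X in X * _]fM heis_lift_az heis_lift_kz [f _]fg /=.
rewrite -!mulrA hdyk (mulrA (k m)) hdkD subrr invexpz0 mul1r.
by rewrite (mulrA (a _)) hdaD addNr invexpz0 mul1r.
Qed.

Lemma heis_lift_w : f (hw heis_data_self) = hw d.
Proof.
rewrite [LHS]fM [X in X * _]fM heis_lift_az heis_lift_kz [f _]fg /=.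
rewrite -!mulrA hdwk (mulrA (k n)) hdkD subrr invexpz0 mul1r.
by rewrite (mulrA (a _)) hdaD subrr invexpz0 mul1r.
Qed.

Lemma heis_lift_z : f (hz heis_data_self) = hz d.
Proof.
rewrite [LHS]fZ fM [X in X * _]fM heis_lift_az heis_lift_kz [f _]fg /=.
rewrite -scalerAr -scalerAl scalerA qD addNr expr0z scale1r.
rewrite -!mulrA hdzk (mulrA (k _)) hdkD addNr invexpz0 mul1r.
by rewrite (mulrA (a _)) hdaD addNr invexpz0 mul1r.
Qed.
End LiftValues.

Lemma heis_ext_gen (d : heis_data D) (B : algType K) (f g : D -> B) :
  heis_image d =1 gen -> is_alg_morph f -> is_alg_morph g ->
  [/\ f (hk d) = g (hk d), f (ha d) = g (ha d),
      f (hx d) = g (hx d), f (hy d) = g (hy d)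
    & f (hz d) = g (hz d) /\ f (hw d) = g (hw d)] ->
  f =1 g.
Proof.
move=> dE fm gm [ek dega degx ey [degz ew]].
have [f1 fM fD fZ _] := alg_morphP fm; have [g1 gM gD gZ _] := alg_morphP gm.
have ekV := alg_morph_inv (hkkV d) (hkVk d) fm gm ek.
have eaV := alg_morph_inv (haaV d) (haVa d) fm gm dega.
have fe x y i : f x = g x -> f y = g y -> f (invexpz x y i) = g (invexpz x y i).
  by move=> h1 h2; rewrite (monoid_morph_invexpz _ _ _ fm.2) (monoid_morph_invexpz _ _ _ gm.2)
    h1 h2.
apply: heis_ind => [s x y IHx IHy||x y IHx IHy|h].
- by rewrite fD gD fZ gZ IHx IHy.
- by rewrite f1 g1.
- by rewrite fM gM IHx IHy.
- rewrite -dE; case: h; rewrite /heis_image.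
  all: by rewrite ?(fZ, gZ) ?(fM, gM) ?(fe _ _ _ ek ekV) ?(fe _ _ _ dega eaV) ?degx ?ey ?degz ?ew.
Qed.

Lemma heis_ext (B : algType K) (f g : D -> B) : is_alg_morph f -> is_alg_morph g ->
  [/\ f (hk heis_data_self) = g (hk heis_data_self), f (ha heis_data_self) = g (ha heis_data_self),
      f (hx heis_data_self) = g (hx heis_data_self), f (hy heis_data_self) = g (hy heis_data_self)
    & f (hz heis_data_self) = g (hz heis_data_self) /\ f (hw heis_data_self) = g (hw
      heis_data_self)] ->
  f =1 g.
Proof. exact: heis_ext_gen heis_image_self. Qed.

(** The tautological data of the algebra, made opaque so that unification does
    not unfold its components into products of the original generators. *)
Fact heis_std_ex : {d : heis_data D | d = heis_data_self}. Proof. by eexists. Qed.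
Definition heis_std := sval heis_std_ex.
Lemma heis_stdE : heis_std = heis_data_self. Proof. exact: svalP heis_std_ex. Qed.
Lemma stdKE : heis_elt qs m n GK = hk heis_std. Proof. by rewrite heis_stdE. Qed.
Lemma stdaE : heis_elt qs m n Ga = ha heis_std. Proof. by rewrite heis_stdE. Qed.
Lemma stdKexp i : heis_Kexp qs m n i = invexpz (hk heis_std) (hkV heis_std) i. Proof. by
  rewrite heis_stdE. Qed.
Lemma stdaexp i : heis_aexp qs m n i = invexpz (ha heis_std) (haV heis_std) i. Proof. by
  rewrite heis_stdE. Qed.
Lemma stdE' : heis_E' qs m n = hx heis_std. Proof. by rewrite heis_stdE. Qed.
Lemma stdc' : heis_c' qs m n = hy heis_std. Proof. by rewrite heis_stdE. Qed.
Lemma stdF' : heis_F' qs m n = hz heis_std. Proof. by rewrite heis_stdE. Qed.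
Lemma stdb' : heis_b' qs m n = hw heis_std. Proof. by rewrite heis_stdE. Qed.

End SecondPresentation.

(** * The quantum torus on K, a, x, z, u and v *)

Section Torus.
Variables (K : fieldType) (qs : kstar K) (m n : int).
Local Notation q := (val qs).
Hypothesis q_not_root : forall l : nat, (0 < l)%N -> q ^+ l != 1.
Hypotheses (m0 : m != 0) (n0 : n != 0).
Let q0 : q != 0 := valP qs.

Lemma qz_eq1 i : q ^ i = 1 -> i = 0.
Proof.
case: i => [[//|l]|l] /eqP.
- by rewrite -exprnP (negPf (q_not_root _)).
- by rewrite NegzE -invr_expz invr_eq1 -exprnP (negPf (q_not_root _)).
Qed.

Lemma qz_inj i j : q ^ i = q ^ j -> i = j.
Proof.
move=> e; apply/eqP; rewrite -subr_eq0; apply/eqP; apply: qz_eq1.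
by rewrite expfzDr // e -expfzDr // subrr expr0z.
Qed.

(** The exponents of K, a, x, z, u and v, in this order. *)
Definition expo := (int * int * int * int * int * int)%type.

Definition degK (e : expo) := e.1.1.1.1.1.
Definition dega (e : expo) := e.1.1.1.1.2.
Definition degx (e : expo) := e.1.1.1.2.
Definition degz (e : expo) := e.1.1.2.
Definition degu (e : expo) := e.1.2.
Definition degv (e : expo) := e.2.

(** [X e X f = q^(torus_form e f) X (e + f)] means that monomials are ordered as
    K, a, x, z, u, v; the terms come from [a K = q K a],
    [u x = q^(-2m^2) x u], [v z = q^(2n^2) z v] and [z x = q^(2mn) x z]. *)
Definition torus_form (e f : expo) : int :=
  dega e * degK f - 2 * m ^+ 2 * (degu e * degx f) + 2 * n ^+ 2 * (degv e * degz f)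
  + 2 * m * n * (degz e * degx f).

Fact torus_chiDl a b c :
  q ^ torus_form (a + b) c = q ^ torus_form a c * q ^ torus_form b c.
Proof. by rewrite -expfzDr //; congr (q ^ _); rewrite /torus_form /=; ring. Qed.
Fact torus_chiDr a b c :
  q ^ torus_form a (b + c) = q ^ torus_form a b * q ^ torus_form a c.
Proof. by rewrite -expfzDr //; congr (q ^ _); rewrite /torus_form /=; ring. Qed.
Fact torus_chi_neq0 a b : q ^ torus_form a b != 0.
Proof. exact: expfz_neq0. Qed.

Definition torus_chi : bicharacter K expo :=
  Bicharacter torus_chiDl torus_chiDr torus_chi_neq0.

Definition torus : twisted_algebra torus_chi := twisted_group_algebra torus_chi.
Local Notation T := torus.
Local Notation X e := (tX torus e).

Lemma torusM e f : X e * X f = q ^ torus_form e f *: X (e + f).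
Proof. exact: tXM. Qed.

Definition expo_pos : pred expo :=
  let p := fun i : int => 0 < i in
  cone_lex (cone_lex (cone_lex (cone_lex (cone_lex p p) p) p) p) p.

Lemma expo_cone : is_cone expo_pos.
Proof. by do 5 (apply: cone_lexP; last exact: int_cone); exact: int_cone. Qed.

Lemma torus_domain (f g : T) : f != 0 -> g != 0 -> f * g != 0.
Proof. exact: tdomain expo_cone. Qed.

Lemma torus_mulIf (f g h : T) : f != 0 -> g * f = h * f -> g = h.
Proof.
move=> f0 e; apply/eqP; rewrite -subr_eq0; apply: contraT => gh.
by have := torus_domain gh f0; rewrite mulrBl e subrr eqxx.
Qed.

Local Notation tk := (X (1, 0, 0, 0, 0, 0)).
Local Notation ta := (X (0, 1, 0, 0, 0, 0)).
Local Notation tx := (X (0, 0, 1, 0, 0, 0)).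
Local Notation tz := (X (0, 0, 0, 1, 0, 0)).
Local Notation tu := (X (0, 0, 0, 0, 1, 0)).
Local Notation tv := (X (0, 0, 0, 0, 0, 1)).

Definition cu : K := (q ^ (2 * m ^+ 2) - 1)^-1.
Definition cv : K := (q ^ (- (2 * n ^+ 2)) - 1)^-1.

Lemma cu_neq0 : q ^ (2 * m ^+ 2) - 1 != 0.
Proof.
rewrite subr_eq0; apply: contraNneq m0 => /qz_eq1 /eqP.
by rewrite mulf_eq0 sqrf_eq0.
Qed.
Lemma cv_neq0 : q ^ (- (2 * n ^+ 2)) - 1 != 0.
Proof.
rewrite subr_eq0; apply: contraNneq n0 => /qz_eq1 /eqP.
by rewrite oppr_eq0 mulf_eq0 sqrf_eq0.
Qed.

Section QuantumTorusData.
Variables (B : algType K) (X : expo -> B).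
Hypothesis X0 : X 0 = 1.
Hypothesis XM : forall e f, X e * X f = q ^ torus_form e f *: X (e + f).

Local Notation ux := (X (0, 0, -1, 0, 1, 0)).
Local Notation x' := (X (0, 0, -1, 0, 0, 0)).
Local Notation vz := (X (0, 0, 0, -1, 0, 1)).
Local Notation z' := (X (0, 0, 0, -1, 0, 0)).

Let pD (a b c d e f a' b' c' d' e' f' : int) : (a,b,c,d,e,f) + (a',b',c',d',e',f') =
  (a+a',b+b',c+c',d+d',e+e',f+f') :> expo. Proof. by []. Qed.
Let ratio (p : K) (U : B) : p - 1 != 0 ->
    (p - 1)^-1 *: (p *: U - 1) = (p * (p - 1)^-1) *: (U - 1) + 1.
Proof.
  move=> p1; rewrite !scalerBr scalerA mulrC -addrA; congr (_ + _).
  rewrite -[X in _ = _ + X]scale1r -!scaleNr -scalerDl; congr (_ *: _).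
  by field.
Qed.

(** Solving the definitions of [u] and [v] for [y] and [w] gives
    [y = (q^(2m^2) - 1)^-1 (u - 1) x^-1], and similarly for [w]. The relations
    are checked in an arbitrary algebra with such a family of monomials. *)
Definition qtorus_data : heis_data qs m n B.
Proof.
apply: (@HeisData _ _ _ _ B
  (X (1, 0, 0, 0, 0, 0)) (X (-1, 0, 0, 0, 0, 0))
  (X (0, 1, 0, 0, 0, 0)) (X (0, -1, 0, 0, 0, 0))
  (X (0, 0, 1, 0, 0, 0)) (cu *: (q ^ (2 * m ^+ 2) *: ux - x'))
  (X (0, 0, 0, 1, 0, 0)) (cv *: (q ^ (- (2 * n ^+ 2)) *: vz - z'))).
all: rewrite -?scalerAl -?scalerAr ?scalerA ?mulrBl ?mulrBr.
all: rewrite -?scalerAl -?scalerAr ?scalerA ?XM ?scalerA.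
all: rewrite /torus_form /degK /dega /degx /degz /degu /degv /=.
all: rewrite ?pD ?(mulr0, mul0r, mulr1, mul1r, mulrN, mulNr, opprK, oppr0, subr0, sub0r, addr0,
  add0r, subrr, addNr, expr0z).
all: rewrite -?[(0,0,0,0,0,0)]/(0 : expo) ?X0 ?scale1r -?expfzDr // ?subrr ?addNr ?expr0z
  ?scale1r //.
- by rewrite expr1z mulVf // scale1r.
- exact: ratio cu_neq0.
- exact: ratio cv_neq0.
- by rewrite ?(expfzDr _ _ q0) ?(scalerBr, scalerA); congr (_ *: _ - _ *: _); ring.
- by rewrite ?(expfzDr _ _ q0) ?(scalerBr, scalerA); congr (_ *: _ - _ *: _); ring.
rewrite !(expfzDr _ _ q0) !(scalerBr, scalerA) !opprD !opprK [LHS]addrACA.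
by congr (_ *: _ - _ *: _ + (- (_ *: _) + _ *: _)); ring.
Defined.

Lemma qtorus_invexpz (e : int -> expo) i : (forall i j, e (i + j) = e i + e j) ->
  (forall i j, torus_form (e i) (e j) = 0) ->
  invexpz (X (e 1)) (X (e (-1))) i = X (e i).
Proof.
move=> eD e00; have XE i' j : X (e i') * X (e j) = X (e (i' + j)).
  by rewrite XM e00 expr0z scale1r eD.
have e0 : e 0 = 0 by apply: (addIr (e 0)); rewrite -eD !add0r.
have Xe0 : X (e 0) = 1 by rewrite e0.
elim/int_rec: i => [|l IHl|l IHl]; first by rewrite invexpz0.
- rewrite intS [1 + _]addrC invexpzS ?XE ?subrr ?addNr ?Xe0 // IHl.
  by rewrite XE addrC.
- have -> : - (l.+1%:Z) = - l%:Z - 1 by rewrite intS opprD addrC.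
  rewrite invexpzP ?XE ?subrr ?addNr ?Xe0 // IHl.
  by rewrite XE addrC.
Qed.

Local Notation simp_form := (mulr0, mul0r, mulr1, mul1r, mulrN, add0r, addr0, subr0, sub0r).

Lemma qtorus_u : (q ^ (2 * m ^+ 2) - 1) *:
    (cu *: (q ^ (2 * m ^+ 2) *: ux - x') * X (0, 0, 1, 0, 0, 0)) + 1 =
  X (0, 0, 0, 0, 1, 0).
Proof.
rewrite -scalerAl scalerA mulfV ?cu_neq0 // scale1r mulrBl -scalerAl !XM scalerA.
rewrite -expfzDr // /torus_form /degK /dega /degx /degz /degu /degv /= !pD !simp_form.
by rewrite subrr addNr expr0z !scale1r -[(0,0,0,0,0,0)]/(0 : expo) X0 subrK.
Qed.

Lemma qtorus_v : (q ^ (- (2 * n ^+ 2)) - 1) *: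
    (cv *: (q ^ (- (2 * n ^+ 2)) *: vz - z') * X (0, 0, 0, 1, 0, 0)) + 1 =
  X (0, 0, 0, 0, 0, 1).
Proof.
rewrite -scalerAl scalerA mulfV ?cv_neq0 // scale1r mulrBl -scalerAl !XM scalerA.
rewrite -expfzDr // /torus_form /degK /dega /degx /degz /degu /degv /= !pD !simp_form.
by rewrite !addNr expr0z !scale1r -[(0,0,0,0,0,0)]/(0 : expo) X0 subrK.
Qed.

Lemma qtorus_nmon i j s t : X (i, 0, 0, 0, 0, 0) * X (0, j, 0, 0, 0, 0) *
    X (0, 0, 0, 0, 1, 0) ^+ s * X (0, 0, 0, 0, 0, 1) ^+ t =
  X (i, j, 0, 0, s%:Z, t%:Z).
Proof.
have uE l : X (0, 0, 0, 0, 1, 0) ^+ l = X (0, 0, 0, 0, l%:Z, 0).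
  elim: l => [|l IHl]; first by rewrite expr0 -X0.
  rewrite exprS IHl XM /torus_form /degK /dega /degx /degz /degu /degv /= !pD !simp_form.
  by rewrite expr0z scale1r intS.
have vE l : X (0, 0, 0, 0, 0, 1) ^+ l = X (0, 0, 0, 0, 0, l%:Z).
  elim: l => [|l IHl]; first by rewrite expr0 -X0.
  rewrite exprS IHl XM /torus_form /degK /dega /degx /degz /degu /degv /= !pD !simp_form.
  by rewrite expr0z scale1r intS.
rewrite uE vE.
by do 3 (rewrite XM -?scalerAl /torus_form /degK /dega /degx /degz /degu /degv /= !pD
  ?simp_form expr0z scale1r).
Qed.
End QuantumTorusData.

Definition torus_data : heis_data qs m n torus := qtorus_data (tX0 _) torusM.

Lemma torus_k i : invexpz (hk torus_data) (hkV torus_data) i = X (i, 0, 0, 0, 0, 0).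
Proof.
apply: (@qtorus_invexpz T (fun e => X e) (tX0 _) torusM (fun i => (i, 0, 0, 0, 0, 0))) => //.
by move=> i' j; rewrite /torus_form /degK /dega /degx /degz /degu /degv /= !(mulr0, mul0r).
Qed.
Lemma torus_a i : invexpz (ha torus_data) (haV torus_data) i = X (0, i, 0, 0, 0, 0).
Proof.
apply: (@qtorus_invexpz T (fun e => X e) (tX0 _) torusM (fun i => (0, i, 0, 0, 0, 0))) => //.
by move=> i' j; rewrite /torus_form /degK /dega /degx /degz /degu /degv /= !(mulr0, mul0r).
Qed.
Lemma torus_x : hx torus_data = X (0, 0, 1, 0, 0, 0). Proof. by []. Qed.
Lemma torus_z : hz torus_data = X (0, 0, 0, 1, 0, 0). Proof. by []. Qed.
Lemma torus_y : hy torus_data =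
  cu *: (q ^ (2 * m ^+ 2) *: X (0, 0, -1, 0, 1, 0) - X (0, 0, -1, 0, 0, 0)).
Proof. by []. Qed.
Lemma torus_w : hw torus_data =
  cv *: (q ^ (- (2 * n ^+ 2)) *: X (0, 0, 0, -1, 0, 1) - X (0, 0, 0, -1, 0, 0)).
Proof. by []. Qed.
End Torus.

(** * A spanning set *)

Lemma qcomm_expr (K : fieldType) (B : algType K) (g x : B) s l :
  g * x = s *: (x * g) -> g * x ^+ l = s ^+ l *: (x ^+ l * g).
Proof.
move=> gx; elim: l => [|l IHl]; first by rewrite scale1r mulr1 mul1r.
by rewrite [in LHS]exprS mulrA gx -scalerAl -[x * g * _]mulrA IHl -scalerAr scalerA -exprS
  mulrA -exprS.
Qed.

(** In a quantum Weyl algebra [x] acts as a q-derivation with respect to [y];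
    the value of [c], a q-integer, does not matter for spanning. *)
Lemma qweyl_expr (K : fieldType) (B : algType K) (x y : B) p l :
  x * y = p *: (y * x) + 1 ->
  exists c, x * y ^+ l = p ^+ l *: (y ^+ l * x) + c *: y ^+ l.-1.
Proof.
move=> xy; elim: l => [|l [c IHl]].
  by exists 0; rewrite !expr0 scale1r scale0r addr0 mulr1 mul1r.
exists (p * (if l is 0%N then 0 else c) + 1).
rewrite [in LHS]exprS mulrA xy mulrDl mul1r -scalerAl -[y * x * _]mulrA IHl mulrDr.
rewrite scalerDr -!scalerAr !scalerA -exprS -addrA mulrA -exprS; congr (_ + _).
rewrite scalerDl scale1r; congr (_ + _).
case: l IHl => [IHl|l _] /=; last by rewrite -exprS.
suff -> : c = 0 by rewrite mulr0 !scale0r.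
have /eqP : c *: (1 : B) = 0.
  by have := IHl; rewrite !expr0 scale1r mulr1 mul1r => /eqP; rewrite -subr_eq0 opprD addrA
    subrr sub0r oppr_eq0 => /eqP.
by rewrite scaler_eq0 oner_eq0 orbF => /eqP.
Qed.

Section Spanning.
Variables (K : fieldType) (qs : kstar K) (m n : int).
Local Notation q := (val qs).
Let q0 : q != 0 := valP qs.
Local Notation D := (heis qs m n).
Local Notation d := (heis_std qs m n).
Local Notation k i := (invexpz (hk d) (hkV d) i).
Local Notation a i := (invexpz (ha d) (haV d) i).
Local Notation x := (hx d).
Local Notation y := (hy d).
Local Notation z := (hz d).
Local Notation w := (hw d).

(** Sets closed under the algebra operations are tested on the new generators. *)
Lemma heis_ind_std (S : D -> Prop) :
  (forall s g h, S g -> S h -> S (s *: g + h)) ->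
  (forall g h, S g -> S h -> S (g * h)) ->
  (forall i, S (k i)) -> (forall i, S (a i)) -> S x -> S y -> S z -> S w ->
  forall g, S g.
Proof.
move=> SL SM Sk Sa Sx Sy Sz Sw.
have S1 : S 1 by rewrite -(invexpz0 (hk d) (hkV d)).
have S0 : S 0 by rewrite -(addNr (1 : D)) -scaleN1r; apply: SL.
have SZ s g : S g -> S (s *: g) by move=> Sg; rewrite -[_ *: _]addr0; apply: SL.
apply: heis_ind => //.
move=> h; rewrite -(heis_image_self qs m n h) -heis_stdE; case: h; rewrite /heis_image.
- exact: Sa.
- exact: Sa.
- by apply: (SM); [exact: Sa | apply: (SM); [exact: Sk | exact: Sw]].
- by apply: (SM); [exact: Sa | apply: (SM); [exact: Sk | exact: Sy]].
- exact: Sk.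
- exact: Sk.
- by apply: (SM); [exact: Sa | exact: Sx].
- by apply: (SZ); apply: (SM); [exact: Sa | apply: (SM); [exact: Sk | exact: Sz]].
Qed.

(** The exponents of K, a, y, x, w, z: within each Weyl pair the element that
    acts as a derivation is written on the right. *)
Definition oexp := (int * int * nat * nat * nat * nat)%type.

Definition omon (e : oexp) : D :=
  let: (i, j, l, l', r, r') := e in
  k i * (a j * (y ^+ l * (x ^+ l' * (w ^+ r * z ^+ r')))).

Definition osum : {malg K[oexp]} -> D := linext (fun e c => c *: omon e).

Lemma osumD : {morph osum : f g / f + g}.
Proof. by apply: linextD => e c c'; rewrite scalerDl. Qed.

Lemma osumU c e : osum << c *g e >> = c *: omon e.
Proof. by apply: linextU; rewrite scale0r. Qed.

Definition ospan (g : D) := exists f, g = osum f.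

Lemma ospanL s g h : ospan g -> ospan h -> ospan (s *: g + h).
Proof.
move=> [f ->] [f' ->]; exists (s *: f + f').
rewrite osumD; congr (_ + _); rewrite /osum /linext scaler_sumr.
have [->|s0] := eqVneq s 0.
  rewrite scale0r msupp0 big_seq_fset0; apply: big1 => e _; exact: scale0r.
rewrite (_ : msupp (s *: f) = msupp f).
  by apply: eq_bigr => e _; rewrite mcoeffZ scalerA.
by rewrite msuppZ (negPf s0).
Qed.

Lemma ospan0 : ospan 0.
Proof. by exists 0; rewrite /osum /linext msupp0 big_seq_fset0. Qed.
Lemma ospanZ s g : ospan g -> ospan (s *: g).
Proof. by move=> og; rewrite -[_ *: _]addr0; apply: ospanL => //; exact: ospan0. Qed.
Lemma ospanM e : ospan (omon e).
Proof. by exists << 1 *g e >>; rewrite osumU scale1r. Qed.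
Lemma ospan_ind (g : D) (P : D -> Prop) :
  (forall s g h, P g -> P h -> P (s *: g + h)) -> P 0 -> (forall e, P (omon e)) ->
  ospan g -> P g.
Proof.
move=> PL P0 Pe [f ->]; rewrite /osum /linext.
apply: (big_ind P) => // [u v Pu Pv|e _]; first by rewrite -[u]scale1r; apply: PL.
by rewrite -[_ *: _]addr0; apply: PL.
Qed.

Let pre s (g h r : D) : g * h = s *: (h * g) -> g * (h * r) = s *: (h * (g * r)).
Proof. by move=> gh; rewrite mulrA gh -scalerAl mulrA. Qed.
Let pre1 (g h r : D) : g * h = h * g -> g * (h * r) = h * (g * r).
Proof. by move=> gh; rewrite mulrA gh mulrA. Qed.

Lemma ospan_stable g : (forall e, ospan (g * omon e)) ->
  forall h, ospan h -> ospan (g * h).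
Proof.
move=> Hg h; apply: (@ospan_ind h (fun h => ospan (g * h))) => // [s u v Hu Hv|]; last by
  rewrite mulr0; exact: ospan0.
by rewrite mulrDr -scalerAr; apply: ospanL.
Qed.

Lemma ospan_k i e : ospan (k i * omon e).
Proof.
case: e => [[[[[i' j] l] l'] r] r']; rewrite /omon mulrA hdkD.
exact: (ospanM (_, _, _, _, _, _)).
Qed.

Lemma ospan_a i e : ospan (a i * omon e).
Proof.
case: e => [[[[[i' j] l] l'] r] r']; rewrite /omon.
have ak : a i * k i' = q ^ (i' * i) *: (k i' * a i).
  by rewrite hdka scalerA -expfzDr // subrr scale1r.
rewrite (pre _ ak); apply: ospanZ; rewrite (mulrA (a i)) hdaD.
exact: (ospanM (_, _, _, _, _, _)).
Qed.

Lemma ospan_y e : ospan (y * omon e).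
Proof.
case: e => [[[[[i j] l] l'] r] r']; rewrite /omon.
rewrite (pre1 _ (hdyk _ _)) (pre1 _ (hdya _ _)) (mulrA y) -exprS.
exact: (ospanM (_, _, _, _, _, _)).
Qed.

Lemma ospan_x e : ospan (x * omon e).
Proof.
case: e => [[[[[i j] l] l'] r] r']; rewrite /omon.
rewrite (pre1 _ (hdxk _ _)) (pre1 _ (hdxa _ _)) (mulrA x).
have [c ->] := qweyl_expr l (hxy d).
rewrite mulrDl !mulrDr -!scalerAl -!scalerAr -(mulrA _ x) (mulrA x) -exprS.
by apply: ospanL; [|apply: ospanZ]; exact: (ospanM (_, _, _, _, _, _)).
Qed.

Lemma ospan_w e : ospan (w * omon e).
Proof.
case: e => [[[[[i j] l] l'] r] r']; rewrite /omon.
rewrite (pre1 _ (hdwk _ _)) (pre1 _ (hdwa _ _)).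
rewrite (pre _ (qcomm_expr l (hwy d))) (pre _ (qcomm_expr l' (hwx d))).
rewrite (mulrA w) -exprS -!scalerAr; do 2 apply: ospanZ.
exact: (ospanM (_, _, _, _, _, _)).
Qed.

Lemma ospan_z e : ospan (z * omon e).
Proof.
case: e => [[[[[i j] l] l'] r] r']; rewrite /omon.
rewrite (pre1 _ (hdzk _ _)) (pre1 _ (hdza _ _)).
rewrite (pre _ (qcomm_expr l (hzy d))) (pre _ (qcomm_expr l' (hzx d))).
rewrite -!scalerAr; do 2 apply: ospanZ.
rewrite (mulrA z); have [c ->] := qweyl_expr r (hzw d).
rewrite mulrDl !mulrDr -!scalerAl -!scalerAr -(mulrA _ z) -exprS.
by apply: ospanL; [|apply: ospanZ]; exact: (ospanM (_, _, _, _, _, _)).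
Qed.

(** The span of the ordered monomials contains 1 and is stable under left
    multiplication by each generator. *)
Lemma ospan_all g : ospan g.
Proof.
suff H h : ospan h -> ospan (g * h).
  rewrite -[g]mulr1; apply: H; rewrite [1](_ : _ = omon (0, 0, 0%N, 0%N, 0%N, 0%N)).
    exact: ospanM.
  by rewrite /omon !invexpz0 !expr0 !mulr1.
elim/heis_ind_std: g h => [s g g' Hg Hg'|g g' Hg Hg'|i|i||||] h.
- by move=> oh; rewrite mulrDl -scalerAl; apply: ospanL; auto.
- by move=> /Hg' /Hg; rewrite mulrA.
- by apply: ospan_stable; apply: ospan_k.
- by apply: ospan_stable; apply: ospan_a.
- by apply: ospan_stable; apply: ospan_x.
- by apply: ospan_stable; apply: ospan_y.
- by apply: ospan_stable; apply: ospan_z.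
- by apply: ospan_stable; apply: ospan_w.
Qed.
End Spanning.

(** * The embedding into a quantum torus *)

Section Embedding.
Variables (K : fieldType) (qs : kstar K) (m n : int).
Local Notation q := (val qs).
Hypothesis q_not_root : forall l : nat, (0 < l)%N -> q ^+ l != 1.
Hypotheses (m0 : m != 0) (n0 : n != 0).
Let q0 : q != 0 := valP qs.
Local Notation D := (heis qs m n).
Local Notation d := (heis_std qs m n).
Local Notation T := (torus qs m n).
Local Notation X e := (tX T e).
Local Notation k i := (invexpz (hk d) (hkV d) i).
Local Notation a i := (invexpz (ha d) (haV d) i).
Local Notation x := (hx d).
Local Notation y := (hy d).
Local Notation z := (hz d).
Local Notation w := (hw d).
Local Notation cu := (cu qs m).
Local Notation cv := (cv qs n).

Local Notation tcoef := (@tcoef K expo _ T).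
Local Notation tsupp := (@tsupp K expo _ T).
Local Notation omon := (omon qs m n).
Local Notation osum := (@osum K qs m n).

Definition theta : D -> T := heis_lift (torus_data q_not_root m0 n0).
Local Notation Th := theta.

Lemma thetaP : is_alg_morph Th. Proof. exact: heis_liftP. Qed.
Lemma theta1 : Th 1 = 1. Proof. by have [] := alg_morphP thetaP. Qed.
Lemma theta0 : Th 0 = 0. Proof. by have [] := alg_morphP thetaP. Qed.
Lemma thetaM g h : Th (g * h) = Th g * Th h. Proof. by have [] := alg_morphP thetaP. Qed.
Lemma thetaD g h : Th (g + h) = Th g + Th h. Proof. by have [] := alg_morphP thetaP. Qed.
Lemma thetaZ s g : Th (s *: g) = s *: Th g. Proof. by have [] := alg_morphP thetaP. Qed.
Lemma thetaN g : Th (- g) = - Th g. Proof. by rewrite -scaleN1r thetaZ scaleN1r. Qed.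
Lemma thetaB g h : Th (g - h) = Th g - Th h. Proof. by rewrite thetaD thetaN. Qed.
Lemma thetaX g l : Th (g ^+ l) = Th g ^+ l.
Proof. by elim: l => [|l IHl]; rewrite ?expr0 ?theta1 // !exprS thetaM IHl. Qed.

Lemma theta_k i : Th (k i) = X (i, 0, 0, 0, 0, 0).
Proof.
by rewrite heis_stdE [LHS]heis_lift_kz torus_k.
Qed.
Lemma theta_a i : Th (a i) = X (0, i, 0, 0, 0, 0).
Proof.
by rewrite heis_stdE [LHS]heis_lift_az torus_a.
Qed.
Lemma theta_x : Th x = X (0, 0, 1, 0, 0, 0).
Proof. by rewrite heis_stdE [LHS]heis_lift_x torus_x. Qed.
Lemma theta_y : Th y =
  cu *: (q ^ (2 * m ^+ 2) *: X (0, 0, -1, 0, 1, 0) - X (0, 0, -1, 0, 0, 0)).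
Proof. by rewrite heis_stdE [LHS]heis_lift_y torus_y. Qed.
Lemma theta_z : Th z = X (0, 0, 0, 1, 0, 0).
Proof. by rewrite heis_stdE [LHS]heis_lift_z torus_z. Qed.
Lemma theta_w : Th w =
  cv *: (q ^ (- (2 * n ^+ 2)) *: X (0, 0, 0, -1, 0, 1) - X (0, 0, 0, -1, 0, 0)).
Proof. by rewrite heis_stdE [LHS]heis_lift_w torus_w. Qed.

Local Notation lead := (@is_lead K expo _ T expo_pos).

Let cu0 : cu != 0. Proof. by rewrite invr_eq0 cu_neq0. Qed.
Let cv0 : cv != 0. Proof. by rewrite invr_eq0 cv_neq0. Qed.

Lemma lead_two (s : K) e f : s != 0 -> expo_pos (e - f) ->
  lead (s *: X e - X f) e.
Proof.
move=> s0 ef; have fe : (f == e) = false.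
  by apply: contraTF ef => /eqP ->; rewrite subrr.
split; first by rewrite in_tsupp tcoefD tcoefN tcoefZ !tcoefX eqxx fe subr0 mulr1.
move=> g; rewrite in_tsupp tcoefD tcoefN tcoefZ !tcoefX.
have [<-|eg] := eqVneq e g; first by rewrite ?eqxx.
by have [<-|fg] := eqVneq f g; rewrite ?mulr0 ?subr0 ?eqxx.
Qed.

(** The leading exponent of an ordered monomial: [y] is [u x^-1] and [w] is
    [v z^-1] up to scalars and terms of lower degree in [u] and [v]. *)
Definition lexp (e : oexp) : expo :=
  let: (i, j, l, l', r, r') := e in
  (i, j, l'%:Z - l%:Z, r'%:Z - r%:Z, l%:Z, r%:Z).

Lemma lexp_inj : injective lexp.
Proof.
move=> [[[[[i j] l] l'] r] r'] [[[[[i1 j1] l1] l1'] r1] r1'] e.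
have eq f := congr1 f e.
have := (eq _ degK, eq _ dega, eq _ degx, eq _ degz, eq _ degu, eq _ degv).
rewrite /lexp /degK /dega /degx /degz /degu /degv /= => -[[[[[-> ->] e1] e2] [el]] [er]].
by congr (_, _, _, _, _, _); lia.
Qed.

Lemma lead_omon e : lead (Th (omon e)) (lexp e).
Proof.
case: e => [[[[[i j] l] l'] r] r']; rewrite /omon !thetaM !thetaX.
rewrite theta_k theta_a theta_x theta_y theta_z theta_w.
have -> : lexp (i, j, l, l', r, r') = (i, 0, 0, 0, 0, 0) + ((0, j, 0, 0, 0, 0) +
  ((0, 0, -1, 0, 1, 0) *+ l + ((0, 0, 1, 0, 0, 0) *+ l' +
   ((0, 0, 0, -1, 0, 1) *+ r + (0, 0, 0, 1, 0, 0) *+ r')))).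
  have pM (a1 a2 a3 a4 a5 a6 : int) N : (a1, a2, a3, a4, a5, a6) *+ N =
      (a1 *+ N, a2 *+ N, a3 *+ N, a4 *+ N, a5 *+ N, a6 *+ N) :> expo.
    by elim: N => [|N IHN] //; rewrite mulrS IHN !mulrS.
  rewrite !pM !mul0rn /lexp !mulNrn.
  have pD (a1 a2 a3 a4 a5 a6 b1 b2 b3 b4 b5 b6 : int) : (a1, a2, a3, a4, a5, a6) + (b1, b2, b3,
    b4, b5, b6) = (a1 + b1, a2 + b2, a3 + b3, a4 + b4, a5 + b5, a6 + b6) :> expo by [].
  rewrite !pD !addr0 !add0r !natz.
  by congr (_, _, _, _, _, _); rewrite // addrC.
have cp := expo_cone.
do ?[apply: lead_mul => //]; do ?[apply: lead_exp => //].
all: try exact: lead_X.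
all: by apply: lead_Z => //; apply: lead_two => //; rewrite expfz_neq0.
Qed.

(** The leading exponents of the ordered monomials are pairwise distinct, so a
    nontrivial combination of them cannot vanish in the torus. *)
Lemma theta_osum_eq0 f : Th (osum f) = 0 -> f = 0.
Proof.
move=> Tf; apply/eqP; apply: contra_eqT Tf => f0; apply/eqP => Tf.
have [e0 se0] : exists e, e \in msupp f.
  apply: contraPP f0 => nex; apply/negP; rewrite negbK; apply/eqP/malgP => e.
  by rewrite mcoeff0; apply/eqP; apply: contraPT nex; rewrite mcoeff_neq0 => se []; exists e.
have [e' /mapP[e se ->] emax] := cone_max expo_cone (map_f lexp se0).
have [lead_e _] := lead_omon e.
have : tcoef (Th (osum f)) (lexp e) = f@_e * tcoef (Th (omon e)) (lexp e).
  rewrite /osum /linext.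
  have TS (s : seq oexp) : Th (\sum_(e' <- s) f@_e' *: omon e') =
      \sum_(e' <- s) f@_e' *: Th (omon e').
    elim: s => [|e1 s IHs]; first by rewrite !big_nil theta0.
    by rewrite !big_cons thetaD thetaZ IHs.
  rewrite TS (big_fsetD1 e) //= tcoefD tcoefZ.
  rewrite -[RHS]addr0; congr (_ + _).
  rewrite (big_morph (fun g => tcoef g (lexp e)) (fun f g => tcoefD f g _) (tcoef0 _ _)).
  rewrite big1_fset //= => e1.
  rewrite in_fsetD1 => /andP[ee1 se1] _; apply/eqP.
  rewrite [eqbLHS]tcoefZ mulf_eq0; apply/orP; right.
  apply: contraT; rewrite -in_tsupp => st.
  have ne : lexp e1 != lexp e by rewrite (inj_eq lexp_inj).
  have [p0 pD _] := expo_cone.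
  have p1 := emax _ (map_f lexp se1) ne.
  have p2 := (lead_omon e1).2 _ st; rewrite eq_sym in ne.
  by have := pD _ _ p1 (p2 ne); rewrite addrC addrA subrK subrr (negPf p0).
rewrite Tf tcoef0 => /esym/eqP; rewrite mulf_eq0 -[B in B || _]negbK mcoeff_neq0 se /=.
by move: lead_e; rewrite in_tsupp => /negPf ->.
Qed.

Lemma theta_eq0 g : Th g = 0 -> g = 0.
Proof.
have [f ->] := ospan_all g; move/theta_osum_eq0 ->.
by rewrite /osum /linext msupp0 big_seq_fset0.
Qed.

Lemma theta_inj : injective Th.
Proof.
by move=> g h e; apply/eqP; rewrite -subr_eq0; apply/eqP/theta_eq0; rewrite thetaB e subrr.
Qed.

(** The image of the algebra is not the whole torus: only nonnegative powers of
    [u] and [v] occur. This makes [u] and [v] noninvertible, and later forces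
    exponents that add up to 0 or 1. *)
Lemma theta_supp g e : e \in tsupp (Th g) -> 0 <= degu e /\ 0 <= degv e.
Proof.
have TX f e' : e' \in tsupp (X f) -> e' = f.
  by rewrite in_tsupp tcoefX; have [->//|_] := eqVneq f e'; rewrite eqxx.
elim/heis_ind_std: g e => [s g h Hg Hh|g h Hg Hh|i|i||||] e.
- rewrite thetaD thetaZ in_tsupp tcoefD tcoefZ => nz.
  have [/Hg //|sg] := boolP (e \in tsupp (Th g)).
  apply: Hh; rewrite in_tsupp; apply: contra nz => /eqP ->.
  by move: sg; rewrite in_tsupp negbK => /eqP ->; rewrite mulr0 addr0.
- rewrite thetaM => /tsuppM[e1 [e2 [/Hg[u1 v1] /Hh[u2 v2] <-]]].
  by split; apply: addr_ge0.
- by rewrite theta_k => /TX ->.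
- by rewrite theta_a => /TX ->.
- by rewrite theta_x => /TX ->.
- rewrite theta_y in_tsupp tcoefZ tcoefD tcoefN tcoefZ !tcoefX => nz.
  have [<-//|ne] := eqVneq (0, 0, -1, 0, 1, 0) e.
  have [<-//|ne'] := eqVneq (0, 0, -1, 0, 0, 0) e.
  by move: nz; rewrite (negPf ne) (negPf ne') !(mulr0, subr0) eqxx.
- by rewrite theta_z => /TX ->.
- rewrite theta_w in_tsupp tcoefZ tcoefD tcoefN tcoefZ !tcoefX => nz.
  have [<-//|ne] := eqVneq (0, 0, 0, -1, 0, 1) e.
  have [<-//|ne'] := eqVneq (0, 0, 0, -1, 0, 0) e.
  by move: nz; rewrite (negPf ne) (negPf ne') !(mulr0, subr0) eqxx.
Qed.

(** ** The normal elements u and v *)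

Definition hu : D := (q ^ (2 * m ^+ 2) - 1) *: (y * x) + 1.
Definition hv : D := (q ^ (- (2 * n ^+ 2)) - 1) *: (w * z) + 1.

Lemma theta_u : Th hu = X (0, 0, 0, 0, 1, 0).
Proof.
rewrite thetaD thetaZ thetaM theta1 theta_x theta_y.
exact: (qtorus_u q_not_root m0 (tX0 _) (@torusM _ _ _ _)).
Qed.

Lemma theta_v : Th hv = X (0, 0, 0, 0, 0, 1).
Proof.
rewrite thetaD thetaZ thetaM theta1 theta_z theta_w.
exact: (qtorus_v q_not_root n0 (tX0 _) (@torusM _ _ _ _)).
Qed.

Definition nmon (i j : int) (s t : nat) : D := k i * a j * hu ^+ s * hv ^+ t.

Lemma nmonE i j s t : nmon i j s t = k i * a j * hu ^+ s * hv ^+ t.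
Proof. by []. Qed.
Lemma huE : hu = (q ^ (2 * m ^+ 2) - 1) *: (y * x) + 1. Proof. by []. Qed.
Lemma hvE : hv = (q ^ (- (2 * n ^+ 2)) - 1) *: (w * z) + 1. Proof. by []. Qed.

Lemma theta_nmon i j s t : Th (nmon i j s t) = X (i, j, 0, 0, s%:Z, t%:Z).
Proof.
rewrite !thetaM !thetaX theta_k theta_a theta_u theta_v.
exact: (qtorus_nmon (tX0 _) (@torusM _ _ _ _)).
Qed.
End Embedding.

(** * Elements without left inverse *)

Section NotInvertible.
Variables (K : fieldType) (qs : kstar K) (m n : int).
Local Notation D := (heis qs m n).
Local Notation R := (heis_rel qs m n).
Local Notation d := (heis_std qs m n).
Local Notation gen := (heis_elt qs m n).

(** The operators of the representation [hrep] are linear. *)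
Lemma hrep0 t z i j : hrep qs m n t (fun _ _ _ => 0) z i j = 0.
Proof.
rewrite -[RHS](mul0r (hrep qs m n t (fun _ _ _ => 0) z i j)) -hrepZ.
congr (hrep qs m n t _ z i j).
by apply/funext => ?; apply/funext => ?; apply/funext => ?; rewrite mul0r.
Qed.

(** A generator with a nonzero kernel in some representation has no left inverse;
    below, [E] kills the functions supported at [i = 0], and [F] those supported
    at [j = 0]. *)
Lemma not_left_inv_gen g f : hrep_gen qs m n g f = (fun _ _ _ => 0) -> f 0 0%N 0%N != 0 ->
  forall h : D, h * gen g != 1.
Proof.
move=> gf f0; elim/quotW => t; apply/eqP.
rewrite -[_ * _]/(pmul _ _) -piM => /pres_eqK /(hrep_cong f 0 0 0) /=.
by rewrite gf hrep0 mul1r => e; rewrite -e eqxx in f0.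
Qed.

Lemma x_not_left_inv (h : D) : h * hx d != 1.
Proof.
rewrite -stdE' /heis_E' mulrA.
apply: (@not_left_inv_gen _ (fun _ i _ => (i == 0%N)%:R)); last by rewrite oner_eq0.
by apply/funext => ?; apply/funext => ?; apply/funext => ?.
Qed.

(** [F'] is a product of units with [F], but the unit [K^n] on its right has to
    be conjugated away first. *)
Lemma z_not_left_inv (h : D) : h * hz d != 1.
Proof.
rewrite -stdF' /heis_F' /heis_Kexp -scalerAr !mulrA; apply/eqP => e.
set kn := invexpz _ _ n in e; set kN := invexpz (gen GK) (gen GKV) (- n).
have kK : kN * kn = 1 by apply: invexpzVl; [apply: heis_kkV|apply: heis_kVk]; exact: heis_relP.
have Kk : kn * kN = 1 by apply: invexpzVr; [apply: heis_kkV|apply: heis_kVk]; exact: heis_relP.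
move: e; set u := _ *: _ => e.
have e' : kn * u * kN = 1 by rewrite e mulr1 Kk.
move: e'; rewrite /u -scalerAr -scalerAl !mulrA -(mulrA _ kn kN) Kk mulr1 2!scalerAl => /eqP.
apply/negP; apply: (@not_left_inv_gen _ (fun _ _ j => (j == 0%N)%:R)); last by rewrite oner_eq0.
by apply/funext => ?; apply/funext => ?; apply/funext => ? /=; rewrite mulr0.
Qed.
End NotInvertible.

(** * Normal elements *)

Section Normal.
Variables (K : fieldType) (qs : kstar K) (m n : int).
Local Notation q := (val qs).
Hypothesis q_not_root : forall l : nat, (0 < l)%N -> q ^+ l != 1.
Hypotheses (m0 : m != 0) (n0 : n != 0).
Let q0 : q != 0 := valP qs.
Local Notation D := (heis qs m n).
Local Notation d := (heis_std qs m n).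
Local Notation T := (torus qs m n).
Local Notation X e := (tX T e).
Local Notation k i := (invexpz (hk d) (hkV d) i).
Local Notation a i := (invexpz (ha d) (haV d) i).
Local Notation x := (hx d).
Local Notation y := (hy d).
Local Notation z := (hz d).
Local Notation w := (hw d).
Local Notation tcoef := (@tcoef K expo _ T).
Local Notation tsupp := (@tsupp K expo _ T).
Local Notation Th := (theta q_not_root m0 n0).
Local Notation form := (torus_form m n).
Local Notation hu := (hu qs m n).
Local Notation hv := (hv qs m n).
Local Notation nmon := (nmon qs m n).

Let Tinj := @theta_inj _ _ _ _ q_not_root m0 n0.
Let thE := (@theta1 _ _ _ _ q_not_root m0 n0, @thetaN _ _ _ _ q_not_root m0 n0,
  @thetaD _ _ _ _ q_not_root m0 n0, @thetaZ _ _ _ _ q_not_root m0 n0,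
  @thetaM _ _ _ _ q_not_root m0 n0).

Lemma theta_neq0 g : g != 0 -> Th g != 0.
Proof. by apply: contra_neq => /theta_eq0. Qed.

Lemma tsuppX e b : b \in tsupp (X e) -> b = e.
Proof.
rewrite in_tsupp tcoefX; have [->//|_] := eqVneq e b; by rewrite eqxx.
Qed.

Lemma tsupp1P (f : T) e : (forall b, b \in tsupp f -> b = e) ->
  f = tcoef f e *: X e.
Proof.
move=> fe; apply: tcoefP => b; rewrite tcoefZ tcoefX.
have [->|be] := eqVneq e b; first by rewrite mulr1.
rewrite mulr0; apply/eqP; apply: contraTT be; rewrite -in_tsupp => /fe ->.
by rewrite eqxx.
Qed.

Lemma expo_eqP (e f : expo) :
  [/\ degK e = degK f, dega e = dega f & degx e = degx f] ->
  [/\ degz e = degz f, degu e = degu f & degv e = degv f] -> e = f.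
Proof.
case: e f => [[[[[e1 e2] e3] e4] e5] e6] [[[[[f1 f2] f3] f4] f5] f6].
by rewrite /degK /dega /degx /degz /degu /degv /= => -[-> -> ->] [-> -> ->].
Qed.

(** An exponent is determined by its six coordinates, which are additive as are
    their opposites. *)
Lemma expo_leP (e b : expo) : (forall l : expo -> int, {morph l : a b / a + b} -> l b <= l e) ->
  b = e.
Proof.
move=> H; have E (l : expo -> int) : {morph l : a b / a + b} -> l b = l e.
  move=> lD; apply/eqP; rewrite eq_le H //=.
  have := H (fun g => - l g); rewrite lerN2; apply.
  by move=> g h; rewrite lD opprD.
by apply: expo_eqP; split; apply: E.
Qed.

(** By [tsupp_conj] in all directions, a conjugate of a monomial is supported at
    the same exponent. *)
Lemma conjX (f g : T) e : f != 0 -> X e * f = f * g -> exists c, g = c *: X e.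
Proof.
move=> f0 ef; exists (tcoef g e); apply: tsupp1P => b sb.
apply: expo_leP => l lD.
by have [e' /tsuppX -> //] := tsupp_conj lD expo_cone f0 ef sb.
Qed.

(** Monomials q-commute with each other, so a q-commutation with [X e] is tested
    exponent by exponent. *)
Lemma qcomm_supp (f : T) e c : X e * f = c *: (f * X e) ->
  forall b, b \in tsupp f -> c = q ^ (form e b - form b e).
Proof.
move=> ef b sb; have := congr1 (fun g => tcoef g (b + e)) ef.
rewrite tcoefXl tcoefZ tcoefXr addrK => /eqP.
move: sb; rewrite in_tsupp => fb; rewrite mulrA (inj_eq (mulIf fb)) => /eqP e'.
apply: (mulIf (bichar_neq0 (torus_chi qs m n) b e)); rewrite -e' /= -expfzDr //.
by rewrite subrK.
Qed.

Lemma comm_supp (f : T) e : X e * f = f * X e ->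
  forall b, b \in tsupp f -> form e b = form b e.
Proof.
move=> ef b sb; have := @qcomm_supp f e 1; rewrite scale1r => /(_ ef b sb).
by move=> /esym /(qz_eq1 q_not_root) /eqP; rewrite subr_eq0 => /eqP.
Qed.

Definition normal_elt (N : D) := forall g, exists g', g * N = N * g'.

Lemma normal_unit g h : g * h = 1 -> normal_elt g.
Proof. by move=> gh g'; exists (h * (g' * g)); rewrite mulrA gh mul1r. Qed.

(** Elements of the algebra that are monomials in the torus q-commute with every
    normal element. *)
Lemma normal_qcomm N g e : N != 0 -> normal_elt N -> Th g = X e ->
  exists2 c, g * N = c *: (N * g) & X e * Th N = c *: (Th N * X e).
Proof.
move=> N0 Nn ge; have [g' gN] := Nn g.
have eN : X e * Th N = Th N * Th g' by rewrite -ge -!thE gN.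
have [c g'E] := conjX (theta_neq0 N0) eN; exists c; last by rewrite eN g'E -scalerAr.
by apply: Tinj; rewrite !thE ge eN g'E -scalerAr.
Qed.

(** Write [g] for [x] and [h] for [y], so that [u - 1 = s h g] lies in the left
    ideal generated by [g]. Conjugation by [N] turns [u - 1] into an element [G]
    of the same left ideal, because [g] q-commutes with [N]. Comparing supports,
    [G = A u + B] with scalars [A] and [B], the only exponents on the segment
    from 0 to that of [u] being its ends. Then [A + B] lies in the left ideal
    too, so that [A + B = 0], as [g] has no left inverse. The terms of lowest
    degree in [u] give [B = -1], hence [G = u - 1]. (An invertible [x] would be
    normal without commuting with [u].) *)
Lemma normal_comm N g h u s ex' eu' : N != 0 -> normal_elt N ->
  (forall h' : D, h' * g != 1) -> s != 0 -> u = s *: (h * g) + 1 ->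
  Th g = X ex' -> Th u = X eu' ->
  (exists2 l : expo -> int, {morph l : a b / a + b} & 0 < l eu') ->
  (forall b, (forall l : expo -> int, {morph l : a b / a + b} -> l b <= Num.max 0 (l eu')) ->
     b = 0 \/ b = eu') ->
  X eu' * Th N = Th N * X eu'.
Proof.
move=> N0 Nn ginv s0 uE ge ue [l lD lu] seg.
have [c gN _] := normal_qcomm N0 Nn ge.
have [h' hN] := Nn h; have [G Gdef] : {G | G = (s * c) *: (h' * g)} by eexists.
have uN : (u - 1) * N = N * G.
  rewrite uE addrK -scalerAl -mulrA gN -scalerAr mulrA hN scalerA.
  by rewrite Gdef -scalerAr mulrA.
have uNT : (X eu' - 1) * Th N = Th N * Th G.
  by have := congr1 Th uN; rewrite !thE ue.
have N0' := theta_neq0 N0.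
have l0 : l 0 = 0 by apply: (addIr (l 0)); rewrite -lD !add0r.
have u0 : eu' != 0 by apply: contraTneq lu => ->; rewrite l0 ltxx.
have GE : Th G = tcoef (Th G) eu' *: X eu' + tcoef (Th G) 0 *: 1.
  apply: tcoefP => b; rewrite tcoefD !tcoefZ -(tX0 T) !tcoefX.
  have [sb|] := boolP (b \in tsupp (Th G)); last first.
    rewrite in_tsupp negbK => /eqP Gb; have [e|_] := eqVneq eu' b.
      rewrite {1}e Gb mul0r add0r; have -> : (0 == b) = false by rewrite -e eq_sym; exact/negbTE.
      by rewrite mulr0.
    rewrite mulr0 add0r; have [e|_] := eqVneq 0 b; last by rewrite Gb mulr0.
    by move: Gb; rewrite -e mulr1.
  have : b = 0 \/ b = eu'.
    apply: seg => l' lD'; have [b' sb' lb] := tsupp_conj lD' expo_cone N0' uNT sb.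
    apply: le_trans lb _; move: sb'.
    rewrite in_tsupp tcoefD tcoefN -(tX0 T) !tcoefX => nz.
    have l0' : l' 0 = 0 by apply: (addIr (l' 0)); rewrite -lD' !add0r.
    have [<-|ne] := eqVneq eu' b'; first by rewrite le_max lexx orbT.
    have [<-|ne'] := eqVneq 0 b'; first by rewrite l0' le_max lexx.
    by move: nz; rewrite (negPf ne) (negPf ne') subrr eqxx.
  case=> ->; rewrite eqxx.
    by rewrite (negPf u0) mulr0 add0r mulr1.
  by rewrite eq_sym (negPf u0) mulr0 addr0 mulr1.
set A := tcoef (Th G) eu' in GE; set B := tcoef (Th G) 0 in GE.
have GD : G = A *: u + B *: 1 by apply: Tinj; rewrite GE !thE ue.
(* G and u - 1 are left multiples of g, hence so is A + B *)
have AB : A + B = 0.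
  apply/eqP; apply: contraT => AB0.
  have /eqP[] := ginv ((A + B)^-1 *: ((s * c) *: h' - (A * s) *: h)).
  rewrite -scalerAl mulrBl -!scalerAl -Gdef GD uE.
  rewrite [A *: (_ + _)]scalerDr scalerA -[S in S - _]addrA -scalerDl addrAC subrr add0r.
  by rewrite scalerA mulVf // scale1r.
(* comparison of the terms of smallest degree in u *)
have lD' : {morph (fun g => - l g) : a b / a + b} by move=> a' b'; rewrite lD opprD.
have [b [b' [sb _ _ bmax _]]] := tsupp_max lD' expo_cone N0' (oner_neq0 T).
have nb : tcoef (Th N) (b - eu') = 0.
  apply/eqP; apply: contraT; rewrite -in_tsupp => /bmax.
  have <- : l (b - eu') + l eu' = l b by rewrite -lD subrK.
  by rewrite lerN2 gerDl leNgt lu.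
have := congr1 (fun f => tcoef f b) uNT; rewrite GE mulrBl mulrDr.
rewrite -!scalerAr mul1r mulr1 !(tcoefD, tcoefN, tcoefZ) tcoefXl tcoefXr nb !mulr0 sub0r add0r.
move/eqP; rewrite -mulN1r (inj_eq (mulIf _)) -?in_tsupp // => /eqP BE.
have A1 : A = 1 by move: AB; rewrite -BE => /eqP; rewrite subr_eq0 => /eqP.
move: uNT; rewrite GE A1 -BE scale1r scaleN1r mulrBl mulrBr mul1r mulr1.
by move/addIr.
Qed.

(* the bounds in the directions of the coordinates and of their opposites *)
Let Eseg (b : expo) (eu' : expo) :
  (forall l : expo -> int, {morph l : a b / a + b} -> l b <= Num.max 0 (l eu')) ->
  [/\ degK b <= Num.max 0 (degK eu'), dega b <= Num.max 0 (dega eu'), degx b <= Num.max 0 (degx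
    eu'),
     degz b <= Num.max 0 (degz eu') & degu b <= Num.max 0 (degu eu') /\ degv b <= Num.max 0
       (degv eu')]
  /\ [/\ - degK b <= Num.max 0 (- degK eu'), - dega b <= Num.max 0 (- dega eu'), - degx b <=
    Num.max 0 (- degx eu'),
     - degz b <= Num.max 0 (- degz eu') & - degu b <= Num.max 0 (- degu eu') /\ - degv b <=
       Num.max 0 (- degv eu')].
Proof.
move=> H; have N (l : expo -> int) : {morph l : a b / a + b} -> - l b <= Num.max 0 (- l eu').
  by move=> lD; apply: (H (fun g => - l g)) => g h; rewrite lD opprD.
by split; split; do ?split; first [apply: H | apply: N].
Qed.

Lemma normal_comm_u N : N != 0 -> normal_elt N ->
  X (0, 0, 0, 0, 1, 0) * Th N = Th N * X (0, 0, 0, 0, 1, 0).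
Proof.
move=> N0 Nn; apply: (@normal_comm N x y hu (q ^ (2 * m ^+ 2) - 1) (0, 0, 1, 0, 0, 0)) => //.
- exact: x_not_left_inv.
- exact: cu_neq0 q_not_root m0.
- exact: theta_x.
- exact: theta_u.
- by exists degu.
move=> b /Eseg; case: b => [[[[[b1 b2] b3] b4] b5] b6].
rewrite /degK /dega /degx /degz /degu /degv /= => -[[H1 H2 H3 H4 [H5 H6]] [F1 F2 F3 F4 [F5 F6]]].
have [-> -> -> -> ->] : [/\ b1 = 0, b2 = 0, b3 = 0, b4 = 0 & b6 = 0] by split; lia.
have [->|->] : b5 = 0 \/ b5 = 1 by lia.
  by left.
by right.
Qed.

Lemma normal_comm_v N : N != 0 -> normal_elt N ->
  X (0, 0, 0, 0, 0, 1) * Th N = Th N * X (0, 0, 0, 0, 0, 1).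
Proof.
move=> N0 Nn; apply: (@normal_comm N z w hv (q ^ (- (2 * n ^+ 2)) - 1) (0, 0, 0, 1, 0, 0)) => //.
- exact: z_not_left_inv.
- exact: cv_neq0 q_not_root n0.
- exact: theta_z.
- exact: theta_v.
- by exists degv.
move=> b /Eseg; case: b => [[[[[b1 b2] b3] b4] b5] b6].
rewrite /degK /dega /degx /degz /degu /degv /= => -[[H1 H2 H3 H4 [H5 H6]] [F1 F2 F3 F4 [F5 F6]]].
have [-> -> -> -> ->] : [/\ b1 = 0, b2 = 0, b3 = 0, b4 = 0 & b5 = 0] by split; lia.
have [->|->] : b6 = 0 \/ b6 = 1 by lia.
  by left.
by right.
Qed.

(** All exponents of [N] q-commute in the same way with K, a, x and z, and
    [normal_comm_u], [normal_comm_v] exclude x and z from them. Since [q] is not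
    a root of unity, this leaves a single exponent. *)
Lemma normal_nmon N : N != 0 -> normal_elt N ->
  exists c i j s t, c != 0 /\ N = c *: nmon i j s t.
Proof.
move=> N0 Nn; have N0' := theta_neq0 N0.
have [b sb] := tsupp_neq0 N0'.
have [ub vb] := theta_supp sb.
have sx b' : b' \in tsupp (Th N) -> degx b' = 0 /\ degz b' = 0.
  move=> sb'; have := comm_supp (normal_comm_u N0 Nn) sb'.
  have := comm_supp (normal_comm_v N0 Nn) sb'.
  rewrite /torus_form /degK /dega /degx /degz /degu /degv /= => e1 e2.
  split; apply/eqP; [have := m0|have := n0]; nia.
have conj g e : Th g = X e -> forall b', b' \in tsupp (Th N) ->
    form e b' - form b' e = form e b - form b e.
  move=> ge b' sb'; have [c _ cN] := normal_qcomm N0 Nn ge.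
  by apply: (qz_inj q_not_root); rewrite -(qcomm_supp cN sb') -(qcomm_supp cN sb).
exists (tcoef (Th N) b), (degK b), (dega b), `|degu b|%N, `|degv b|%N; split.
  by rewrite -in_tsupp.
apply: Tinj; rewrite thE theta_nmon !gez0_abs //.
have -> : (degK b, dega b, 0, 0, degu b, degv b) = b.
  have [] := sx _ sb; case: (b) => [[[[[b1 b2] b3] b4] b5] b6].
  by rewrite /degK /dega /degx /degz /degu /degv /= => -> ->.
apply: tsupp1P => b' sb'.
have := conj _ _ (theta_k _ _ _ 1) _ sb'; have := conj _ _ (theta_a _ _ _ 1) _ sb'.
have := conj _ _ (theta_x _ _ _) _ sb'; have := conj _ _ (theta_z _ _ _) _ sb'.
have [] := sx _ sb; have [] := sx _ sb'.
case: (b) (b') => [[[[[b1 b2] b3] b4] b5] b6] [[[[[f1 f2] f3] f4] f5] f6].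
rewrite /torus_form /degK /dega /degx /degz /degu /degv /= => -> -> -> -> e1 e2 e3 e4.
have -> : f1 = b1 by lia.
have -> : f2 = b2 by lia.
have -> : f5 = b5 by apply/eqP; have := m0; nia.
have -> : f6 = b6 by apply/eqP; have := n0; nia.
by [].
Qed.

(** A unit and its inverse are both normal, with nonnegative exponents of [u] and
    [v] that add up to zero. *)
Lemma unit_nmon g h : g * h = 1 -> h * g = 1 ->
  exists c i j, c != 0 /\ g = c *: (k i * a j).
Proof.
move=> gh hg; have nz (u v : D) : u * v = 1 -> u != 0.
  by move=> uv; apply: contra_eq_neq uv => ->; rewrite mul0r eq_sym oner_eq0.
have [c [i [j [s [t [c0 gE]]]]]] := normal_nmon (nz _ _ gh) (normal_unit gh).
have [c' [i' [j' [s' [t' [c0' hE]]]]]] := normal_nmon (nz _ _ hg) (normal_unit hg).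
exists c, i, j; split=> //.
have := congr1 Th gh; rewrite gE hE thetaM !thetaZ !theta_nmon theta1 -scalerAr -scalerAl
  scalerA torusM.
rewrite scalerA => /(congr1 (fun f => tcoef f 0)).
rewrite tcoefZ -(tX0 T) !tcoefX eqxx.
have [e _|_] := eqVneq; last by rewrite mulr0 => /esym/eqP; rewrite oner_eq0.
have := congr1 degu e; have := congr1 degv e; rewrite /degu /degv /= => e1 e2.
have [-> ->] : s = 0%N /\ t = 0%N by lia.
by rewrite nmonE !expr0 !mulr1.
Qed.
End Normal.

(** * Automorphisms fixing the torus generators *)

Section Rigidity.
Variables (K : fieldType) (qs : kstar K) (m n : int).
Local Notation q := (val qs).
Hypothesis q_not_root : forall l : nat, (0 < l)%N -> q ^+ l != 1.
Hypotheses (m0 : m != 0) (n0 : n != 0).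
Let q0 : q != 0 := valP qs.
Local Notation D := (heis qs m n).
Local Notation d := (heis_std qs m n).
Local Notation T := (torus qs m n).
Local Notation X e := (tX T e).
Local Notation k i := (invexpz (hk d) (hkV d) i).
Local Notation a i := (invexpz (ha d) (haV d) i).
Local Notation x := (hx d).
Local Notation y := (hy d).
Local Notation z := (hz d).
Local Notation w := (hw d).
Local Notation tcoef := (@tcoef K expo _ T).
Local Notation tsupp := (@tsupp K expo _ T).
Local Notation Th := (theta q_not_root m0 n0).
Local Notation form := (torus_form m n).
Local Notation hu := (hu qs m n).
Local Notation hv := (hv qs m n).
Local Notation nmon := (nmon qs m n).

Let Tinj := @theta_inj _ _ _ _ q_not_root m0 n0.
Let thE := (@theta1 _ _ _ _ q_not_root m0 n0, @thetaN _ _ _ _ q_not_root m0 n0,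
  @thetaD _ _ _ _ q_not_root m0 n0, @thetaZ _ _ _ _ q_not_root m0 n0,
  @thetaM _ _ _ _ q_not_root m0 n0).

Local Notation aut := (algAut D).

Lemma aut_morph (phi : aut) : is_alg_morph phi.
Proof. by have [_ lf mf] := algAutP phi. Qed.

Definition auti (phi : aut) : aut := (phi^-1)%g.

Lemma autK (phi : aut) : cancel phi (auti phi).
Proof. by case: (svalP (algAut_inv_ex phi)). Qed.
Lemma autVK (phi : aut) : cancel (auti phi) phi.
Proof. by case: (svalP (algAut_inv_ex phi)). Qed.

Section Aut.
Variable phi : aut.
Lemma aut1 : phi 1 = 1. Proof. by have [] := alg_morphP (aut_morph phi). Qed.
Lemma autM g h : phi (g * h) = phi g * phi h.
Proof. by have [] := alg_morphP (aut_morph phi). Qed.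
Lemma autD g h : phi (g + h) = phi g + phi h.
Proof. by have [] := alg_morphP (aut_morph phi). Qed.
Lemma autZ s g : phi (s *: g) = s *: phi g.
Proof. by have [] := alg_morphP (aut_morph phi). Qed.
Lemma autX g l : phi (g ^+ l) = phi g ^+ l.
Proof. by elim: l => [|l IHl]; rewrite ?expr0 ?aut1 // !exprS autM IHl. Qed.

Lemma aut_neq0 g : g != 0 -> phi g != 0.
Proof. by apply: contra_neq => /(congr1 (auti phi)); rewrite autK => ->; have [] := alg_morphP
  (aut_morph (auti phi)). Qed.

Lemma aut_normal N : normal_elt N -> normal_elt (phi N).
Proof.
move=> Nn g; have [g' gN] := Nn (auti phi g).
by exists (phi g'); rewrite -autM -gN autM autVK.
Qed.
End Aut.

Lemma hu_neq0 : hu != 0.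
Proof.
apply: contra_eq_neq (theta_u q_not_root m0 n0) => ->; rewrite theta0.
apply/eqP => /(congr1 (fun f => tcoef f (0, 0, 0, 0, 1, 0))) /eqP.
by rewrite tcoef0 tcoefX eqxx eq_sym oner_eq0.
Qed.

Lemma hv_neq0 : hv != 0.
Proof.
apply: contra_eq_neq (theta_v q_not_root m0 n0) => ->; rewrite theta0.
apply/eqP => /(congr1 (fun f => tcoef f (0, 0, 0, 0, 0, 1))) /eqP.
by rewrite tcoef0 tcoefX eqxx eq_sym oner_eq0.
Qed.

Lemma hxu : x * hu = q ^ (2 * m ^+ 2) *: (hu * x).
Proof.
apply: Tinj; rewrite thetaZ !thetaM theta_x theta_u !torusM scalerA -expfzDr //.
by congr (q ^ _ *: X _); rewrite /torus_form /degK /dega /degx /degz /degu /degv /=; ring.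
Qed.
Lemma hxv : x * hv = hv * x.
Proof.
apply: Tinj; rewrite !thetaM theta_x theta_v !torusM.
by congr (q ^ _ *: X _); rewrite /torus_form /degK /dega /degx /degz /degu /degv /=; ring.
Qed.
Lemma hzv : z * hv = q ^ (- (2 * n ^+ 2)) *: (hv * z).
Proof.
apply: Tinj; rewrite thetaZ !thetaM theta_z theta_v !torusM scalerA -expfzDr //.
by congr (q ^ _ *: X _); rewrite /torus_form /degK /dega /degx /degz /degu /degv /=; ring.
Qed.
Lemma hzu : z * hu = hu * z.
Proof.
apply: Tinj; rewrite !thetaM theta_z theta_u !torusM.
by congr (q ^ _ *: X _); rewrite /torus_form /degK /dega /degx /degz /degu /degv /=; ring.
Qed.

Lemma heis_mulIf (g h h' : D) : g != 0 -> h * g = h' * g -> h = h'.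
Proof.
move=> g0 e; apply: Tinj; apply: (torus_mulIf (theta_neq0 q_not_root m0 n0 g0)).
by rewrite -!thetaM e.
Qed.

Lemma huv : hu * hv = hv * hu.
Proof.
apply: Tinj; rewrite !thetaM theta_u theta_v !torusM.
by congr (q ^ _ *: X _); rewrite /torus_form /degK /dega /degx /degz /degu /degv /=; ring.
Qed.

Lemma hx_neq0 : x != 0.
Proof.
apply: contra_eq_neq (theta_x q_not_root m0 n0) => ->; rewrite theta0.
apply/eqP => /(congr1 (fun f => tcoef f (0, 0, 1, 0, 0, 0))) /eqP.
by rewrite tcoef0 tcoefX eqxx eq_sym oner_eq0.
Qed.

Lemma hz_neq0 : z != 0.
Proof.
apply: contra_eq_neq (theta_z q_not_root m0 n0) => ->; rewrite theta0.
apply/eqP => /(congr1 (fun f => tcoef f (0, 0, 0, 1, 0, 0))) /eqP.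
by rewrite tcoef0 tcoefX eqxx eq_sym oner_eq0.
Qed.

(** An element [e] that commutes with [h g] q-commutes with [h] by the inverse
    of the factor for [g]; this gives the commutations of [y] and [w], which are
    not monomials of the torus. *)
Lemma partner_qcomm (g h u e : D) s r : g != 0 -> s != 0 -> r != 0 ->
  u = s *: (h * g) + 1 -> u * e = e * u -> g * e = r *: (e * g) ->
  h * e = r^-1 *: (e * h).
Proof.
move=> g0 s0 r0 uE ue ge; apply: (heis_mulIf g0).
have hge : (h * g) * e = e * (h * g).
  have : s *: ((h * g) * e) = s *: (e * (h * g)).
    by move: ue; rewrite uE mulrDl mulrDr mul1r mulr1 -scalerAl -scalerAr => /addIr.
  by move/(congr1 (fun f => s^-1 *: f)); rewrite !scalerA mulVf // !scale1r.
have eg : e * g = r^-1 *: (g * e) by rewrite ge scalerA mulVf // scale1r.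
by rewrite -mulrA eg -scalerAr mulrA hge -scalerAl mulrA.
Qed.

Lemma comm_ka_supp g : g * k 1 = k 1 * g -> g * a 1 = a 1 * g ->
  forall b, b \in tsupp (Th g) -> degK b = 0 /\ dega b = 0.
Proof.
move=> gk ga b sb.
have ek : X (1, 0, 0, 0, 0, 0) * Th g = Th g * X (1, 0, 0, 0, 0, 0).
  by rewrite -(theta_k q_not_root m0 n0) -!thetaM gk.
have ea' : X (0, 1, 0, 0, 0, 0) * Th g = Th g * X (0, 1, 0, 0, 0, 0).
  by rewrite -(theta_a q_not_root m0 n0) -!thetaM ga.
have := comm_supp q_not_root ek sb; have := comm_supp q_not_root ea' sb.
by rewrite /torus_form /degK /dega /degx /degz /degu /degv /=; lia.
Qed.

(** Two factors [Y X] of an element of degree one in [u] and [v] cannot both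
    have positive degree; if [Y] has degree zero, it is a multiple of the formal
    inverse of [x], and [x] would have a left inverse. *)
Lemma rigid_pair g h u s vx vu Xn Yn c : g != 0 ->
  (forall h' : D, h' * g != 1) -> s != 0 -> c != 0 ->
  u = s *: (h * g) + 1 -> Th g = X vx -> Th u = X vu -> degu vu + degv vu = 1 ->
  (forall b, b \in tsupp (Th Xn) -> (degK b, dega b, degx b, degz b) = (degK vx, dega vx, degx
    vx, degz vx)) ->
  (forall b, b \in tsupp (Th Yn) -> (degK b, dega b, degx b, degz b) = (- degK vx, - dega vx, -
    degx vx, - degz vx)) ->
  degu vx = 0 -> degv vx = 0 ->
  s *: (Yn * Xn) + 1 = c *: u ->
  exists2 l, l != 0 & Xn = l *: g /\ Yn = l^-1 *: h.
Proof.
have sum_le0 (i j : int) : 0 <= i -> 0 <= j -> i + j <= 0 -> i = 0 /\ j = 0.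
  by clear; lia.
move=> g0 ginv s0 c0 uE ge ue vu1 sX sY ux vx0 YX.
have YXT : s *: (Th Yn * Th Xn) = c *: X vu - X 0.
  have := congr1 Th YX; rewrite thetaD !thetaZ thetaM theta1 ue => <-.
  by rewrite tX0 addrK.
have vu0 : vu != 0 by apply: contra_eqN vu1 => /eqP ->.
have supp b : b \in tsupp (Th Yn * Th Xn) -> b = 0 \/ b = vu.
  move=> sb; have := congr1 (fun f => tcoef f b) YXT.
  rewrite tcoefD tcoefN !tcoefZ !tcoefX.
  have [<-|_] := eqVneq 0 b; first by left.
  have [<-|_] := eqVneq vu b; first by right.
  rewrite mulr0 subr0 => /eqP; rewrite mulf_eq0 (negPf s0) /=.
  by move: sb; rewrite in_tsupp => /negPf ->.
have YX0 : Th Yn * Th Xn != 0.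
  apply/eqP => e; have := congr1 (fun f => tcoef f vu) YXT.
  rewrite e scaler0 tcoef0 tcoefD tcoefN tcoefZ !tcoefX eqxx.
  by rewrite eq_sym (negPf vu0) subr0 mulr1 => /esym/eqP; rewrite (negPf c0).
have [Y0 X0] : Th Yn != 0 /\ Th Xn != 0.
  by split; apply: contraNneq YX0 => ->; rewrite ?mul0r ?mulr0.
pose l (b : expo) := degu b + degv b.
have lD : {morph l : b b' / b + b'} by move=> b b'; rewrite /l /degu /degv /=; ring.
have [b1 [b2 [s1 s2 /supp s12 max1 max2]]] := tsupp_max lD expo_cone Y0 X0.
have l12 : l b1 + l b2 <= 1.
  rewrite -lD; case: s12 => ->; first by rewrite /l /degu /degv.
  by rewrite /l vu1.
have Xl : (forall b, b \in tsupp (Th Xn) -> l b <= 0) -> exists2 c', c' != 0 & Xn = c' *: g.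
  move=> lX; have XE : Th Xn = tcoef (Th Xn) vx *: X vx.
    apply: tsupp1P => b sb; have := lX b sb; have := sX b sb; have := theta_supp sb.
    case: (b) (vx) ux vx0 => [[[[[e1 e2] e3] e4] e5] e6] [[[[[f1 f2] f3] f4] f5] f6].
    rewrite /l /degK /dega /degx /degz /degu /degv /= => -> -> [u5 u6] [-> -> -> ->] e56.
    by have [-> ->] := sum_le0 _ _ u5 u6 e56.
  exists (tcoef (Th Xn) vx); last by apply: Tinj; rewrite thetaZ ge -XE.
  by apply: contraNneq X0 => c'0; rewrite XE c'0 scale0r.
have [l2|l2] := lerP (l b2) 0.
  have [c' c'0 XE] := Xl (fun b sb => le_trans (max2 b sb) l2).
  exists c' => //; split=> //.
  (* c u - 1 and u - 1 are left multiples of g *)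
  have c1 : c = 1.
    apply/eqP; apply: contraT => c1.
    have /eqP[] := ginv ((c - 1)^-1 *: ((s * c') *: Yn - (c * s) *: h)).
    rewrite -scalerAl mulrBl -!scalerAl.
    have -> : (s * c') *: (Yn * g) = c *: u - 1.
      by rewrite -YX XE addrK -scalerAr scalerA.
    rewrite uE [c *: (_ + _)]scalerDr scalerA addrAC [(c * s) *: _ + _]addrC addrK.
    by rewrite -(scaleN1r (1 : D)) -scalerDl scalerA mulVf ?scale1r // subr_eq0.
  move: YX; rewrite c1 scale1r uE XE => /addIr.
  move/(congr1 (fun f => s^-1 *: f)); rewrite !scalerA mulVf // !scale1r => Yg.
  apply: (heis_mulIf g0); rewrite -scalerAl -Yg -scalerAr scalerA mulVf //.
  by rewrite scale1r.
have l1 : l b1 <= 0 by move: (l b1) (l b2) l12 l2 => i j; clear; lia.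
have YE : Th Yn = tcoef (Th Yn) (- vx) *: X (- vx).
  apply: tsupp1P => b sb; have := le_trans (max1 b sb) l1; have := sY b sb; have := theta_supp sb.
  case: (b) (vx) ux vx0 => [[[[[e1 e2] e3] e4] e5] e6] [[[[[f1 f2] f3] f4] f5] f6].
  rewrite /l /degK /dega /degx /degz /degu /degv /= => -> -> [u5 u6] [-> -> -> ->] e56.
  by have [-> ->] := sum_le0 _ _ u5 u6 e56.
have Yg : Yn * g = (tcoef (Th Yn) (- vx) * q ^ form (- vx) vx) *: 1.
  by apply: Tinj; rewrite thetaM {1}YE ge -scalerAl torusM addNr tX0 scalerA !thE.
have nz : tcoef (Th Yn) (- vx) * q ^ form (- vx) vx != 0.
  rewrite mulf_neq0 ?expfz_neq0 //; apply: contraNneq Y0 => Y00.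
  by rewrite YE Y00 scale0r.
have /eqP[] := ginv ((tcoef (Th Yn) (- vx) * q ^ form (- vx) vx)^-1 *: Yn).
by rewrite -scalerAl Yg scalerA mulVf // scale1r.
Qed.

(** The scalar in front of the image of [e'] does not affect q-commutations, so
    the latter constrain the exponents of the image [g] of an element. *)
Lemma qcomm_image_supp g e' e c r : Th e' = X e -> c != 0 ->
  g * (c *: e') = q ^ r *: ((c *: e') * g) ->
  forall b, b \in tsupp (Th g) -> form b e - form e b = r.
Proof.
move=> e'E c0 gce b sb.
have ge : g * e' = q ^ r *: (e' * g).
  rewrite -[e' in LHS](scale1r e') -(mulVf c0) -scalerA -scalerAr gce scalerA mulrC.
  by rewrite -scalerA -scalerAl (scalerA _ c) mulVf // scale1r.
have : X e * Th g = q ^ (- r) *: (Th g * X e).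
  by rewrite -e'E -!thetaM ge thetaZ scalerA -expfzDr // addNr scale1r.
by move/qcomm_supp => /(_ b sb) /(qz_inj q_not_root) er; lia.
Qed.

Definition uvmon s t : D := hu ^+ s * hv ^+ t.

Lemma theta_uvmon s t : Th (uvmon s t) = X (0, 0, 0, 0, s%:Z, t%:Z).
Proof. by rewrite -theta_nmon nmonE !invexpz0 !mul1r. Qed.

Lemma uvmon_inj c c' s t s' t' : c != 0 ->
  c *: uvmon s t = c' *: uvmon s' t' -> s = s' /\ t = t'.
Proof.
move=> c0 /(congr1 Th); rewrite !thetaZ !theta_uvmon.
move/(congr1 (fun f => tcoef f (0, 0, 0, 0, s%:Z, t%:Z))).
rewrite !tcoefZ !tcoefX eqxx mulr1; have [[-> ->] //|_] := eqVneq.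
by rewrite mulr0 => /eqP; rewrite (negPf c0).
Qed.

Lemma uvmonM s t s' t' : uvmon s t * uvmon s' t' = uvmon (s + s') (t + t').
Proof.
apply: Tinj; rewrite thetaM !theta_uvmon torusM /torus_form /degK /dega /degx /degz /degu /degv /=.
by rewrite !(mulr0, mul0r) expr0z scale1r.
Qed.

Lemma uvmonX s t l : uvmon s t ^+ l = uvmon (s * l) (t * l).
Proof.
elim: l => [|l IHl]; first by rewrite !muln0 /uvmon !expr0 mulr1.
by rewrite exprS IHl uvmonM !mulnS.
Qed.

Lemma uvmon10 : uvmon 1 0 = hu. Proof. by rewrite /uvmon expr1 expr0 mulr1. Qed.
Lemma uvmon01 : uvmon 0 1 = hv. Proof. by rewrite /uvmon expr1 expr0 mul1r. Qed.

Section FixingTorus.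

Section Images.
Variable psi : aut.
Hypotheses (psik : psi (hk d) = hk d) (psia : psi (ha d) = ha d).

Lemma fix_comm_ka g : g * hk d = hk d * g -> g * ha d = ha d * g ->
  forall b, b \in tsupp (Th (psi g)) -> degK b = 0 /\ dega b = 0.
Proof.
move=> gk ga; apply: comm_ka_supp; rewrite invexpz1.
  by rewrite -{1}psik -autM gk autM psik.
by rewrite -{1}psia -autM ga autM psia.
Qed.

Lemma fix_uv g : g != 0 -> normal_elt g -> g * hk d = hk d * g -> g * ha d = ha d * g ->
  exists c s t, c != 0 /\ psi g = c *: uvmon s t.
Proof.
move=> g0 gn gk ga.
have [c [i [j [s [t [c0 gE]]]]]] :=
  normal_nmon q_not_root m0 n0 (aut_neq0 psi g0) (aut_normal psi gn).
exists c, s, t; split=> //; have := @fix_comm_ka _ gk ga (i, j, 0, 0, s%:Z, t%:Z).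
rewrite gE thetaZ theta_nmon in_tsupp tcoefZ tcoefX eqxx mulr1 => /(_ c0).
by rewrite /degK /dega /= => -[-> ->]; rewrite nmonE !invexpz0 !mul1r.
Qed.
End Images.

Lemma hu_comm_k : hu * hk d = hk d * hu.
Proof.
apply: Tinj; rewrite -[hk d](invexpz1 _ (hkV d)) !thetaM theta_k theta_u !torusM.
by rewrite /torus_form /degK /dega /degx /degz /degu /degv /= !(mulr0, mul0r) [(_, _, _, _, _,
  _) + _]addrC.
Qed.
Lemma hu_comm_a : hu * ha d = ha d * hu.
Proof.
apply: Tinj; rewrite -[ha d](invexpz1 _ (haV d)) !thetaM theta_a theta_u !torusM.
by rewrite /torus_form /degK /dega /degx /degz /degu /degv /= !(mulr0, mul0r) [(_, _, _, _, _,
  _) + _]addrC.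
Qed.
Lemma hv_comm_k : hv * hk d = hk d * hv.
Proof.
apply: Tinj; rewrite -[hk d](invexpz1 _ (hkV d)) !thetaM theta_k theta_v !torusM.
by rewrite /torus_form /degK /dega /degx /degz /degu /degv /= !(mulr0, mul0r) [(_, _, _, _, _,
  _) + _]addrC.
Qed.
Lemma hv_comm_a : hv * ha d = ha d * hv.
Proof.
apply: Tinj; rewrite -[ha d](invexpz1 _ (haV d)) !thetaM theta_a theta_v !torusM.
by rewrite /torus_form /degK /dega /degx /degz /degu /degv /= !(mulr0, mul0r) [(_, _, _, _, _,
  _) + _]addrC.
Qed.

Let p1_neq0 : q ^ (2 * m ^+ 2) != 0. Proof. exact: expfz_neq0. Qed.
Let p2_neq0 : q ^ (- (2 * n ^+ 2)) != 0. Proof. exact: expfz_neq0. Qed.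
Let inv_q i : (q ^ i)^-1 = q ^ (- i). Proof. exact: invr_expz. Qed.

Lemma hyu : y * hu = q ^ (- (2 * m ^+ 2)) *: (hu * y).
Proof.
rewrite -inv_q.
exact: (@partner_qcomm x y hu hu _ _ hx_neq0 (cu_neq0 q_not_root m0) p1_neq0 erefl erefl hxu).
Qed.
Lemma hyv : y * hv = hv * y.
Proof.
rewrite -[RHS]scale1r -invr1; apply: (@partner_qcomm x y hu hv _ _ hx_neq0 (cu_neq0 q_not_root
  m0)) => //.
- exact: oner_neq0.
- exact: huv.
- by rewrite scale1r hxv.
Qed.
Lemma hwv : w * hv = q ^ (2 * n ^+ 2) *: (hv * w).
Proof.
rewrite -[2 * n ^+ 2]opprK -inv_q.
exact: (@partner_qcomm z w hv hv _ _ hz_neq0 (cv_neq0 q_not_root n0) p2_neq0 erefl erefl hzv).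
Qed.
Lemma hwu : w * hu = hu * w.
Proof.
rewrite -[RHS]scale1r -invr1; apply: (@partner_qcomm z w hv hu _ _ hz_neq0 (cv_neq0 q_not_root
  n0)) => //.
- exact: oner_neq0.
- by rewrite huv.
- by rewrite scale1r hzu.
Qed.

(** [u] q-commutes with each generator, and elements that can be moved across [u]
    form a subalgebra. *)
Lemma hu_normal : normal_elt hu.
Proof.
elim/heis_ind_std=> [s g g' [h1 e1] [h2 e2]|g g' [h1 e1] [h2 e2]|i|i||||].
- by exists (s *: h1 + h2); rewrite mulrDl -scalerAl e1 e2 [RHS]mulrDr -scalerAr.
- by exists (h1 * h2); rewrite -mulrA e2 mulrA e1 mulrA.
- exists (k i); rewrite [RHS]comm_invexpz ?hkkV ?hkVk //; exact: hu_comm_k.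
- exists (a i); rewrite [RHS]comm_invexpz ?haaV ?haVa //; exact: hu_comm_a.
- by exists (q ^ (2 * m ^+ 2) *: x); rewrite -scalerAr hxu.
- by exists (q ^ (- (2 * m ^+ 2)) *: y); rewrite -scalerAr hyu.
- by exists z; rewrite hzu.
- by exists w; rewrite hwu.
Qed.

Lemma hv_normal : normal_elt hv.
Proof.
elim/heis_ind_std=> [s g g' [h1 e1] [h2 e2]|g g' [h1 e1] [h2 e2]|i|i||||].
- by exists (s *: h1 + h2); rewrite mulrDl -scalerAl e1 e2 [RHS]mulrDr -scalerAr.
- by exists (h1 * h2); rewrite -mulrA e2 mulrA e1 mulrA.
- exists (k i); rewrite [RHS]comm_invexpz ?hkkV ?hkVk //; exact: hv_comm_k.
- exists (a i); rewrite [RHS]comm_invexpz ?haaV ?haVa //; exact: hv_comm_a.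
- by exists x; rewrite hxv.
- by exists y; rewrite hyv.
- by exists (q ^ (- (2 * n ^+ 2)) *: z); rewrite -scalerAr hzv.
- by exists (q ^ (2 * n ^+ 2) *: w); rewrite -scalerAr hwv.
Qed.

Variable psi : aut.
Hypotheses (psik : psi (hk d) = hk d) (psia : psi (ha d) = ha d).

Lemma aut_uvmon c s t c' s' t' S T' : psi hu = c *: uvmon s t ->
  psi hv = c' *: uvmon s' t' ->
  psi (uvmon S T') = (c ^+ S * c' ^+ T') *: uvmon (s * S + s' * T') (t * S + t' * T').
Proof.
move=> uE vE; rewrite /uvmon autM !autX uE vE !exprZn !uvmonX.
by rewrite -scalerAl -scalerAr scalerA uvmonM.
Qed.

(** The monoid of the nonzero normal elements that commute with K and a is free
    commutative on [u] and [v] up to scalars. On exponents, [psi] and its inverse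
    act by matrices of natural numbers that are inverse to each other, hence by
    permutation matrices. *)
Lemma fix_permutes : exists c c', [/\ c != 0, c' != 0 &
  (psi hu = c *: hu /\ psi hv = c' *: hv) \/ (psi hu = c *: hv /\ psi hv = c' *: hu)].
Proof.
have ipk : auti psi (hk d) = hk d by rewrite -{1}psik autK.
have ipa : auti psi (ha d) = ha d by rewrite -{1}psia autK.
have U (f : aut) fk fa := @fix_uv f fk fa _ hu_neq0 hu_normal hu_comm_k hu_comm_a.
have V (f : aut) fk fa := @fix_uv f fk fa _ hv_neq0 hv_normal hv_comm_k hv_comm_a.
have [c [s [t [c0 uE]]]] := U _ psik psia.
have [c' [s' [t' [c0' vE]]]] := V _ psik psia.
have [C [S [T' [C0 UE]]]] := U _ ipk ipa.
have [C' [S' [T'' [C0' VE]]]] := V _ ipk ipa.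
have := autVK psi hu; rewrite UE autZ (aut_uvmon S T' uE vE) scalerA -uvmon10.
rewrite -[in RHS](scale1r (uvmon 1 0)) => /esym/(uvmon_inj (oner_neq0 _)) [e1 e2].
have := autVK psi hv; rewrite VE autZ (aut_uvmon S' T'' uE vE) scalerA -uvmon01.
rewrite -[in RHS](scale1r (uvmon 0 1)) => /esym/(uvmon_inj (oner_neq0 _)) [e3 e4].
exists c, c'; split=> //; rewrite uvmon10 uvmon01 uE vE -uvmon10 -uvmon01.
have [[-> -> -> ->]|[-> -> -> ->]] :
    [/\ s = 1, t = 0, s' = 0 & t' = 1]%N \/ [/\ s = 0, t = 1, s' = 1 & t' = 0]%N.
- case: S e1 e2 {UE} => [|S] e1 e2; [right|left].
    have /andP[/eqP s1 /eqP T1] : (s' == 1%N) && (T' == 1%N) by rewrite -muln_eq1; lia.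
    have t0 : t' = 0%N by lia.
    have /andP[/eqP t1 /eqP S1] : (t == 1%N) && (S' == 1%N) by rewrite -muln_eq1; lia.
    by split=> //; lia.
  have t0 : t = 0%N by lia.
  have /andP[/eqP t1 /eqP T1] : (t' == 1%N) && (T'' == 1%N) by rewrite -muln_eq1; lia.
  have T0 : T' = 0%N by lia.
  have /andP[/eqP s1 /eqP S1] : (s == 1%N) && (S.+1 == 1%N) by rewrite -muln_eq1; lia.
  by split=> //; lia.
- by left.
- by right.
Qed.

Let supp_ka g (gk : g * hk d = hk d * g) (ga : g * ha d = ha d * g) :=
  @fix_comm_ka psi psik psia g gk ga.

Let image_qcomm g e r : g * e = q ^ r *: (e * g) ->
  psi g * psi e = q ^ r *: (psi e * psi g).
Proof. by move=> ge; rewrite -!autM ge autZ autM. Qed.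

Let uimage c e vu g r : psi hu = c *: e -> c != 0 -> Th e = X vu ->
  g * hu = q ^ r *: (hu * g) -> forall b, b \in tsupp (Th (psi g)) ->
  form b vu - form vu b = r.
Proof.
move=> uE c0 eE gu; apply: (qcomm_image_supp eE c0).
by rewrite -uE; apply: image_qcomm.
Qed.

Let vimage c e vu g r : psi hv = c *: e -> c != 0 -> Th e = X vu ->
  g * hv = q ^ r *: (hv * g) -> forall b, b \in tsupp (Th (psi g)) ->
  form b vu - form vu b = r.
Proof.
move=> uE c0 eE gu; apply: (qcomm_image_supp eE c0).
by rewrite -uE; apply: image_qcomm.
Qed.

Let comm0 (g e : D) : g * e = e * g -> g * e = q ^ 0 *: (e * g).
Proof. by rewrite expr0z scale1r. Qed.

Let psi_uE : psi hu = (q ^ (2 * m ^+ 2) - 1) *: (psi y * psi x) + 1.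
Proof. by rewrite huE autD autZ autM aut1. Qed.
Let psi_vE : psi hv = (q ^ (- (2 * n ^+ 2)) - 1) *: (psi w * psi z) + 1.
Proof. by rewrite hvE autD autZ autM aut1. Qed.

Let thu := theta_u q_not_root m0 n0.
Let thv := theta_v q_not_root m0 n0.

(** The degree [l] is nonnegative and its maxima on [h] and [g] add up to its
    maximum 0 on [h g]. It is applied with [l] the degree in that one of [u], [v]
    which does not occur in the product. *)
Lemma factor_supp g h u s vu c (l : expo -> int) : s != 0 -> c != 0 ->
  s *: (h * g) + 1 = c *: u -> Th u = X vu -> vu != 0 ->
  {morph l : b b' / b + b'} -> l vu = 0 ->
  (forall g' b, b \in tsupp (Th g') -> 0 <= l b) ->
  forall b, b \in tsupp (Th g) -> l b = 0.
Proof.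
move=> s0 c0 hgE ue vu0 lD lu lpos b sb.
have hgT : s *: (Th h * Th g) = c *: X vu - X 0.
  have := congr1 Th hgE; rewrite thetaD !thetaZ thetaM theta1 ue => <-.
  by rewrite tX0 addrK.
have supp b' : b' \in tsupp (Th h * Th g) -> b' = 0 \/ b' = vu.
  move=> sb'; have := congr1 (fun f => tcoef f b') hgT.
  rewrite tcoefD tcoefN !tcoefZ !tcoefX.
  have [<-|_] := eqVneq 0 b'; first by left.
  have [<-|_] := eqVneq vu b'; first by right.
  rewrite mulr0 subr0 => /eqP; rewrite mulf_eq0 (negPf s0) /=.
  by move: sb'; rewrite in_tsupp => /negPf ->.
have hg0 : Th h * Th g != 0.
  apply/eqP => e; have := congr1 (fun f => tcoef f vu) hgT.
  rewrite e scaler0 tcoef0 tcoefD tcoefN tcoefZ !tcoefX eqxx.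
  by rewrite eq_sym (negPf vu0) subr0 mulr1 => /esym/eqP; rewrite (negPf c0).
have [h0 g0] : Th h != 0 /\ Th g != 0.
  by split; apply: contraNneq hg0 => ->; rewrite ?mul0r ?mulr0.
have [b1 [b2 [s1 s2 /supp s12 _ max2]]] := tsupp_max lD expo_cone h0 g0.
have l0 : l 0 = 0 by apply: (addIr (l 0)); rewrite -lD !add0r.
have arith (i j r : int) : i + j = 0 -> r <= j -> 0 <= r -> 0 <= i -> r = 0.
  by clear; lia.
apply: arith (max2 _ sb) (lpos _ _ sb) (lpos _ _ s1).
by rewrite -lD; case: s12 => ->.
Qed.

(** If [u] and [v] are exchanged, the q-commutations with [u] and [v] show that
    the leading exponents of the images of [x] and [z] consist of a power [z^f]
    and a power [x^g] with [m^2 = - n^2 f] and [n^2 = - m^2 g], up to powers of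
    [u] and [v]. So [f g = 1], and the relation [z x = q^(2mn) x z] becomes
    impossible, as it would be reversed. *)
Lemma fix_no_swap c c' : c != 0 -> c' != 0 ->
  psi hu = c *: hv -> psi hv = c' *: hu -> False.
Proof.
move=> c0 c0' uE vE.
have lu (b b' : expo) : degu (b + b') = degu b + degu b' by [].
have lv (b b' : expo) : degv (b + b') = degv b + degv b' by [].
have x0 := theta_neq0 q_not_root m0 n0 (aut_neq0 psi hx_neq0).
have z0 := theta_neq0 q_not_root m0 n0 (aut_neq0 psi hz_neq0).
have [b sb] := tsupp_neq0 x0; have [b' sb'] := tsupp_neq0 z0.
have xu := uimage uE c0 thv hxu; have xv := vimage vE c0' thu (comm0 hxv).
have zu := uimage uE c0 thv (comm0 hzu); have zv := vimage vE c0' thu hzv.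
have eub e : e \in tsupp (Th (psi x)) -> degu e = 0.
  apply: (@factor_supp (psi x) (psi y) hv _ _ c degu (cu_neq0 q_not_root m0) c0 _ thv) => //.
    by rewrite -psi_uE.
  by move=> g' e' /theta_supp [].
have evb e : e \in tsupp (Th (psi z)) -> degv e = 0.
  apply: (@factor_supp (psi z) (psi w) hu _ _ c' degv (cv_neq0 q_not_root n0) c0' _ thu) => //.
    by rewrite -psi_vE.
  by move=> g' e' /theta_supp [].
have zx : psi z * psi x = q ^ (2 * m * n) *: (psi x * psi z).
  by apply: image_qcomm; exact: hzx.
have [e1 lx] := lead_ex expo_cone x0; have [e2 lz] := lead_ex expo_cone z0.
have := congr1 (fun f => tcoef f (e2 + e1)) (congr1 Th zx).
rewrite thetaZ !thetaM tcoefZ (tcoef_leadM expo_cone lz lx).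
rewrite [e2 + e1]addrC (tcoef_leadM expo_cone lx lz).
rewrite [tcoef (Th (psi x)) e1 * _]mulrC mulrCA.
have nz : tcoef (Th (psi z)) e2 * tcoef (Th (psi x)) e1 != 0.
  by rewrite mulf_neq0 // -in_tsupp; [case: lz|case: lx].
move/(mulfI nz); rewrite /= -expfzDr // => /(qz_inj q_not_root).
have [sx _] := lx; have [sz _] := lz.
have [k1 a1] := supp_ka (hxk d) (hxa d) sx; have [k2 a2] := supp_ka (hzk d) (hza d) sz.
have := xu _ sx; have := xv _ sx; have := zu _ sz; have := zv _ sz.
have := eub _ sx; have := evb _ sz; move: k1 a1 k2 a2.
clear - m0 n0 e1 e2; case: e1 e2 => [[[[[f1 f2] f3] f4] f5] f6] [[[[[g1 g2] g3] g4] g5] g6].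
rewrite /torus_form /degK /dega /degx /degz /degu /degv /= => -> -> -> -> -> -> e3 e4 e5 e6.
have -> : f3 = 0 by apply/eqP; have := m0; nia.
have -> : g4 = 0 by apply/eqP; have := n0; nia.
move=> e7; have f4n : m ^+ 2 = - n ^+ 2 * f4 by lia.
have g3m : n ^+ 2 = - m ^+ 2 * g3 by lia.
have m2 : 0 < m ^+ 2 by rewrite exprn_even_gt0.
have n2 : 0 < n ^+ 2 by rewrite exprn_even_gt0.
have fg : f4 * g3 = 1.
  have n20 : n ^+ 2 != 0 by rewrite lt0r_neq0.
  by apply: (mulfI n20); rewrite {2}g3m f4n; ring.
have mn : m * n != 0 by rewrite mulf_neq0.
nia.
Qed.

(** Once [u] and [v] are preserved up to scalars, the q-commutations with K, a,
    [u] and [v] fix the degrees of the images of x, y, z, w in K, a, x and z, and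
    [rigid_pair] applies to both Weyl pairs. *)
Lemma fix_torus : exists c c', [/\ c != 0, c' != 0,
  psi x = c *: x /\ psi y = c^-1 *: y & psi z = c' *: z /\ psi w = c'^-1 *: w].
Proof.
have [c [c' [c0 c0' [[uE vE]|[uE vE]]]]] := fix_permutes; last first.
  by case: (fix_no_swap c0 c0' uE vE).
have xu := uimage uE c0 thu hxu; have xv := vimage vE c0' thv (comm0 hxv).
have yu := uimage uE c0 thu hyu; have yv := vimage vE c0' thv (comm0 hyv).
have zu := uimage uE c0 thu (comm0 hzu); have zv := vimage vE c0' thv hzv.
have wu := uimage uE c0 thu (comm0 hwu); have wv := vimage vE c0' thv hwv.
have [l l0 [xE yE]] : exists2 l, l != 0 & psi x = l *: x /\ psi y = l^-1 *: y.
  apply: (@rigid_pair x y hu _ (0, 0, 1, 0, 0, 0) (0, 0, 0, 0, 1, 0) (psi x) (psi y) c hx_neq0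
    (x_not_left_inv (m := m) (n := n)) (cu_neq0 q_not_root m0)) => //.
  - exact: theta_x.
  - move=> b sb; have := supp_ka (hxk d) (hxa d) sb; have := xu _ sb; have := xv _ sb; move: sb
    => _.
    clear - m0 n0 b; case: b => [[[[[b1 b2] b3] b4] b5] b6]; rewrite /torus_form /degK /dega
      /degx /degz /degu /degv /=.
    move=> e1 e2 [-> ->]; congr (_, _, _, _); apply/eqP; [have := m0|have := n0]; nia.
  - move=> b sb; have := supp_ka (hyk d) (hya d) sb; have := yu _ sb; have := yv _ sb; move: sb
    => _.
    clear - m0 n0 b; case: b => [[[[[b1 b2] b3] b4] b5] b6]; rewrite /torus_form /degK /dega
      /degx /degz /degu /degv /=.
    move=> e1 e2 [-> ->]; congr (_, _, _, _); apply/eqP; [have := m0|have := n0]; nia.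
  - by rewrite -psi_uE.
have [l' l0' [zE wE]] : exists2 l, l != 0 & psi z = l *: z /\ psi w = l^-1 *: w.
  apply: (@rigid_pair z w hv _ (0, 0, 0, 1, 0, 0) (0, 0, 0, 0, 0, 1) (psi z) (psi w) c' hz_neq0
    (z_not_left_inv (m := m) (n := n)) (cv_neq0 q_not_root n0)) => //.
  - exact: theta_z.
  - move=> b sb; have := supp_ka (hzk d) (hza d) sb; have := zu _ sb; have := zv _ sb; move: sb
    => _.
    clear - m0 n0 b; case: b => [[[[[b1 b2] b3] b4] b5] b6]; rewrite /torus_form /degK /dega
      /degx /degz /degu /degv /=.
    move=> e1 e2 [-> ->]; congr (_, _, _, _); apply/eqP; [have := m0|have := n0]; nia.
  - move=> b sb; have := supp_ka (hwk d) (hwa d) sb; have := wu _ sb; have := wv _ sb; move: sb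
    => _.
    clear - m0 n0 b; case: b => [[[[[b1 b2] b3] b4] b5] b6]; rewrite /torus_form /degK /dega
      /degx /degz /degu /degv /=.
    move=> e1 e2 [-> ->]; congr (_, _, _, _); apply/eqP; [have := m0|have := n0]; nia.
  - by rewrite -psi_vE.
by exists l, l'.
Qed.
End FixingTorus.

(** The images of K and a are units, that is monomials, and the relation
    between K and a forces the matrix of their exponents to have determinant 1. *)
Lemma aut_torus (phi : aut) : exists c c' i j i' j', [/\ c != 0, c' != 0,
  phi (hk d) = c *: (k i * a j), phi (ha d) = c' *: (k i' * a j') & i * j' - j * i' = 1].
Proof.
have U g h : g * h = 1 -> h * g = 1 -> exists c i j, c != 0 /\ phi g = c *: (k i * a j).
  move=> gh hg; apply: (unit_nmon q_not_root m0 n0 (h := phi h)).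
    by rewrite -autM gh aut1.
  by rewrite -autM hg aut1.
have [c [i [j [c0 kE]]]] := U _ _ (hkkV d) (hkVk d).
have [c' [i' [j' [c0' aE]]]] := U _ _ (haaV d) (haVa d).
exists c, c', i, j, i', j'; split=> //.
have ak i1 j1 : a j1 * k i1 = q ^ (i1 * j1) *: (k i1 * a j1).
  by rewrite hdka scalerA -expfzDr // subrr scale1r.
have mul4 i1 j1 i2 j2 : (k i1 * a j1) * (k i2 * a j2) =
    q ^ (i2 * j1) *: (k (i1 + i2) * a (j1 + j2)).
  rewrite -!mulrA (mulrA (a j1)) ak -!scalerAl -!scalerAr !mulrA hdkD.
  by rewrite -!mulrA hdaD.
have := congr1 phi (hka d); rewrite autZ !autM kE aE.
rewrite -!scalerAl -!scalerAr !scalerA !mul4 !scalerA [i' + i]addrC [j' + j]addrC.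
move/(congr1 Th); rewrite !thetaZ thetaM theta_k theta_a torusM scalerA [RHS]scalerA.
move/(congr1 (fun f => tcoef f ((i + i', 0, 0, 0, 0, 0) + (0, j + j', 0, 0, 0, 0)))).
rewrite !tcoefZ tcoefX eqxx !mulr1; set F := q ^ form _ _.
have F0 : F != 0 by apply: expfz_neq0.
move/(mulIf F0) => e.
have /(qz_inj q_not_root) : q ^ (i' * j) = q ^ (-1 + i * j').
  rewrite [in RHS]expfzDr // exprN1; apply: (mulfI (mulf_neq0 c0 c0')).
  by rewrite e; ring.
by lia.
Qed.
End Rigidity.

(** * The group of automorphisms *)

Section AutomorphismGroup.
Variables (K : fieldType) (qs : kstar K) (m n : int) (rs : kstar K).
Local Notation q := (val qs).
(* The square root of q is what splits the group of monomial automorphisms. *)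
Local Notation r := (val rs).
Hypothesis rq : r ^+ 2 = q.
Local Notation D := (heis qs m n).
Local Notation d := (heis_std qs m n).
Local Notation k i := (invexpz (hk d) (hkV d) i).
Local Notation a i := (invexpz (ha d) (haV d) i).
Local Notation aut := (algAut D).
Let r0 : r != 0 := valP rs.
Local Notation vec := 'cV[int]_2.
Local Notation KK := (kstar K * kstar K)%type.
Implicit Types (v w : vec) (A B : SL2Z) (t z : KK).

Let rD i j : r ^ i * r ^ j = r ^ (i + j). Proof. by rewrite expfzDr. Qed.
Let qr i : q ^ i = r ^ (2 * i). Proof. by rewrite -rq -exprz_exp. Qed.

(** The normalization by [r] makes the cocycle of the products alternating: it is
    then preserved by SL_2(Z), while that of [K^i a^j] is not. *)
Definition wmon v : D := r ^ (v 0 0 * v 1 0) *: (k (v 0 0) * a (v 1 0)).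

Lemma wmonM v w :
  wmon v * wmon w = r ^ (w 0 0 * v 1 0 - v 0 0 * w 1 0) *: wmon (v + w).
Proof.
have ak i j : a j * k i = q ^ (i * j) *: (k i * a j).
  by rewrite hdka scalerA -expfzDr ?(valP qs) // subrr scale1r.
rewrite /wmon -scalerAl -scalerAr !scalerA -!mulrA (mulrA (a _)) ak -!scalerAl.
rewrite -!scalerAr !scalerA !mulrA hdkD -!mulrA hdaD qr !rD !mxE.
by congr (r ^ _ *: _); ring.
Qed.

Lemma wmon0 : wmon 0 = 1.
Proof. by rewrite /wmon !mxE mul0r expr0z scale1r !invexpz0 mulr1. Qed.

Definition sympl v w : int := w 0 0 * v 1 0 - v 0 0 * w 1 0.

(** The symplectic form vanishes on the multiples of one vector. *)
Lemma sympl_powers (f : vec -> D) v l :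
  (forall v w, f v * f w = r ^ sympl v w *: f (v + w)) -> f 0 = 1 ->
  [/\ f v * f (- v) = 1, f (- v) * f v = 1
    & invexpz (f v) (f (- v)) l = f (l *: v)].
Proof.
move=> fM f0; have f1 i j : f (i *: v) * f (j *: v) = f ((i + j) *: v).
  rewrite fM /sympl !mxE (_ : _ - _ = 0); last by ring.
  by rewrite expr0z scale1r scalerDl.
have v1 : f v = f (1 *: v) by rewrite scale1r.
have vN1 : f (- v) = f ((-1) *: v) by rewrite scaleN1r.
have vV : f v * f (- v) = 1 by rewrite vN1 v1 f1 subrr scale0r.
have Vv : f (- v) * f v = 1 by rewrite vN1 v1 f1 addNr scale0r.
split=> //; elim/int_rec: l => [|l IHl|l IHl]; first by rewrite invexpz0 scale0r f0.
- by rewrite intS [1 + _]addrC invexpzS // IHl v1 f1 addrC.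
- have -> : - (l.+1%:Z) = - l%:Z - 1 by rewrite intS opprD addrC.
  by rewrite invexpzP // IHl vN1 f1 addrC.
Qed.

(** The character of [Z^2] that takes the values [t] on the two basis vectors. *)
Definition kchar t v : K := val t.1 ^ v 0 0 * val t.2 ^ v 1 0.

Let z0 (x : kstar K) : val x != 0 := valP x.

Lemma kchar_neq0 t v : kchar t v != 0.
Proof. by rewrite mulf_neq0 // expfz_neq0. Qed.
Lemma kcharD t v w : kchar t (v + w) = kchar t v * kchar t w.
Proof. by rewrite /kchar !mxE !expfzDr // mulrACA. Qed.
Lemma kcharZ t l v : kchar t (l *: v) = kchar t v ^ l.
Proof. by rewrite /kchar !mxE expfzMl !exprz_exp ![l * _]mulrC. Qed.
Lemma kchar0 t : kchar t 0 = 1.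
Proof. by rewrite /kchar !mxE !expr0z mulr1. Qed.
Lemma kcharM t z v : kchar (t * z)%g v = kchar t v * kchar z v.
Proof. by rewrite /kchar /= !expfzMl mulrACA. Qed.

Let ord2 (i : 'I_2) : i = 0 \/ i = 1.
Proof. by case: i => [[|[|i]] Hi] //; [left|right]; apply: val_inj. Qed.

Lemma mulmx2 (A : 'M[int]_2) v i : (A *m v) i 0 = A i 0 * v 0 0 + A i 1 * v 1 0.
Proof.
rewrite mxE big_ord_recl big_ord1; congr (_ * v _ _ + A _ _ * v _ _).
all: exact: val_inj.
Qed.

(** SL_2(Z) acts on the pairs [t] through their characters, by transport of
    structure. *)
Lemma kchar_act A t v : kchar (SL2Z_act A t) v = kchar t (val (A^-1)%g *m v).
Proof.
rewrite /kchar !mulmx2 /= !expfzMl !expfzDr ?z0 // -!exprz_exp.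
by rewrite mulrACA.
Qed.

Definition vecK : vec := delta_mx 0 0.
Definition veca : vec := delta_mx 1 0.

Lemma vecKE : vecK 0 0 = 1 /\ vecK 1 0 = 0. Proof. by rewrite !mxE. Qed.
Lemma vecaE : veca 0 0 = 0 /\ veca 1 0 = 1. Proof. by rewrite !mxE. Qed.

Lemma vecE v : v = v 0 0 *: vecK + v 1 0 *: veca.
Proof.
by apply/colP => i; rewrite !mxE; case: (ord2 i) => ->; rewrite /= ?mulr1 ?mulr0 ?addr0 ?add0r.
Qed.

Lemma wmon_vecK : wmon vecK = hk d.
Proof. by rewrite /wmon !vecKE.1 !vecKE.2 mulr0 expr0z scale1r invexpz0 mulr1 invexpz1. Qed.
Lemma wmon_veca : wmon veca = ha d.
Proof. by rewrite /wmon !vecaE.1 !vecaE.2 mul0r expr0z scale1r invexpz0 mul1r invexpz1. Qed.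

Lemma wmon_comm (g : D) v : g * hk d = hk d * g -> g * ha d = ha d * g ->
  g * wmon v = wmon v * g.
Proof.
move=> gk ga; rewrite /wmon -scalerAr -scalerAl; congr (_ *: _).
rewrite mulrA (comm_invexpz _ (hkkV d) (hkVk d) gk) -mulrA.
by rewrite (comm_invexpz _ (haaV d) (haVa d) ga) mulrA.
Qed.

Lemma det2 A : val A 0 0 * val A 1 1 - val A 0 1 * val A 1 0 = 1.
Proof.
have := SL2Z_det A; rewrite (expand_det_row _ 0) big_ord_recl big_ord1 /cofactor.
rewrite !det_mx11 !mxE /= expr0 expr1 mul1r mulN1r mulrN.
apply: eq_trans; congr (val A _ _ * val A _ _ - val A _ _ * val A _ _).
all: exact: val_inj.
Qed.

(** The abstract group of the theorem: a pair of scalars for K and a, a matrix,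
    and a pair of scalars for E' and F'. *)
Definition param : groupType := (semidirect (SL2Z_action K) * KK)%type.
Implicit Types (p : param).
Notation ptorus p := (p.1.1 : KK).
Notation pmat p := (val (p.1.2 : SL2Z)).
Notation pscal p := (p.2 : KK).

(** The matrix acts first, then the character. In this order the composition
    of two such maps is the product of the semidirect product. *)
Definition wimage p v : D := kchar (ptorus p) (pmat p *m v) *: wmon (pmat p *m v).

Lemma sympl_mulmx A v w : sympl (val A *m v) (val A *m w) = sympl v w.
Proof.
rewrite /sympl !mulmx2.
transitivity ((val A 0 0 * val A 1 1 - val A 0 1 * val A 1 0) *
    (w 0 0 * v 1 0 - v 0 0 * w 1 0)); last by rewrite det2 mul1r.
by ring.
Qed.

Lemma wimageM p v w : wimage p v * wimage p w = r ^ sympl v w *: wimage p (v + w).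
Proof.
rewrite /wimage -scalerAl -scalerAr scalerA wmonM -/(sympl _ _) sympl_mulmx.
rewrite mulmxDr kcharD [LHS]scalerA [RHS]scalerA.
by congr (_ *: wmon _); rewrite mulrC.
Qed.

Lemma wimage0 p : wimage p 0 = 1.
Proof. by rewrite /wimage mulmx0 kchar0 wmon0 scale1r. Qed.

Lemma wimage_comm p (g : D) v : g * hk d = hk d * g -> g * ha d = ha d * g ->
  g * wimage p v = wimage p v * g.
Proof. by move=> gk ga; rewrite /wimage -scalerAr -scalerAl wmon_comm. Qed.

Lemma wimageV p v : wimage p v * wimage p (- v) = 1.
Proof. by have [] := sympl_powers v 0 (wimageM p) (wimage0 p). Qed.
Lemma wimageVl p v : wimage p (- v) * wimage p v = 1.
Proof. by have [] := sympl_powers v 0 (wimageM p) (wimage0 p). Qed.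

Let zcomm (g h : D) s : g * h = h * g -> (s *: g) * h = h * (s *: g).
Proof. by move=> gh; rewrite -scalerAl -scalerAr gh. Qed.
Let zqcomm (g h : D) s s' c : g * h = c *: (h * g) ->
  (s *: g) * (s' *: h) = c *: ((s' *: h) * (s *: g)).
Proof.
move=> gh; rewrite -!scalerAl -!scalerAr gh !scalerA; congr (_ *: _); ring.
Qed.
Let zweyl (g h : D) (s : kstar K) c : g * h = c *: (h * g) + 1 ->
  (val s *: g) * ((val s)^-1 *: h) = c *: (((val s)^-1 *: h) * (val s *: g)) + 1.
Proof.
move=> gh; rewrite -!scalerAl -!scalerAr gh [val s *: (_ *: _)]scalerA.
by rewrite mulfV // [_ *: (_ *: (h * g))]scalerA mulVf // !scale1r.
Qed.
Let param_ka p : wimage p vecK * wimage p veca = q^-1 *: (wimage p veca * wimage p vecK).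
Proof.
rewrite !wimageM /sympl !vecKE.1 !vecKE.2 !vecaE.1 !vecaE.2 [veca + vecK]addrC scalerA.
by congr (_ *: _); rewrite -exprN1 qr rD.
Qed.

Definition param_data p : heis_data qs m n D.
Proof.
apply: (@HeisData _ _ _ _ D (wimage p vecK) (wimage p (- vecK)) (wimage p veca) (wimage p (- veca))
  (val (pscal p).1 *: hx d) ((val (pscal p).1)^-1 *: hy d)
  (val (pscal p).2 *: hz d) ((val (pscal p).2)^-1 *: hw d)).
- exact: wimageV.
- exact: wimageVl.
- exact: wimageV.
- exact: wimageVl.
- exact: param_ka.
1-4: by apply: zcomm; apply: wimage_comm; rewrite ?hxk ?hyk ?hzk ?hwk ?hxa ?hya ?hza ?hwa.
1-4: by apply: zcomm; apply: wimage_comm; rewrite ?hxk ?hyk ?hzk ?hwk ?hxa ?hya ?hza ?hwa.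
- by apply: zweyl; rewrite hxy.
- by apply: zweyl; rewrite hzw.
- by apply: zqcomm; rewrite hzx.
- by apply: zqcomm; rewrite hzy.
- by apply: zqcomm; rewrite hwx.
- by apply: zqcomm; rewrite hwy.
Defined.

Definition endo p : D -> D := heis_lift (param_data p).

Lemma endoP p : is_alg_morph (endo p). Proof. exact: heis_liftP. Qed.

Lemma endo_k p : endo p (hk d) = wimage p vecK.
Proof. by rewrite heis_stdE [LHS]heis_lift_k. Qed.
Lemma endo_a p : endo p (ha d) = wimage p veca.
Proof. by rewrite heis_stdE [LHS]heis_lift_a. Qed.
Lemma endo_x p : endo p (hx d) = val (pscal p).1 *: hx d.
Proof. by rewrite [in LHS]heis_stdE [LHS]heis_lift_x. Qed.
Lemma endo_y p : endo p (hy d) = (val (pscal p).1)^-1 *: hy d.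
Proof. by rewrite [in LHS]heis_stdE [LHS]heis_lift_y. Qed.
Lemma endo_z p : endo p (hz d) = val (pscal p).2 *: hz d.
Proof. by rewrite [in LHS]heis_stdE [LHS]heis_lift_z. Qed.
Lemma endo_w p : endo p (hw d) = (val (pscal p).2)^-1 *: hw d.
Proof. by rewrite [in LHS]heis_stdE [LHS]heis_lift_w. Qed.
Lemma endo_kV p : endo p (hkV d) = wimage p (- vecK).
Proof. by rewrite heis_stdE [LHS]heis_lift_kV. Qed.
Lemma endo_aV p : endo p (haV d) = wimage p (- veca).
Proof. by rewrite heis_stdE [LHS]heis_lift_aV. Qed.

Lemma endo_wmon p v : endo p (wmon v) = wimage p v.
Proof.
have [_ fM _ fZ _] := alg_morphP (endoP p).
rewrite /wmon fZ fM !(monoid_morph_invexpz _ _ _ (endoP p).2).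
rewrite endo_k endo_kV endo_a endo_aV.
have [_ _ ->] := sympl_powers vecK (v 0 0) (wimageM p) (wimage0 p).
have [_ _ ->] := sympl_powers veca (v 1 0) (wimageM p) (wimage0 p).
rewrite wimageM -vecE scalerA rD /sympl.
have sE l (u : vec) i : (l *: u) i 0 = l * u i 0 by rewrite mxE.
rewrite !sE vecKE.1 vecKE.2 vecaE.1 vecaE.2.
by rewrite !(mulr0, mul0r, mulr1) sub0r subrr expr0z scale1r.
Qed.

Lemma heis_ext_std (f g : D -> D) : is_alg_morph f -> is_alg_morph g ->
  f (hk d) = g (hk d) -> f (ha d) = g (ha d) ->
  f (hx d) = g (hx d) -> f (hy d) = g (hy d) ->
  f (hz d) = g (hz d) -> f (hw d) = g (hw d) -> f =1 g.
Proof. by move=> fm gm; rewrite heis_stdE => *; apply: heis_ext. Qed.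

Lemma id_morph : is_alg_morph (id : D -> D). Proof. by []. Qed.
Lemma comp_morph (f g : D -> D) : is_alg_morph f -> is_alg_morph g -> is_alg_morph (f \o g).
Proof.
move=> [lf [f1 fM]] [lg [g1 gM]]; split=> [c x y|]; first by rewrite /= lg lf.
by split=> [|x y] /=; rewrite ?g1 // gM fM.
Qed.

Lemma endo1 : endo 1%g =1 id.
Proof.
have w1 v : wimage 1%g v = wmon v.
  by rewrite /wimage mul1mx /kchar !exp1rz mulr1 scale1r.
apply: heis_ext_std id_morph _ _ _ _ _ _; first exact: endoP.
- by rewrite endo_k w1 wmon_vecK.
- by rewrite endo_a w1 wmon_veca.
- by rewrite endo_x scale1r.
- by rewrite endo_y invr1 scale1r.
- by rewrite endo_z scale1r.
- by rewrite endo_w invr1 scale1r.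
Qed.

Lemma endoM p p' : endo (p * p')%g =1 endo p \o endo p'.
Proof.
have fZ p1 := let: And5 _ _ _ fZ _ := alg_morphP (endoP p1) in fZ.
have wM v : endo p (wimage p' v) = wimage (p * p')%g v.
  rewrite /wimage fZ endo_wmon /wimage scalerA /= !mulmxA.
  congr (_ *: _); rewrite kcharM kchar_act mulrC; congr (_ * kchar _ _).
  by rewrite mulmxA /= mulmxA mulVmx ?SL2Z_unit // mul1mx.
have v1 : val (pscal (p * p')%g).1 = val (pscal p).1 * val (pscal p').1 by [].
have v2 : val (pscal (p * p')%g).2 = val (pscal p).2 * val (pscal p').2 by [].
apply: heis_ext_std; [exact: endoP | apply: comp_morph; exact: endoP | | | | | |] => /=.
- by rewrite !endo_k wM.
- by rewrite !endo_a wM.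
- by rewrite !endo_x fZ endo_x scalerA [in RHS]mulrC v1.
- by rewrite !endo_y fZ endo_y scalerA v1 invfM mulrC.
- by rewrite !endo_z fZ endo_z scalerA [in RHS]mulrC v2.
- by rewrite !endo_w fZ endo_w scalerA v2 invfM mulrC.
Qed.

Fact paut_subproof p : `[< is_alg_aut (endo p) >].
Proof.
apply/asboolP; have [lf mf] := endoP p; split=> //.
exists (endo p^-1%g) => g; first by rewrite -[LHS]endoM mulVg endo1.
by rewrite -[LHS]endoM mulgV endo1.
Qed.

Definition paut p : aut := Sub (endo p) (paut_subproof p).

Lemma pautE p g : paut p g = endo p g. Proof. by []. Qed.

Lemma pautM : {morph paut : p p' / (p * p')%g}.
Proof. by move=> p p'; apply: algAut_eqP => g; exact: endoM. Qed.

Lemma aut_ext_std (f g : aut) :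
  f (hk d) = g (hk d) -> f (ha d) = g (ha d) ->
  f (hx d) = g (hx d) -> f (hy d) = g (hy d) ->
  f (hz d) = g (hz d) -> f (hw d) = g (hw d) -> f = g.
Proof. by move=> *; apply: algAut_eqP; apply: heis_ext_std => //; exact: aut_morph. Qed.
End AutomorphismGroup.

Section Classification.
Variables (K : fieldType) (qs : kstar K) (m n : int) (rs : kstar K).
Local Notation q := (val qs).
Local Notation r := (val rs).
Hypothesis rq : r ^+ 2 = q.
Hypothesis q_not_root : forall l : nat, (0 < l)%N -> q ^+ l != 1.
Hypotheses (m0 : m != 0) (n0 : n != 0).
Local Notation D := (heis qs m n).
Local Notation d := (heis_std qs m n).
Local Notation k i := (invexpz (hk d) (hkV d) i).
Local Notation a i := (invexpz (ha d) (haV d) i).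
Local Notation aut := (algAut D).
Local Notation KK := (kstar K * kstar K)%type.
Local Notation SD := (semidirect (SL2Z_action K)).
Local Notation param := (param K).
Local Notation paut := (@paut K qs m n rs rq).
Local Notation wmon := (wmon qs m n rs).
Local Notation vec := 'cV[int]_2.
Local Notation Th := (theta q_not_root m0 n0).
Local Notation ptorus p := (p.1.1 : KK).
Local Notation pmat p := (val (p.1.2 : SL2Z)).
Implicit Types (p : param) (A : SL2Z) (t z : KK).

Let r0 : r != 0 := valP rs.
Let x0 := hx_neq0 q_not_root m0 n0.
Let z0 := hz_neq0 q_not_root m0 n0.

Lemma wmon_inj (c c' : K) (v v' : vec) : c != 0 ->
  c *: wmon v = c' *: wmon v' -> v = v' /\ c = c'.
Proof.
move=> c0; have thw b u : Th (b *: wmon u) = (b * r ^ (u 0 0 * u 1 0)) *: tX _ (u 0 0, u 1 0,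
  0, 0, 0, 0).
  rewrite thetaZ -[RHS]scalerA; congr (_ *: _).
  rewrite thetaZ thetaM theta_k theta_a torusM scalerA; congr (_ *: tX _ _).
    by rewrite /torus_form /degK /dega /degx /degz /degu /degv /= !(mulr0, mul0r) mulr1.
  by apply: expo_eqP; rewrite /degK /dega /degx /degz /degu /degv /= !(add0r, addr0).
move/(congr1 Th); rewrite !thw.
move/(congr1 (fun f => tcoef f (v 0 0, v 1 0, 0, 0, 0, 0))).
rewrite !tcoefZ !tcoefX eqxx mulr1.
have [[e0' e1']|_] := eqVneq; last first.
  by rewrite mulr0 => /eqP; rewrite mulf_eq0 (negPf c0) (negPf (expfz_neq0 _ r0)).
rewrite mulr1 -e0' -e1' => /(mulIf (expfz_neq0 _ r0)) ->; split=> //.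
by rewrite (vecE v) (vecE v') -e0' -e1'.
Qed.

Lemma scal_cancel (g : D) (c c' : K) : g != 0 -> c *: g = c' *: g -> c = c'.
Proof.
move=> g0 /eqP; rewrite -subr_eq0 -scalerBl => /eqP cg; apply/eqP; rewrite -subr_eq0.
apply: contraNT g0 => cc; rewrite -[g]scale1r -(mulVf cc) -scalerA cg.
by rewrite scaler0.
Qed.

Let ord2 (i : 'I_2) : i = 0 \/ i = 1.
Proof. by case: i => [[|[|i]] Hi] //; [left|right]; apply: val_inj. Qed.

(** The parameters are recovered from the images of K, a, x and z. *)
Lemma paut_inj : injective paut.
Proof.
move=> p p' pp'; have e g : endo (m := m) (n := n) rq p g = endo rq p' g by rewrite -!pautE pp'.
have := e (hk d); rewrite !endo_k /wimage => /(wmon_inj (kchar_neq0 _ _)) [eA0 ek0].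
have := e (ha d); rewrite !endo_a /wimage => /(wmon_inj (kchar_neq0 _ _)) [eA1 ek1].
have := e (hx d); rewrite !endo_x => /(scal_cancel x0) es1.
have := e (hz d); rewrite !endo_z => /(scal_cancel z0) es2.
have eA : pmat p = pmat p'.
  apply/matrixP => i j; have [j0|j1] := ord2 j.
    have := congr1 (fun u : vec => u i 0) eA0; rewrite !mulmx2.
    by rewrite !(vecKE.1, vecKE.2) !(mulr0, mulr1, addr0) j0.
  have := congr1 (fun u : vec => u i 0) eA1; rewrite !mulmx2.
  by rewrite !(vecaE.1, vecaE.2) !(mulr0, mulr1, add0r) j1.
have et (v : vec) : kchar (ptorus p) v = kchar (ptorus p') v.
  rewrite -[v](mulKVmx (SL2Z_unit p.1.2)) [invmx _ *m v]vecE mulmxDr -!scalemxAr.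
  by rewrite !kcharD !kcharZ ek0 ek1 eA.
have := et vecK; have := et veca; rewrite /kchar !(vecKE.1, vecKE.2, vecaE.1, vecaE.2).
rewrite !expr0z !expr1z !mulr1 !mul1r => et2 et1.
case: p p' eA es1 es2 et1 et2 {pp' e eA0 ek0 eA1 ek1 et} => [[[t1 t2] A] [s1 s2]].
case=> [[[t1' t2'] A'] [s1' s2']] /= eA es1 es2 et1 et2.
by congr (((_, _), _), (_, _)); apply: val_inj.
Qed.

Let kmk (c : K) (c0 : c != 0) : kstar K := Sub c c0.

(** Composing with the inverse of a monomial automorphism reduces to the
    automorphisms that fix K and a. *)
Lemma paut_surj (phi : aut) : exists p, paut p = phi.
Proof.
have [c [c' [i [j [i' [j' [c0 c0' kE aE ij]]]]]]] := aut_torus q_not_root m0 n0 phi.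
pose M : 'M[int]_2 := \matrix_(u < 2, v < 2)
  if u == 0 then (if v == 0 then i else i') else (if v == 0 then j else j').
have M1 : \det M == 1.
  rewrite (expand_det_row _ 0) big_ord_recl big_ord1 /cofactor !det_mx11 !mxE /=.
  by rewrite expr0 expr1 mul1r mulN1r mulrN -ij [j * i']mulrC.
pose A : SL2Z := Sub M M1.
have b0 : c * r ^ (- (i * j)) != 0 by rewrite mulf_neq0 // expfz_neq0.
have b1 : c' * r ^ (- (i' * j')) != 0 by rewrite mulf_neq0 // expfz_neq0.
pose p : param := ((SL2Z_act A (kmk b0, kmk b1), A), 1%g).
have Ae0 : (val A *m vecK) 0 0 = i /\ (val A *m vecK) 1 0 = j.
  by rewrite !mulmx2 vecKE.1 vecKE.2 !mulr1 !mulr0 !addr0 !mxE.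
have Ae1 : (val A *m veca) 0 0 = i' /\ (val A *m veca) 1 0 = j'.
  by rewrite !mulmx2 vecaE.1 vecaE.2 !mulr1 !mulr0 !add0r !mxE.
have pk : paut p (hk d) = phi (hk d).
  rewrite pautE endo_k /wimage kchar_act mulmxA mulVmx ?SL2Z_unit // mul1mx.
  rewrite /kchar vecKE.1 vecKE.2 expr1z expr0z mulr1 /wmon Ae0.1 Ae0.2 scalerA /= -mulrA.
  by rewrite -expfzDr // addNr expr0z mulr1 kE.
have pa : paut p (ha d) = phi (ha d).
  rewrite pautE endo_a /wimage kchar_act mulmxA mulVmx ?SL2Z_unit // mul1mx.
  rewrite /kchar vecaE.1 vecaE.2 expr1z expr0z mul1r /wmon Ae1.1 Ae1.2 scalerA /= -mulrA.
  by rewrite -expfzDr // addNr expr0z mulr1 aE.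
pose psi : aut := ((paut p)^-1 * phi)%g.
have psik : psi (hk d) = hk d by rewrite -[LHS]/(auti _ (phi _)) -pk autK.
have psia : psi (ha d) = ha d by rewrite -[LHS]/(auti _ (phi _)) -pa autK.
have [e [e' [e0' e0'' [xE yE] [zE wE]]]] := fix_torus q_not_root m0 n0 psik psia.
pose p' : param := (1%g, (kmk e0', kmk e0'')).
have w1 v : wimage qs m n rs p' v = wmon v.
  by rewrite /wimage mul1mx /kchar !exp1rz mulr1 scale1r.
have psiE : psi = paut p'.
  apply: aut_ext_std; rewrite !pautE.
  - by rewrite endo_k w1 wmon_vecK psik.
  - by rewrite endo_a w1 wmon_veca psia.
  - by rewrite endo_x xE.
  - by rewrite endo_y yE.
  - by rewrite endo_z zE.
  - by rewrite endo_w wE.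
by exists (p * p')%g; rewrite pautM -psiE /psi mulgA mulgV mul1g.
Qed.

(** ** The named automorphisms *)

Local Notation S := (heis_S (q := qs) (m := m) (n := n)).

(** The elements fixed by an automorphism form a subalgebra. *)
Lemma heis_S_fixed (phi : aut) :
  (forall s, heis_S s -> phi s = s) <->
  [/\ phi (hx d) = hx d, phi (hy d) = hy d, phi (hz d) = hz d & phi (hw d) = hw d].
Proof.
split=> [fS|[fx fy fz fw] s].
  have sub := @sub_gen_smallest _ (@is_subalgebra K D) [set heis_b' qs m n; heis_c' qs m n;
    heis_E' qs m n; heis_F' qs m n]%classic.
  rewrite -stdE' -stdc' -stdF' -stdb'; split; apply: fS; apply: sub.
  - by left; right.
  - by left; left; right.
  - by right.
  - by left; left; left.
move=> Ss; apply: (Ss [set g | phi g = g]%classic); split.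
- split=> [|c g h /= gE hE|g h /= gE hE]; first exact: aut1.
  + by rewrite autD autZ gE hE.
  + by rewrite autM gE hE.
- by move=> g [[[->|->]|->]|->] /=; rewrite ?stdE' ?stdc' ?stdF' ?stdb'.
Qed.

Lemma wimage_tr t (s : KK) v : wimage qs m n rs ((t, 1%g), s) v = kchar t v *: wmon v.
Proof. by rewrite /wimage mul1mx. Qed.

Lemma kchar_vecK t : kchar t vecK = val t.1.
Proof. by rewrite /kchar vecKE.1 vecKE.2 expr1z expr0z mulr1. Qed.
Lemma kchar_veca t : kchar t veca = val t.2.
Proof. by rewrite /kchar vecaE.1 vecaE.2 expr1z expr0z mul1r. Qed.

Lemma paut_fix_S (s : SD) : forall g, heis_S g -> paut (s, 1%g) g = g.
Proof.
apply/heis_S_fixed; rewrite !pautE endo_x endo_y endo_z endo_w /=.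
by rewrite invr1 !scale1r.
Qed.

Lemma is_zetaP (t : KK) (phi : aut) :
  is_zeta t.1 t.2 phi <-> phi = paut ((t, 1%g), 1%g).
Proof.
rewrite /is_zeta stdKE stdaE; split=> [[pk pa /heis_S_fixed[px py pz pw]]|->].
  apply: aut_ext_std; rewrite ?pautE.
  - by rewrite endo_k wimage_tr kchar_vecK wmon_vecK pk.
  - by rewrite endo_a wimage_tr kchar_veca wmon_veca pa.
  - by rewrite endo_x scale1r.
  - by rewrite endo_y invr1 scale1r.
  - by rewrite endo_z scale1r.
  - by rewrite endo_w invr1 scale1r.
rewrite !pautE endo_k endo_a !wimage_tr kchar_vecK kchar_veca wmon_vecK wmon_veca.
by split=> //; exact: paut_fix_S.
Qed.

Lemma is_xiP (s : KK) (phi : aut) : is_xi s.1 s.2 phi <-> phi = paut (1%g, s).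
Proof.
rewrite /is_xi stdKE stdaE stdE' stdc' stdF' stdb'.
have w1 v : wimage qs m n rs (1%g, s) v = wmon v.
  by rewrite wimage_tr /kchar !exp1rz mulr1 scale1r.
split=> [[[pk pa] [px pz py pw]]|->].
  apply: aut_ext_std; rewrite ?pautE.
  - by rewrite endo_k w1 wmon_vecK pk.
  - by rewrite endo_a w1 wmon_veca pa.
  - by rewrite endo_x.
  - by rewrite endo_y.
  - by rewrite endo_z.
  - by rewrite endo_w.
rewrite !pautE endo_k endo_a !w1 wmon_vecK wmon_veca endo_x endo_y endo_z endo_w.
by [].
Qed.

(** The [rho_A] are stated with the monomials [K^i a^j], without the factor
    [r^(ij)]. They differ from the matrices of the splitting by this scalar part,
    so they do not themselves form a subgroup. *)
Definition rho_scal A : KK :=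
  SL2Z_act A (kstar_expz rs (- (val A 0 0 * val A 1 0)),
              kstar_expz rs (- (val A 0 1 * val A 1 1))).

Lemma rho_wimage A (s : KK) :
  wimage qs m n rs ((rho_scal A, A), s) vecK = k (val A 0 0) * a (val A 1 0) /\
  wimage qs m n rs ((rho_scal A, A), s) veca = k (val A 0 1) * a (val A 1 1).
Proof.
rewrite /wimage !kchar_act !mulmxA !mulVmx ?SL2Z_unit // !mul1mx kchar_vecK kchar_veca.
rewrite /wmon !mulmx2 vecKE.1 vecKE.2 vecaE.1 vecaE.2 !(mulr0, mulr1, addr0, add0r) !scalerA /=.
by rewrite -!expfzDr // !addNr expr0z !scale1r.
Qed.

Lemma is_rhoP A (phi : aut) :
  is_rho A phi <-> phi = paut ((rho_scal A, A), 1%g).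
Proof.
have [w0 w1] := rho_wimage A 1%g.
rewrite /is_rho stdKE stdaE !stdKexp !stdaexp.
split=> [[pk pa /heis_S_fixed[px py pz pw]]|->].
  apply: aut_ext_std; rewrite ?pautE.
  - by rewrite endo_k w0 pk.
  - by rewrite endo_a w1 pa.
  - by rewrite endo_x scale1r.
  - by rewrite endo_y invr1 scale1r.
  - by rewrite endo_z scale1r.
  - by rewrite endo_w invr1 scale1r.
rewrite !pautE endo_k endo_a w0 w1.
by split=> //; exact: paut_fix_S.
Qed.

Local Open Scope classical_set_scope.

Lemma zetas_isom : subgroup_isom (zetas qs m n) KK.
Proof.
exists (fun t : KK => paut ((t, 1%g), 1%g)); split.
- move=> t t'; apply: etrans (@pautM K qs m n rs rq _ _); congr (paut _).
  congr (((_ : KK), _), _) => /=; rewrite ?mulg1 //.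
  by congr (_ * _)%g; rewrite [RHS]SL2Z_act1.
- by move=> t t' /paut_inj [].
- apply/seteqP; split=> [_ [t _ <-]|phi [z1 [z2 h]]].
    by exists t.1, t.2; apply/is_zetaP.
  by exists (z1, z2) => //; apply/esym/is_zetaP.
Qed.

Lemma xis_isom : subgroup_isom (xis qs m n) KK.
Proof.
exists (fun s : KK => paut (1%g, s)); split.
- move=> s s'; apply: etrans (@pautM K qs m n rs rq _ _); congr (paut _).
  by congr pair; rewrite /= mulg1.
- by move=> s s' /paut_inj [].
- apply/seteqP; split=> [_ [t _ <-]|phi [z1 [z2 h]]].
    by exists t.1, t.2; apply/is_xiP.
  by exists (z1, z2) => //; apply/esym/is_xiP.
Qed.

(** The zetas and the rhos generate the whole semidirect product, since each
    [rho_A] lies over [A] and the zetas make up the normal subgroup. *)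
Lemma zetas_rhos_isom :
  subgroup_isom (gen_subgroup (zetas qs m n `|` rhos qs m n)) SD.
Proof.
have sdM (s s' : SD) : paut ((s * s')%g, 1%g) = (paut (s, 1%g) * paut (s', 1%g))%g.
  apply: etrans (@pautM K qs m n rs rq _ _); congr (paut _).
  by congr pair; rewrite /= mulg1.
exists (fun s : SD => paut (s, 1%g)); split=> //.
- by move=> s s' /paut_inj [].
apply/seteqP; split=> [_ [[t A] _ <-]|phi].
  move=> G [[G1 GM GV] sG].
  have -> : (t, A) = ((((t * (rho_scal A)^-1)%g, 1%g) : SD) * ((rho_scal A, A) : SD))%g :> SD.
    congr pair; last by rewrite /= mul1g.
    by rewrite /= SL2Z_act1 -mulgA mulVg mulg1.
  rewrite sdM; apply: GM; apply: sG.
    by left; exists ((t * (rho_scal A)^-1)%g : KK).1, ((t * (rho_scal A)^-1)%g : KK).2;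
      apply/is_zetaP.
  by right; exists A; apply/is_rhoP.
move=> Gphi; apply: (Gphi (range (fun s : SD => paut (s, 1%g)))); split.
- have p1 : paut (1%g, 1%g) = 1%g.
    by apply: (mulgI (paut (1%g, 1%g))); rewrite -[LHS](@pautM K qs m n rs rq) !mulg1.
  split; first by exists 1%g.
    by move=> _ _ [s _ <-] [s' _ <-]; exists (s * s')%g => //; rewrite sdM.
  move=> _ [s _ <-]; exists s^-1%g => //.
  by apply: (mulgI (paut (s, 1%g))); rewrite -sdM !mulgV p1.
- move=> psi [[z1 [z2 h]]|[A h]].
    by exists ((z1, z2), 1%g) => //; apply/esym/is_zetaP.
  by exists (rho_scal A, A) => //; apply/esym/is_rhoP.
Qed.

Lemma aut_isom : group_isom aut (SD * KK)%type.
Proof.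
have invP phi := cid (paut_surj phi).
pose f phi := sval (invP phi); have fK : cancel f paut by move=> phi; exact: (svalP (invP phi)).
have Kf : cancel paut f by move=> p; apply: paut_inj; rewrite fK.
exists f; split; last by exists paut.
by move=> phi psi; apply: paut_inj; rewrite pautM !fK.
Qed.
End Classification.

Local Open Scope classical_set_scope.

Theorem theorem5p3 (K : closedFieldType) (char0 : [pchar K] =i pred0)
    (q : kstar K) (q_not_root : forall l : nat, (0 < l)%N -> val q ^+ l != 1)
    (m n : int) (m_neq0 : m != 0) (n_neq0 : n != 0) :
  [/\ (forall z1 z2 : kstar K,
         exists! phi : algAut (heis q m n), is_zeta z1 z2 phi)
        /\ subgroup_isom (zetas q m n) (kstar K * kstar K)%type,
      (forall A : SL2Z, exists! phi : algAut (heis q m n), is_rho A phi)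
        /\ subgroup_isom (gen_subgroup (zetas q m n `|` rhos q m n))
             (semidirect (SL2Z_action K)),
      (forall z3 z4 : kstar K,
         exists! phi : algAut (heis q m n), is_xi z3 z4 phi)
        /\ subgroup_isom (xis q m n) (kstar K * kstar K)%type
    & group_isom (algAut (heis q m n))
        (semidirect (SL2Z_action K) * (kstar K * kstar K))%type].
Proof.
have [s0 s2] : exists s : K, s ^+ 2 = val q.
  have [s sE] := @solve_monicpoly K 2 (fun i => if i is 0%N then val q else 0) isT.
  by exists s; rewrite sE big_ord_recl big_ord1 /= mul0r addr0 mulr1.
have s_neq0 : s0 != 0.
  by apply: contra_eq_neq s2 => ->; rewrite expr0n /= eq_sym (valP q).
pose r : kstar K := Sub s0 s_neq0; have rq : val r ^+ 2 = val q := s2.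
split; [split | split | split |].
- move=> z1 z2; exists (paut m n rq (((z1, z2), 1%g), 1%g)).
  have H phi := @is_zetaP K q m n r rq (z1, z2) phi.
  by split=> [|phi /H ->//]; apply/H.
- exact: zetas_isom rq q_not_root m_neq0 n_neq0.
- move=> A; exists (paut m n rq ((rho_scal r A, A), 1%g)).
  have H phi := @is_rhoP K q m n r rq A phi.
  by split=> [|phi /H ->//]; apply/H.
- exact: zetas_rhos_isom rq q_not_root m_neq0 n_neq0.
- move=> z3 z4; exists (paut m n rq (1%g, (z3, z4))).
  have H phi := @is_xiP K q m n r rq (z3, z4) phi.
  by split=> [|phi /H ->//]; apply/H.
- exact: xis_isom rq q_not_root m_neq0 n_neq0.
- exact: aut_isom rq q_not_root m_neq0 n_neq0.
Qed.
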